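(* Let $\mathfrak{g}$ be a complex simple finite-dimensional Lie algebra not isomorphic to $\mathfrak{sl}(2,\mathbb{C})$ and let $\lambda\in\mathfrak{h}^*$. Then the $\mathfrak{g}$-module $W^{\mathfrak{g}}_{\mathfrak{b}}(\lambda)$ is a $\theta$-Gelfand--Tsetlin module with finite $\Gamma_\theta$-multiplicities, i.e. $W^{\mathfrak{g}}_{\mathfrak{b}}(\lambda)\in\mathcal{H}_{\rm fin}(\mathfrak{g},\Gamma_\theta)$.
   Context: $\mathfrak{h}$ is a Cartan subalgebra of $\mathfrak{g}$, $\Delta^+$ a positive root system, $\mathfrak{n}=\bigoplus_{\alpha\in\Delta^+}\mathfrak{g}_\alpha$, $\overline{\mathfrak{n}}=\bigoplus_{\alpha\in\Delta^+}\mathfrak{g}_{-\alpha}$, $\mathfrak{b}=\mathfrak{h}\oplus\mathfrak{n}$, $\rho=\frac12\sum_{\alpha\in\Delta^+}\alpha$, $\theta$ the maximal root, $\Delta^+_\theta=\Delta^+\setminus\{\theta\}$. $\{f_\alpha;\,\alpha\in\Delta^+\}$ is a root basis of $\overline{\mathfrak{n}}$ ($f_\alpha\in\mathfrak{g}_{-\alpha}$) with corresponding linear coordinate functions $x_\alpha$ on $\overline{\mathfrak{n}}$, and $u(x)=\sum_{\alpha\in\Delta^+}x_\alpha f_\alpha$. The Weyl algebra $\mathcal{A}$ of $\overline{\mathfrak{n}}$ is generated by $x_\alpha,\partial_{x_\alpha}$ ($\alpha\in\Delta^+$) with the canonical commutation relations. For $\mu\in\mathfrak{h}^*$ there is a Lie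 algebra homomorphism $\pi_\mu\colon\mathfrak{g}\to\mathcal{A}$, $$\pi_\mu(a)=-\sum_{\alpha\in\Delta^+}\bigg[\frac{\operatorname{ad}(u(x))e^{\operatorname{ad}(u(x))}}{e^{\operatorname{ad}(u(x))}-\mathrm{id}}\,(e^{-\operatorname{ad}(u(x))}a)_{\overline{\mathfrak{n}}}\bigg]_\alpha\partial_{x_\alpha}+(\mu+\rho)\big((e^{-\operatorname{ad}(u(x))}a)_{\mathfrak{h}}\big),$$ where $\operatorname{ad}(u(x))$ acts on $\mathbb{C}[\overline{\mathfrak{n}}]\otimes\mathfrak{g}$ (the fraction is the power series $te^t/(e^t-1)$ at the nilpotent operator $t=\operatorname{ad}(u(x))$), $[\cdot]_\alpha$ is the coordinate with respect to $f_\alpha$, and $a_{\overline{\mathfrak{n}}},a_{\mathfrak{h}}$ are the components in $\mathfrak{g}=\overline{\mathfrak{n}}\oplus\mathfrak{h}\oplus\mathfrak{n}$ (all extended $\mathbb{C}[\overline{\mathfrak{n}}]$-linearly). $W^{\mathfrak{g}}_{\mathfrak{b}}(\lambda)=\mathcal{A}/\mathcal{I}_{\rm GT}\simeq\mathbb{C}[\partial_{x_\alpha},\alpha\in\Delta^+_\theta,\,x_\theta]$, where $\mathcal{I}_{\rm GT}$ is the left ideal generated by $x_\alpha$ ($\alpha\in\Delta^+_\theta$) and $\partial_{x_\theta}$, with $\mathfrak{g}$-module structure given through $\pi_{\lambda+\rho}$. Let $(e_\theta,h_\theta,f_\theta)$ be an $\mathfrak{sl}(2,\mathbb{C})$-triple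 associated to $\theta$, with span $\mathfrak{s}_\theta$; $\Gamma_\theta\subset U(\mathfrak{g})$ is the commutative subalgebra generated by $\mathfrak{h}$ and the center of $U(\mathfrak{s}_\theta)$. For a $\mathbb{C}$-algebra homomorphism $\chi\colon\Gamma_\theta\to\mathbb{C}$ and a module $M$ put $M_\chi=\{v\in M;\,(\exists k\in\mathbb{N})(\forall a\in\Gamma_\theta)\,(a-\chi(a))^kv=0\}$; its dimension is the $\Gamma_\theta$-multiplicity of $\chi$. A $\theta$-Gelfand--Tsetlin module is a $\mathfrak{g}$-module $M$ with $M=\bigoplus_{\chi\in\operatorname{Hom}(\Gamma_\theta,\mathbb{C})}M_\chi$; $\mathcal{H}_{\rm fin}(\mathfrak{g},\Gamma_\theta)$ is the category of such modules with $\dim M_\chi<\infty$ for all $\chi$. *)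

(* Defs.v *)
From HB Require Import structures.
From mathcomp Require Import all_boot all_order all_algebra.
From mathcomp Require Import boolp reals.
From mathcomp Require Import complex mpoly.

Set Implicit Arguments.
Unset Strict Implicit.
Unset Printing Implicit Defensive.

Import GRing.Theory.
Local Open Scope ring_scope.
Local Open Scope quotient_scope.

(* Unital associative algebras presented by generators and relations: the     *)
(* quotient of the set of formal expressions in the generators by the         *)
(* congruence spanned by the algebra axioms and the relations. Both the       *)
(* universal enveloping algebra and the Weyl algebra are obtained this way.   *)

Section Terms.
Variables (K : fieldType) (X : Type).

Inductive term :=
| TConst of K
| TGen of X
| TAdd of term & term
| TMul of term & term.

Definition TSub (s t : term) := TAdd s (TMul (TConst (-1)) t).

Inductive pcongr (r : term -> term -> Prop) : term -> term -> Prop :=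
| pc_rel s t : r s t -> pcongr r s t
| pc_refl s : pcongr r s s
| pc_sym s t : pcongr r s t -> pcongr r t s
| pc_trans s t u : pcongr r s t -> pcongr r t u -> pcongr r s u
| pc_add s s' t t' :
    pcongr r s s' -> pcongr r t t' -> pcongr r (TAdd s t) (TAdd s' t')
| pc_mul s s' t t' :
    pcongr r s s' -> pcongr r t t' -> pcongr r (TMul s t) (TMul s' t')
| pc_addA s t u : pcongr r (TAdd s (TAdd t u)) (TAdd (TAdd s t) u)
| pc_addC s t : pcongr r (TAdd s t) (TAdd t s)
| pc_add0 s : pcongr r (TAdd (TConst 0) s) s
| pc_addN s : pcongr r (TAdd (TMul (TConst (-1)) s) s) (TConst 0)
| pc_mulA s t u : pcongr r (TMul s (TMul t u)) (TMul (TMul s t) u)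
| pc_mul1 s : pcongr r (TMul (TConst 1) s) s
| pc_mulDl s t u : pcongr r (TMul (TAdd s t) u) (TAdd (TMul s u) (TMul t u))
| pc_mulDr s t u : pcongr r (TMul s (TAdd t u)) (TAdd (TMul s t) (TMul s u))
| pc_constD a b : pcongr r (TConst (a + b)) (TAdd (TConst a) (TConst b))
| pc_constM a b : pcongr r (TConst (a * b)) (TMul (TConst a) (TConst b))
| pc_constC a s : pcongr r (TMul (TConst a) s) (TMul s (TConst a)).

HB.instance Definition _ := gen_eqMixin term.
HB.instance Definition _ := gen_choiceMixin term.

Section Eval.
Variables (M : lmodType K) (act : X -> M -> M).

(* The operator on M denoted by an expression, given the operators denoted by *)
(* the generators.                                                            *)
Fixpoint teval (t : term) (v : M) : M :=
  match t with
  | TConst c => c *: v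
  | TGen x => act x v
  | TAdd s t => teval s v + teval t v
  | TMul s t => teval s (teval t v)
  end.

Hypothesis act_lin : forall x, linear (act x).

Lemma teval_linear t : linear (teval t).
Proof.
elim: t => [c|x|s IHs t IHt|s IHs t IHt] a u v /=.
- by rewrite scalerDr !scalerA mulrC.
- exact: act_lin.
- by rewrite IHs IHt scalerDr addrACA.
- by rewrite IHt IHs.
Qed.

Lemma teval_pcongr (r : term -> term -> Prop) :
  (forall s t, r s t -> teval s =1 teval t) ->
  forall s t, pcongr r s t -> teval s =1 teval t.
Proof.
have tevZ t c v : teval t (c *: v) = c *: teval t v.
  have t0 : teval t 0 = 0.
    by have := teval_linear t (-1) 0 0; rewrite !scaleN1r oppr0 addr0 addNr.
  by have := teval_linear t c v 0; rewrite !addr0 t0 addr0.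
have tevD t u v : teval t (u + v) = teval t u + teval t v.
  by have := teval_linear t 1 u v; rewrite !scale1r.
move=> rP s t; elim=> {s t} /=.
- exact: rP.
- by [].
- by move=> s t _ IH v; rewrite IH.
- by move=> s t u _ IH1 _ IH2 v; rewrite IH1.
- by move=> s s' t t' _ IH1 _ IH2 v; rewrite IH1 IH2.
- by move=> s s' t t' _ IH1 _ IH2 v; rewrite IH2 IH1.
- by move=> s t u v; rewrite addrA.
- by move=> s t v; rewrite addrC.
- by move=> s v; rewrite scale0r add0r.
- by move=> s v; rewrite scaleN1r addNr scale0r.
- by [].
- by move=> s v; rewrite scale1r.
- by [].
- by move=> s t u v; rewrite tevD.
- by move=> a b v; rewrite scalerDl.
- by move=> a b v; rewrite scalerA.
- by move=> a s v; rewrite tevZ.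
Qed.

End Eval.
End Terms.

Arguments TConst {K X}.
Arguments TGen {K X}.

(* The nontriviality proof is what makes the quotient an algType, where 1     *)
(* must differ from 0.                                                        *)
Record presentation (K : fieldType) := Presentation {
  pgen : Type;
  prel : term K pgen -> term K pgen -> Prop;
  pnontriv : ~ pcongr prel (TConst 1) (TConst 0)
}.

Section PresentedAlgebra.
Variables (K : fieldType) (P : presentation K).
Local Notation T := (term K (pgen P)).

Definition pequiv (s t : T) : bool := `[< pcongr (@prel K P) s t >].

Lemma pequiv_is_equiv : equiv_class_of pequiv.
Proof.
split=> [s|s t|s t u].
- exact/asboolP/pc_refl.
- by apply/asboolP/asboolP => /pc_sym.
- by move=> /asboolP st /asboolP tu; apply/asboolP/(pc_trans st tu).
Qed.

Canonical pequiv_equiv := EquivRelPack pequiv_is_equiv.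
Canonical pequiv_encModRel := defaultEncModRel pequiv.

Definition presented := {eq_quot pequiv}.
HB.instance Definition _ := EqQuotient.on presented.
HB.instance Definition _ := Choice.on presented.

Definition pclass (t : T) : presented := \pi_presented t.

Lemma pclassP s t : reflect (pclass s = pclass t) (pequiv s t).
Proof. by apply: (iffP idP) => [/eqmodP|/eqmodP]. Qed.

Lemma pclass_eq s t : pcongr (@prel K P) s t -> pclass s = pclass t.
Proof. by move=> st; apply/pclassP/asboolP. Qed.

Lemma pclass_repr (u : presented) : pclass (repr u) = u.
Proof. exact: reprK. Qed.

Lemma repr_pclass t : pcongr (@prel K P) (repr (pclass t)) t.
Proof. by apply/asboolP/pclassP; rewrite pclass_repr. Qed.

Definition pzero := pclass (TConst 0).
Definition pone := pclass (TConst 1).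
Definition padd (u v : presented) := pclass (TAdd (repr u) (repr v)).
Definition pmul (u v : presented) := pclass (TMul (repr u) (repr v)).
Definition popp (u : presented) := pclass (TMul (TConst (-1)) (repr u)).
Definition pscale (a : K) (u : presented) := pclass (TMul (TConst a) (repr u)).

Lemma paddE s t : padd (pclass s) (pclass t) = pclass (TAdd s t).
Proof. by apply/pclass_eq/pc_add; apply: repr_pclass. Qed.
Lemma pmulE s t : pmul (pclass s) (pclass t) = pclass (TMul s t).
Proof. by apply/pclass_eq/pc_mul; apply: repr_pclass. Qed.
Lemma poppE t : popp (pclass t) = pclass (TMul (TConst (-1)) t).
Proof. by apply/pclass_eq/pc_mul; [apply: pc_refl|apply: repr_pclass]. Qed.
Lemma pscaleE a t : pscale a (pclass t) = pclass (TMul (TConst a) t).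
Proof. by apply/pclass_eq/pc_mul; [apply: pc_refl|apply: repr_pclass]. Qed.

Let pE := (paddE, pmulE, poppE, pscaleE).

Fact paddA : associative padd.
Proof.
move=> u v w; rewrite -(pclass_repr u) -(pclass_repr v) -(pclass_repr w) !pE.
exact/pclass_eq/pc_addA.
Qed.
Fact paddC : commutative padd.
Proof.
move=> u v; rewrite -(pclass_repr u) -(pclass_repr v) !pE.
exact/pclass_eq/pc_addC.
Qed.
Fact padd0 : left_id pzero padd.
Proof.
by move=> u; rewrite -(pclass_repr u) /pzero !pE; apply/pclass_eq/pc_add0.
Qed.
Fact paddN : left_inverse pzero popp padd.
Proof.
by move=> u; rewrite -(pclass_repr u) !pE; apply/pclass_eq/pc_addN.
Qed.

HB.instance Definition _ :=
  GRing.isZmodule.Build presented paddA paddC padd0 paddN.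

Fact pmulA : associative pmul.
Proof.
move=> u v w; rewrite -(pclass_repr u) -(pclass_repr v) -(pclass_repr w) !pE.
exact/pclass_eq/pc_mulA.
Qed.
Fact pmul1l : left_id pone pmul.
Proof.
by move=> u; rewrite -(pclass_repr u) /pone !pE; apply/pclass_eq/pc_mul1.
Qed.
Fact pmul1r : right_id pone pmul.
Proof.
move=> u; rewrite -(pclass_repr u) /pone !pE; apply/pclass_eq.
exact: pc_trans (pc_sym (pc_constC _ _ _)) (pc_mul1 _ _).
Qed.
Fact pmulDl : left_distributive pmul padd.
Proof.
move=> u v w; rewrite -(pclass_repr u) -(pclass_repr v) -(pclass_repr w) !pE.
exact/pclass_eq/pc_mulDl.
Qed.
Fact pmulDr : right_distributive pmul padd.
Proof.
move=> u v w; rewrite -(pclass_repr u) -(pclass_repr v) -(pclass_repr w) !pE.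
exact/pclass_eq/pc_mulDr.
Qed.
Fact pone_neq0 : pone != pzero.
Proof. by apply/eqP => /pclassP/asboolP/pnontriv. Qed.

HB.instance Definition _ := GRing.Zmodule_isNzRing.Build presented
  pmulA pmul1l pmul1r pmulDl pmulDr pone_neq0.

Fact pscaleA a b u : pscale a (pscale b u) = pscale (a * b) u.
Proof.
rewrite -(pclass_repr u) !pE; apply/pclass_eq.
apply: pc_trans (pc_mulA _ _ _ _) (pc_mul (pc_sym (pc_constM _ _ _)) _).
exact: pc_refl.
Qed.
Fact pscale1 : left_id 1 pscale.
Proof. by move=> u; rewrite -(pclass_repr u) !pE; apply/pclass_eq/pc_mul1. Qed.
Fact pscaleDr : right_distributive pscale padd.
Proof.
move=> a u v; rewrite -(pclass_repr u) -(pclass_repr v) !pE.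
exact/pclass_eq/pc_mulDr.
Qed.
Fact pscaleDl u a b : pscale (a + b) u = padd (pscale a u) (pscale b u).
Proof.
rewrite -(pclass_repr u) !pE; apply/pclass_eq.
apply: pc_trans (pc_mul (pc_constD _ _ _) (pc_refl _ _)) (pc_mulDl _ _ _ _).
Qed.

HB.instance Definition _ := GRing.Zmodule_isLmodule.Build K presented
  pscaleA pscale1 pscaleDr pscaleDl.

Fact pscaleAl (a : K) (u v : presented) : a *: (u * v) = a *: u * v.
Proof.
rewrite -(pclass_repr u) -(pclass_repr v).
change (pscale a (pmul (pclass (repr u)) (pclass (repr v))) =
        pmul (pscale a (pclass (repr u))) (pclass (repr v))).
by rewrite !pE; apply/pclass_eq/pc_mulA.
Qed.
Fact pscaleAr (a : K) (u v : presented) : a *: (u * v) = u * (a *: v).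
Proof.
rewrite -(pclass_repr u) -(pclass_repr v).
change (pscale a (pmul (pclass (repr u)) (pclass (repr v))) =
        pmul (pclass (repr u)) (pscale a (pclass (repr v)))).
rewrite !pE; apply/pclass_eq; apply: pc_trans (pc_mulA _ _ _ _) _.
apply: pc_trans (pc_mul (pc_constC _ _ _) (pc_refl _ _)) _.
exact: pc_sym (pc_mulA _ _ _ _).
Qed.

HB.instance Definition _ := GRing.Lmodule_isLalgebra.Build K presented pscaleAl.
HB.instance Definition _ := GRing.Lalgebra_isAlgebra.Build K presented pscaleAr.

Definition pgenerator (x : pgen P) : presented := pclass (TGen x).

Section Action.
Variables (M : lmodType K) (act : pgen P -> M -> M).

(* If act sends the generators to linear operators satisfying the relations,  *)
(* this is the induced algebra action on M; it is junk otherwise.             *)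
Definition paction (u : presented) (v : M) : M := teval act (repr u) v.

Hypothesis act_lin : forall x, linear (act x).
Hypothesis act_rel : forall s t, prel s t -> teval act s =1 teval act t.

Lemma paction_class t v : paction (pclass t) v = teval act t v.
Proof. exact: (teval_pcongr act_lin act_rel (repr_pclass t)). Qed.

Lemma paction_gen x v : paction (pgenerator x) v = act x v.
Proof. by rewrite paction_class. Qed.

Lemma paction1 v : paction 1 v = v.
Proof. by rewrite [LHS]paction_class /= scale1r. Qed.

Lemma pactionD (u u' : presented) v :
  paction (u + u') v = paction u v + paction u' v.
Proof. by rewrite [LHS]paction_class. Qed.

Lemma pactionM (u u' : presented) v :
  paction (u * u') v = paction u (paction u' v).
Proof. by rewrite [LHS]paction_class. Qed.

Lemma pactionZ a (u : presented) v : paction (a *: u) v = a *: paction u v.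
Proof. by rewrite [LHS]paction_class. Qed.

End Action.
End PresentedAlgebra.

Section GeneratedSubalgebra.
Variables (K : fieldType) (A : algType K) (S : A -> Prop).

Definition gensub : {pred A} := fun a =>
  `[< forall B : {pred A}, GRing.subalg_closed B ->
      (forall s, S s -> s \in B) -> a \in B >].

Fact gensub_closed : GRing.subalg_closed gensub.
Proof.
split=> [|a u v /asboolP uS /asboolP vS|u v /asboolP uS /asboolP vS];
  apply/asboolP => B BA SB; have [B1 BZ BM] := BA.
- exact: B1.
- by apply: BZ; [apply: uS|apply: vS].
- by apply: BM; [apply: uS|apply: vS].
Qed.

HB.instance Definition _ := GRing.isSubalgClosed.Build K A gensub
  (GRing.subalg_closed_semi gensub_closed).

Record gensubalg := GenSubAlg { gensub_val : A; _ : gensub_val \in gensub }.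

HB.instance Definition _ := [isSub for gensub_val].
HB.instance Definition _ := [Choice of gensubalg by <:].
HB.instance Definition _ := [SubChoice_isSubAlgebra of gensubalg by <:].

End GeneratedSubalgebra.

Definition center_of (K : fieldType) (A : algType K) (B : {pred A}) (z : A) :=
  z \in B /\ forall b, b \in B -> z * b = b * z.

HB.mixin Record isLieAlgebra (K : fieldType) g of Vector K g := {
  lie : g -> g -> g;
  lie_linear_l : forall y, linear (lie^~ y);
  lie_linear_r : forall x, linear (lie x);
  liexx : forall x, lie x x = 0;
  jacobi : forall x y z,
    lie x (lie y z) + lie y (lie z x) + lie z (lie x y) = 0
}.

#[short(type="lieAlgType")]
HB.structure Definition LieAlgebra (K : fieldType) :=
  {g of isLieAlgebra K g & Vector K g}.

HB.instance Definition _ (K : fieldType) (g : lieAlgType K) (x : g) :=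
  GRing.isLinear.Build K g g _ (lie x) (lie_linear_r x).

Definition ad (K : fieldType) (g : lieAlgType K) (x : g) : 'End(g) :=
  linfun (lie x).

Section LieTheory.
Variables (K : fieldType) (g : lieAlgType K).

Lemma adE (x y : g) : ad x y = lie x y.
Proof. by rewrite lfunE. Qed.

Lemma lieDl (x y z : g) : lie (x + y) z = lie x z + lie y z.
Proof. by have := lie_linear_l z 1 x y; rewrite !scale1r. Qed.

Lemma lie0l (z : g) : lie 0 z = 0.
Proof. by apply: (addIr (lie 0 z)); rewrite -lieDl !add0r. Qed.

Lemma lieZl a (x z : g) : lie (a *: x) z = a *: lie x z.
Proof. by have := lie_linear_l z a x 0; rewrite lie0l !addr0. Qed.

Lemma lie_suml I (r : seq I) (F : I -> g) z :
  lie (\sum_(i <- r) F i) z = \sum_(i <- r) lie (F i) z.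
Proof.
by elim: r => [|i r IH]; rewrite ?big_nil ?lie0l // !big_cons lieDl IH.
Qed.

End LieTheory.

Section LieNotions.
Variables (K : fieldType) (g : lieAlgType K).

Definition simple_lie :=
  (exists x y : g, lie x y != 0) /\
  forall I : {vspace g}, (forall x y, y \in I -> lie x y \in I) ->
    I = 0%VS \/ I = fullv.

(* sl(2) is realised as the traceless 2x2 matrices. *)
Definition isomorphic_to_sl2 :=
  exists phi : 'Hom(g, 'M[K]_2),
    [/\ lker phi == 0%VS,
        forall M, M \in limg phi <-> \tr M = 0 &
        forall x y, phi (lie x y) = phi x *m phi y - phi y *m phi x].

Definition abelian_subspace (a : {vspace g}) :=
  {in a &, forall x y, lie x y = 0}.

Definition ad_diagonalizable (x : g) :=
  exists b : seq g, basis_of fullv b /\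
    {in b, forall v, exists c : K, lie x v = c *: v}.

(* Maximal abelian subalgebra consisting of ad-semisimple elements: the usual *)
(* definition for complex semisimple Lie algebras.                            *)
Definition cartan_subalgebra (h : {vspace g}) :=
  [/\ abelian_subspace h,
      forall a : {vspace g}, abelian_subspace a -> (h <= a)%VS -> a = h &
      {in h, forall x, ad_diagonalizable x}].

End LieNotions.

Section Roots.
Variables (K : fieldType) (g : lieAlgType K) (h : {vspace g}).

Definition dual := 'Hom(subvs_of h, K^o).

Definition root_space (a : dual) : {vspace g} :=
  (\bigcap_(i < \dim (fullv : {vspace subvs_of h}))
     passmx.leigenspace (ad (vsval (tnth (vbasis fullv) i)))
                 (a (tnth (vbasis fullv) i)))%VS.

Lemma root_spaceP (a : dual) (x : g) :
  reflect (forall u : subvs_of h, lie (vsval u) x = (a u : K) *: x)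
          (x \in root_space a).
Proof.
have eigP u : (x \in passmx.leigenspace (ad (vsval u)) (a u)) =
    (lie (vsval u) x == (a u : K) *: x).
  by rewrite memv_ker !lfun_simp ?adE ?subr_eq0.
rewrite memvE; apply: (iffP subv_bigcapP) => [xa u|xa i _]; last first.
  by rewrite -memvE eigP xa.
have /coord_vbasis -> : u \in fullv by rewrite memvf.
rewrite !linear_sum /= [RHS]scaler_suml lie_suml.
apply: eq_bigr => i _.
rewrite lieZl linearZ /=; set b := (vbasis _)`_i.
have /eqP -> : lie (vsval b) x == (a b : K) *: x.
  by rewrite -eigP memvE /b -tnth_nth; apply: xa.
by rewrite scalerA.
Qed.

Definition is_root (a : dual) := (a != 0) && (root_space a != 0%VS).

Definition nat_combination (s : seq dual) (b : dual) :=
  exists c : dual -> nat, b = \sum_(a <- s) a *+ c a.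

Definition root_base (s : seq dual) :=
  [/\ free s, {in s, forall a, is_root a} &
      forall b, is_root b -> nat_combination s b \/ nat_combination s (- b)].

(* The family alpha enumerates, without repetition, the positive roots with   *)
(* respect to some base.                                                      *)
Definition positive_root_system n (alpha : 'I_n -> dual) :=
  injective alpha /\
  exists s, root_base s /\
    forall b, (exists i, b = alpha i) <-> is_root b /\ nat_combination s b.

(* Maximality for the order in which a <= b means that b - a is a sum of      *)
(* positive roots.                                                            *)
Definition maximal_root n (alpha : 'I_n -> dual) (th : 'I_n) :=
  forall b, is_root b -> nat_combination (codom alpha) (b - alpha th) ->
    b = alpha th.

Section Triangular.
Variables (n : nat) (alpha : 'I_n -> dual).

Definition nilp : {vspace g} := (\sum_(i < n) root_space (alpha i))%VS.
Definition nilp_opp : {vspace g} := (\sum_(i < n) root_space (- alpha i))%VS.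

Definition rho : dual := 2^-1 *: \sum_(i < n) alpha i.

(* daddv_pi U V is the projection onto U along V.                             *)
Definition proj_nilp_opp : 'End(g) := daddv_pi nilp_opp (h + nilp)%VS.
Definition proj_h : 'End(g) := daddv_pi h (nilp_opp + nilp)%VS.

Definition root_basis (f : 'I_n -> g) :=
  (forall i, f i \in root_space (- alpha i)) /\ basis_of nilp_opp [tuple f i | i < n].

Definition sl2_triple (th : 'I_n) (e hh f : g) :=
  [/\ e \in root_space (alpha th), hh \in h & f \in root_space (- alpha th)] /\
  [/\ lie hh e = 2 *: e, lie hh f = (- 2) *: f & lie e f = hh].

End Triangular.
End Roots.

Section EnvelopingAlgebra.
Variables (K : fieldType) (g : lieAlgType K).

Inductive env_rel : term K g -> term K g -> Prop :=
| er_linear (a : K) (x y : g) :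
    env_rel (TGen (a *: x + y)) (TAdd (TMul (TConst a) (TGen x)) (TGen y))
| er_lie (x y : g) :
    env_rel (TGen (lie x y))
            (TSub (TMul (TGen x) (TGen y)) (TMul (TGen y) (TGen x))).

Fact env_nontriv : ~ pcongr env_rel (TConst 1) (TConst 0).
Proof.
pose act (x : g) (v : K^o) : K^o := 0.
have act_lin x : linear (act x) by move=> a u v; rewrite /act scaler0 addr0.
have act_rel s t : env_rel s t -> teval act s =1 teval act t.
  by case=> [a x y|x y] v; rewrite /= /act ?scaler0 addr0.
move=> /(teval_pcongr act_lin act_rel)/(_ (1 : K^o)) /= /eqP.
by rewrite scale1r scale0r oner_eq0.
Qed.

Definition env_presentation := Presentation env_nontriv.
Definition env := presented env_presentation.
HB.instance Definition _ := GRing.Algebra.on env.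

Definition env_inj (x : g) : env := @pgenerator K env_presentation x.

Section Modules.
Variables (M : lmodType K) (act : g -> M -> M).

Definition lie_module :=
  [/\ forall x, linear (act x), forall v, linear (act^~ v) &
      forall x y v, act (lie x y) v = act x (act y v) - act y (act x v)].

Definition env_act (u : env) (v : M) : M := @paction K env_presentation M act u v.

Hypothesis actP : lie_module.

Fact env_act_rel s t : env_rel s t -> teval act s =1 teval act t.
Proof.
have [_ act_l act_b] := actP.
case=> [a x y|x y] v /=; first exact: act_l.
by rewrite act_b scaleN1r.
Qed.

Lemma env_act_inj x v : env_act (env_inj x) v = act x v.
Proof. by have [al _ _] := actP; apply: (@paction_gen K env_presentation M act al env_act_rel x v). Qed.

Lemma env_act1 v : env_act 1 v = v.
Proof. by have [al _ _] := actP; apply: (@paction1 K env_presentation M act al env_act_rel v). Qed.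

Lemma env_actD u u' v : env_act (u + u') v = env_act u v + env_act u' v.
Proof. by have [al _ _] := actP; apply: (@pactionD K env_presentation M act al env_act_rel u u' v). Qed.

Lemma env_actM u u' v : env_act (u * u') v = env_act u (env_act u' v).
Proof. by have [al _ _] := actP; apply: (@pactionM K env_presentation M act al env_act_rel u u' v). Qed.

Lemma env_actZ a u v : env_act (a *: u) v = a *: env_act u v.
Proof. by have [al _ _] := actP; apply: (@pactionZ K env_presentation M act al env_act_rel a u v). Qed.

End Modules.

Section GelfandTsetlin.
Variables (h s : {vspace g}).

(* By the PBW theorem this subalgebra is U(s) when s is a Lie subalgebra.     *)
Definition env_sub : {pred env} :=
  gensub (fun u => exists2 x, x \in s & u = env_inj x).

Definition gamma_gens (u : env) :=
  (exists2 x, x \in h & u = env_inj x) \/ center_of env_sub u.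

Definition gamma := gensubalg gamma_gens.
HB.instance Definition _ := GRing.Algebra.on gamma.

Variables (M : lmodType K) (act : g -> M -> M).

Definition gt_component (chi : {lrmorphism gamma -> K^o}) (v : M) :=
  exists k : nat, forall a : gamma,
    env_act act ((gensub_val a - (chi a : K)%:A) ^+ k) v = 0.

(* gt_spanned and gt_independent together say that M is the direct sum of the *)
(* gt_component's; algebra homomorphisms are compared as functions.           *)
Definition gt_spanned :=
  forall v, exists m (chi : 'I_m -> {lrmorphism gamma -> K^o}) (w : 'I_m -> M),
    (forall i, gt_component (chi i) (w i)) /\ v = \sum_i w i.

Definition gt_independent :=
  forall m (chi : 'I_m -> {lrmorphism gamma -> K^o}) (w : 'I_m -> M),
    (forall i j, chi i =1 chi j -> i = j) ->
    (forall i, gt_component (chi i) (w i)) ->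
    \sum_i w i = 0 -> forall i, w i = 0.

Definition theta_gelfand_tsetlin := [/\ lie_module act, gt_spanned & gt_independent].

Definition finite_multiplicities :=
  forall chi, exists r (b : 'I_r -> M),
    (forall i, gt_component chi (b i)) /\
    forall v, gt_component chi v -> exists c : 'I_r -> K, v = \sum_i c i *: b i.

Definition H_fin := theta_gelfand_tsetlin /\ finite_multiplicities.

End GelfandTsetlin.
End EnvelopingAlgebra.

Section WeylAlgebra.
Variables (K : fieldType) (n : nat).

(* inl i and inr i name the generators x_i and d/dx_i. *)
Inductive weyl_rel : term K ('I_n + 'I_n) -> term K ('I_n + 'I_n) -> Prop :=
| wr_xx i j : weyl_rel (TSub (TMul (TGen (inl i)) (TGen (inl j)))
                             (TMul (TGen (inl j)) (TGen (inl i)))) (TConst 0)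
| wr_dd i j : weyl_rel (TSub (TMul (TGen (inr i)) (TGen (inr j)))
                             (TMul (TGen (inr j)) (TGen (inr i)))) (TConst 0)
| wr_dx i j : weyl_rel (TSub (TMul (TGen (inr i)) (TGen (inl j)))
                             (TMul (TGen (inl j)) (TGen (inr i))))
                       (TConst (i == j)%:R).

Fact weyl_nontriv : ~ pcongr weyl_rel (TConst 1) (TConst 0).
Proof.
pose act (x : 'I_n + 'I_n) (p : {mpoly K[n]}) : {mpoly K[n]} :=
  match x with inl i => 'X_i * p | inr i => p^`M(i) end.
have act_lin x : linear (act x).
  case: x => i a u v /=; last exact: mderiv_is_linear.
  by rewrite mulrDr scalerAr.
have mBm (m : 'X_{1..n}) : (m - m)%MM = 0%MM.
  by apply/mnmP => i; rewrite mnmBE subnn mnm0E.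
have act_rel s t : weyl_rel s t -> teval act s =1 teval act t.
  case=> i j v /=; rewrite scaleN1r.
  - by rewrite scale0r mulrCA subrr.
  - by rewrite scale0r mderiv_comm subrr.
  - rewrite mderivM addrK mderivX mnm1E.
    rewrite eq_sym; case: eqP => [->|_]; last by rewrite !scale0r mul0r.
    by rewrite !scale1r mBm mpolyX0 mul1r.
move=> /(teval_pcongr act_lin act_rel)/(_ 1) /= /eqP.
by rewrite scale1r scale0r oner_eq0.
Qed.

Definition weyl_presentation := Presentation weyl_nontriv.
Definition weyl := presented weyl_presentation.
HB.instance Definition _ := GRing.Algebra.on weyl.

Definition wx (i : 'I_n) : weyl := @pgenerator K weyl_presentation (inl i).
Definition wd (i : 'I_n) : weyl := @pgenerator K weyl_presentation (inr i).

Definition weyl_of_poly (p : {mpoly K[n]}) : weyl := mmap (fun c => c%:A) wx p.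

End WeylAlgebra.

(* As A is unital, the left ideal generated by the G i is the set of their    *)
(* left combinations.                                                         *)
Section LeftIdealQuotient.
Variables (K : fieldType) (A : algType K) (m : nat) (G : 'I_m -> A).

Definition left_ideal : {pred A} :=
  fun a => `[< exists c : 'I_m -> A, a = \sum_i c i * G i >].

Fact left_ideal_zmod : zmod_closed left_ideal.
Proof.
split=> [|a b /asboolP[c ->] /asboolP[c' ->]]; apply/asboolP.
  by exists (fun=> 0); rewrite big1 // => i _; rewrite mul0r.
exists (fun i => c i - c' i); rewrite -sumrB.
by apply: eq_bigr => i _; rewrite mulrBl.
Qed.

HB.instance Definition _ := GRing.isZmodClosed.Build A left_ideal left_ideal_zmod.

Lemma left_idealM a b : b \in left_ideal -> a * b \in left_ideal.
Proof.
move=> /asboolP[c ->]; apply/asboolP; exists (fun i => a * c i).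
by rewrite mulr_sumr; apply: eq_bigr => i _; rewrite mulrA.
Qed.

Definition lquot := Quotient.quot left_ideal.
HB.instance Definition _ := GRing.Zmodule.on lquot.
HB.instance Definition _ := EqQuotient.on lquot.

Definition lclass (a : A) : lquot := \pi_lquot a.

Definition lact (a : A) (w : lquot) : lquot := lclass (a * repr w).

Lemma lclassP a b : lclass a = lclass b <-> a - b \in left_ideal.
Proof.
by rewrite Quotient.idealrBE; split=> [e|/eqP//]; apply/eqP.
Qed.

Lemma lclassD a b : lclass (a + b) = lclass a + lclass b.
Proof. exact: (Quotient.pi_add left_ideal). Qed.

Lemma lclass_repr (w : lquot) : lclass (repr w) = w.
Proof. exact: reprK. Qed.

Lemma lactE a b : lact a (lclass b) = lclass (a * b).
Proof.
by apply/lclassP; rewrite -mulrBr; apply/left_idealM/lclassP/lclass_repr.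
Qed.

Definition lscale (a : K) (w : lquot) : lquot := lact a%:A w.

Lemma lscaleE a b : lscale a (lclass b) = lclass (a *: b).
Proof. by rewrite /lscale lactE mulr_algl. Qed.

Fact lscaleA a b w : lscale a (lscale b w) = lscale (a * b) w.
Proof. by rewrite -(lclass_repr w) !lscaleE scalerA. Qed.
Fact lscale1 : left_id 1 lscale.
Proof. by move=> w; rewrite -(lclass_repr w) !lscaleE scale1r. Qed.
Fact lscaleDr : right_distributive lscale +%R.
Proof.
move=> a u v; rewrite -(lclass_repr u) -(lclass_repr v) -lclassD !lscaleE.
by rewrite scalerDr lclassD.
Qed.
Fact lscaleDl w a b : lscale (a + b) w = lscale a w + lscale b w.
Proof. by rewrite -(lclass_repr w) !lscaleE -lclassD scalerDl. Qed.

HB.instance Definition _ := GRing.Zmodule_isLmodule.Build K lquot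
  lscaleA lscale1 lscaleDr lscaleDl.

End LeftIdealQuotient.

(* Coefficients of t e^t / (e^t - 1) = e^t / (sum_k t^k / (k+1)!); they are   *)
(* determined by todd_coefP.                                                  *)
Section Todd.
Variable K : fieldType.

Fixpoint todd_seq (m : nat) : seq K :=
  if m is k.+1 then
    let s := todd_seq k in
    rcons s (k`!%:R^-1 - \sum_(j < k) s`_j / ((k - j).+1)`!%:R)
  else [::].

Definition todd_coef (k : nat) : K := (todd_seq k.+1)`_k.

Lemma todd_coefP m :
  \sum_(k < m.+1) todd_coef k / ((m - k).+1)`!%:R = m`!%:R^-1.
Proof.
have size_ts k : size (todd_seq k) = k by elim: k => //= k IH; rewrite size_rcons IH.
have nth_ts k j : (j < k)%N -> (todd_seq k)`_j = todd_coef j.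
  elim: k => // k IH; rewrite ltnS leq_eqVlt => /predU1P[->//|jk].
  by rewrite /= nth_rcons size_ts jk IH.
rewrite big_ord_recr /= subnn divr1 {2}/todd_coef /= nth_rcons size_ts ltnn eqxx.
rewrite (eq_bigr (fun j : 'I_m => (todd_seq m)`_j / ((m - j).+1)`!%:R)).
  by rewrite addrC subrK.
by move=> j _; rewrite nth_ts.
Qed.

End Todd.

Section Realization.
Variables (K : fieldType) (g : lieAlgType K) (h : {vspace g}).
Variables (n : nat) (alpha : 'I_n -> dual h) (f : 'I_n -> g).

Local Notation P := {mpoly K[n]}.
Local Notation d := (\dim {:g}).
Local Notation e := (vbasis {:g}).

(* C[nbar] (x) g is 'rV[P]_d, by means of the basis e of g, and matrices act  *)
(* on it on the right.                                                        *)
Definition ext_vec (a : g) : 'rV[P]_d := map_mx (@mpolyC n K) (passmx.rVof e a).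
Definition ext_end (T : 'End(g)) : 'M[P]_d :=
  map_mx (@mpolyC n K) (passmx.mxof e e T).
Definition ext_form (phi : g -> K) (v : 'rV[P]_d) : P :=
  \sum_i v 0 i * (phi (tnth e i))%:MP.

Definition ad_u : 'M[P]_d := \sum_(i < n) 'X_i *: ext_end (ad (f i)).

(* The power series with coefficients c at a nilpotent operator on a free     *)
(* module of rank d, whose d-th power vanishes.                               *)
Definition nilp_series (c : nat -> K) (T : 'M[P]_d) : 'M[P]_d :=
  \sum_(k < d) (c k)%:MP *: T ^+ k.

Definition exp_neg_ad_u (a : g) : 'rV[P]_d :=
  ext_vec a *m nilp_series (fun k => (k`!)%:R^-1) (- ad_u).

Definition vector_field_coef (a : g) (i : 'I_n) : P :=
  ext_form (coord [tuple f j | j < n] i)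
    (exp_neg_ad_u a *m ext_end (proj_nilp_opp alpha)
       *m nilp_series (@todd_coef K) ad_u).

Definition pi_mu (mu : dual h) (a : g) : weyl K n :=
  - (\sum_(i < n) weyl_of_poly (vector_field_coef a i) * wd K i)
  + weyl_of_poly (ext_form (fun b => (mu + rho alpha) (vsproj h (proj_h alpha b)))
                           (exp_neg_ad_u a)).

Definition gt_ideal_gens (th i : 'I_n) : weyl K n :=
  if i == th then wd K i else wx K i.

Definition W_gt (th : 'I_n) : lmodType K := lquot (gt_ideal_gens th).

Definition W_gt_act (th : 'I_n) (lambda : dual h) (a : g) :
    W_gt th -> W_gt th :=
  lact (pi_mu (lambda + rho alpha) a).

End Realization.

(* Main.v *)
Require Import Defs.
From HB Require Import structures.
From mathcomp Require Import all_boot all_order all_algebra.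
From mathcomp Require Import boolp reals.
From mathcomp Require Import spectral complex mpoly.
From mathcomp Require Import ring zify.

Set Implicit Arguments.
Unset Strict Implicit.
Unset Printing Implicit Defensive.
Import Order.TTheory GRing.Theory Num.Theory.
Local Open Scope ring_scope.

(** The formula for pi_mu describes the action of the Lie algebra g on the open
cell exp(nbar) of the flag variety, twisted by a line bundle.  For a in g, put
y_a = e^(- ad u) a, an element of g with polynomial coefficients, and let X_a be
the vector field in pi_mu(a).  The derivative of the exponential brings in the
series psi(t) = (1 - e^(- t)) / t, and t e^t / (e^t - 1) is the inverse of psi;
so X_a is the vector field for which X_a(y_b) = [(y_a)_nbar, y_b]
([field_transport]).  Since nbar and b are subalgebras, a formal computation
with the Jacobi identity shows that the derivation [X_a, X_b] - X_[a,b] kills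
every y_c.  The y_c generate and the centre of g is zero, so this derivation
kills u as well, that is, it vanishes ([field_bracket]).  The scalar part of
pi_mu(a) is a linear form on (y_a)_h, and it is a cocycle because [b, b] is
contained in n ([scalar_cocycle]).  Hence pi_mu is a Lie homomorphism
([pi_mu_lie]).

This uses the triangular decomposition g = nbar + h + n.  The operators ad x for
x in h are simultaneously diagonalizable, and maximality of h makes h the space
of weight zero.  An element u0 of h on which every base root equals 1 grades g
by integers, the heights.  The Killing form is nonzero, because its value at
(u0, u0) is the sum of the squares of the heights, counted with multiplicity;
by simplicity it is nondegenerate, so that - alpha is a root when alpha is.  The
decomposition follows, and heights also show that ad u is nilpotent.

As theta is maximal, f_theta is central in nbar and pi_mu(f_theta) is minus the
derivation along x_theta; for x in h, pi_mu(x) is the sum of the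
alpha_i(x) x_i d/dx_i plus a constant ([pi_mu_f], [pi_mu_h]).  A Fourier
transform in all variables except x_theta turns W into a polynomial ring on
which h acts diagonally, the monomials being weight vectors, and f_theta is
locally nilpotent.  In one weight space, bounding the exponent of x_theta bounds
all exponents, by looking at the heights, so the vectors of a given weight
killed by a given power of f_theta form a finite-dimensional space.

These properties are enough for membership in H_fin
([gelfand_tsetlin_criterion]).  The algebra Gamma_theta is commutative and
preserves the finite-dimensional spaces just mentioned, which split into
generalized eigenspaces of characters.  For the multiplicity of a character chi,
let v be in its component and f_theta^j v the last nonzero power: this is a
lowest weight vector for the sl2-triple, so the Casimir element acts on it by
the square of a number which is affine in j, up to a constant, and the
generalized eigenvalue of the Casimir element on v is chi of it.  This leaves at
most two values of j, so the component lies in one of the finite-dimensional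
spaces. *)

(** * Polynomials in commuting elements and the Weyl algebra *)

Lemma mpoly_alg_ind (K : fieldType) n (P : {mpoly K[n]} -> Prop) :
  P 1 -> (forall i, P 'X_i) -> (forall p q, P p -> P q -> P (p * q)) ->
  (forall c p q, P p -> P q -> P (c *: p + q)) -> forall p, P p.
Proof.
move=> P1 PX PM PD; have P0 : P 0.
  by have := PD (-1) 1 1 P1 P1; rewrite scaleN1r addNr.
have PXm m : P 'X_[m].
  rewrite mpolyXE_id; elim/big_ind: _ => // i _.
  by elim: (m i) => [|k IH]; rewrite ?expr0 // exprS; apply: PM.
elim/mpolyind => [|c m p _ _ IH]; first exact: P0.
exact: PD.
Qed.

Section Evaluation.
Variables (K : fieldType) (n : nat) (A : algType K) (D : 'I_n -> A).
Hypothesis DC : forall i j, D i * D j = D j * D i.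

Definition peval (p : {mpoly K[n]}) : A := mmap (in_alg A) D p.

Lemma pevalD p q : peval (p + q) = peval p + peval q.
Proof. exact: mmapD. Qed.
Lemma pevalB p q : peval (p - q) = peval p - peval q.
Proof. exact: mmapB. Qed.
Lemma peval0 : peval 0 = 0.
Proof. exact: mmap0. Qed.
Lemma pevalZ c p : peval (c *: p) = c *: peval p.
Proof. by rewrite /peval mmapZ /= mulr_algl. Qed.
Lemma pevalC c : peval c%:MP = c%:A.
Proof. exact: mmapC. Qed.
Lemma peval1 : peval 1 = 1.
Proof. by rewrite -mpolyC1 pevalC scale1r. Qed.
Lemma pevalX i : peval 'X_i = D i.
Proof. by rewrite /peval mmapX mmap1U. Qed.
Lemma peval_sum (I : finType) (P : pred I) (F : I -> {mpoly K[n]}) :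
  peval (\sum_(i | P i) F i) = \sum_(i | P i) peval (F i).
Proof. exact: (big_morph _ pevalD peval0). Qed.

Lemma mmap1_mul m1 m2 : mmap1 D (m1 + m2) = mmap1 D m1 * mmap1 D m2.
Proof.
rewrite /mmap1; elim: (index_enum _) => [|i r IH]; first by rewrite !big_nil mul1r.
rewrite !big_cons IH mnmDE exprD -!mulrA; congr (_ * _); rewrite !mulrA; congr (_ * _).
by apply: commr_prod => j _; apply/commrX/commr_sym/commrX/DC.
Qed.

Lemma pevalM p q : peval (p * q) = peval p * peval q.
Proof.
elim/mpolyind: p => [|c m p _ _ IH]; first by rewrite mul0r peval0 mul0r.
rewrite mulrDl !pevalD IH mulrDl; congr (_ + _).
rewrite -scalerAl !pevalZ -scalerAl; congr (_ *: _) => {IH}.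
elim/mpolyind: q => [|d m' q _ _ IHq]; first by rewrite mulr0 peval0 mulr0.
rewrite mulrDr !pevalD IHq mulrDr; congr (_ + _).
rewrite -scalerAr !pevalZ -scalerAr -mpolyXD; congr (_ *: _).
by rewrite /peval !mmapX mmap1_mul.
Qed.

Variable E : 'I_n -> A.
Hypothesis ED : forall i j, E i * D j - D j * E i = (i == j)%:R.

(** Both sides are derivations of p, so it is enough to compare them on the
variables. *)
Lemma peval_deriv i p : E i * peval p - peval p * E i = peval p^`M(i).
Proof.
elim/mpoly_alg_ind: p => [|j|p q IHp IHq|c p q IHp IHq].
- by rewrite peval1 mulr1 mul1r subrr -mpolyC1 mderivC peval0.
- rewrite pevalX ED mderivX mnm1E pevalZ eq_sym.
  case: eqP => [->|_]; last by rewrite scale0r.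
  have -> : (U_(i) - U_(i) = 0)%MM by apply/mnmP => k; rewrite mnmBE subnn mnm0E.
  by rewrite mpolyX0 peval1 scale1r.
- rewrite mderivM pevalD !pevalM -IHp -IHq mulrBl mulrBr !mulrA.
  by rewrite addrA subrK.
- rewrite mderivD mderivZ !(pevalD, pevalZ) -IHp -IHq mulrDr mulrDl opprD addrACA.
  by rewrite scalerBr -scalerAr -scalerAl.
Qed.
End Evaluation.

Section WeylRelations.
Variables (K : fieldType) (n : nat).
Local Notation W := (weyl K n).
Local Notation wx := (@wx K n).
Local Notation wd := (@wd K n).

Local Notation cls t := (@pclass K (weyl_presentation K n) t : W).

Let pcE (s t u v : term K ('I_n + 'I_n)) :
  cls s * cls t - cls u * cls v = cls (TSub (TMul s t) (TMul u v)).
Proof.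
by rewrite -[LHS]/(padd (pmul (cls _) (cls _)) (popp (pmul (cls _) (cls _))))
   !pmulE poppE paddE.
Qed.

Let rel (s t : term K ('I_n + 'I_n)) : weyl_rel s t -> cls s = cls t.
Proof. by move=> st; apply: (@pclass_eq K (weyl_presentation K n)); apply: pc_rel. Qed.

Let class_const c : cls (TConst c) = c%:A.
Proof.
rewrite -[RHS]/(pscale c (cls (TConst 1))) pscaleE; apply: pclass_eq.
apply: pc_trans (pc_sym (pc_mul1 _ _)) _; apply: pc_sym; exact: pc_constC.
Qed.

Lemma wxC i j : wx i * wx j = wx j * wx i.
Proof. by apply/eqP; rewrite -subr_eq0 pcE (rel (wr_xx _ i j)). Qed.
Lemma wdC i j : wd i * wd j = wd j * wd i.
Proof. by apply/eqP; rewrite -subr_eq0 pcE (rel (wr_dd _ i j)). Qed.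
Lemma wdx i j : wd i * wx j - wx j * wd i = (i == j)%:R.
Proof.
rewrite pcE (rel (wr_dx _ i j)) class_const.
by case: (i == j); rewrite ?scale1r ?scale0r.
Qed.

Lemma weyl_of_polyE p : weyl_of_poly p = peval wx p. Proof. by []. Qed.

Lemma weyl_ind (P : W -> Prop) :
  (forall c, P c%:A) -> (forall i, P (wx i)) -> (forall i, P (wd i)) ->
  (forall a b, P a -> P b -> P (a + b)) ->
  (forall a b, P a -> P b -> P (a * b)) -> forall a, P a.
Proof.
move=> Pc Px Pd PD PM a; rewrite -[a]pclass_repr.
elim: (repr a) => {a} [c|[i|i]|s IHs t IHt|s IHs t IHt].
- by rewrite class_const.
- exact: Px.
- exact: Pd.
- rewrite -[pclass _](@paddE K (weyl_presentation K n)); exact: PD.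
- rewrite -[pclass _](@pmulE K (weyl_presentation K n)); exact: PM.
Qed.

Definition vfield (v : 'I_n -> {mpoly K[n]}) : W := \sum_i weyl_of_poly (v i) * wd i.
Definition vder (v : 'I_n -> {mpoly K[n]}) (p : {mpoly K[n]}) := \sum_i v i * p^`M(i).

Lemma vfield_poly v p :
  vfield v * weyl_of_poly p - weyl_of_poly p * vfield v = weyl_of_poly (vder v p).
Proof.
rewrite /vfield /vder mulr_suml mulr_sumr -sumrB !weyl_of_polyE peval_sum.
apply: eq_bigr => i _; rewrite pevalM; last exact: wxC.
rewrite -(peval_deriv wxC wdx) !weyl_of_polyE mulrBr !mulrA; congr (_ - _ * _).
rewrite -!pevalM ?[p * _]mulrC //; exact: wxC.
Qed.

(** The second order terms cancel because the wd commute. *)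
Lemma vfield_bracket v w : vfield v * vfield w - vfield w * vfield v =
  vfield (fun i => vder v (w i) - vder w (v i)).
Proof.
have vd j : vfield v * wd j = wd j * vfield v - vfield (fun i => (v i)^`M(j)).
  apply/eqP; rewrite eq_sym subr_eq addrC -subr_eq; apply/eqP.
  rewrite /vfield mulr_suml mulr_sumr -sumrB; apply: eq_bigr => i _.
  rewrite !weyl_of_polyE -(peval_deriv wxC wdx) mulrBl !mulrA; congr (_ - _).
  by rewrite -!mulrA wdC.
have e : vfield v * vfield w =
    \sum_j weyl_of_poly (vder v (w j)) * wd j + \sum_j weyl_of_poly (w j) * (vfield v * wd j).
  rewrite {2}/vfield mulr_sumr -big_split; apply: eq_bigr => j _ /=.
  by rewrite -vfield_poly mulrBl !mulrA subrK.
rewrite e; under [X in _ + X - _]eq_bigr => j _ do rewrite vd mulrBr mulrA.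
rewrite sumrB -mulr_suml -/(vfield w) addrA addrAC addrK.
have -> : \sum_j weyl_of_poly (w j) * vfield (fun i => (v i)^`M(j)) = vfield (fun i => vder w (v i)).
  rewrite /vfield /vder; under eq_bigr => j _ do rewrite mulr_sumr.
  rewrite exchange_big; apply: eq_bigr => i _ /=.
  rewrite !weyl_of_polyE peval_sum mulr_suml; apply: eq_bigr => j _.
  by rewrite mulrA pevalM //; apply: wxC.
rewrite /vfield -sumrB; apply: eq_bigr => i _.
by rewrite !weyl_of_polyE pevalB mulrBl.
Qed.

Lemma vfield_ext v w : v =1 w -> vfield v = vfield w.
Proof. by move=> e; apply: eq_bigr => i _; rewrite e. Qed.

Lemma first_order_bracket v v' c c' :
  (vfield v + weyl_of_poly c) * (vfield v' + weyl_of_poly c') -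
    (vfield v' + weyl_of_poly c') * (vfield v + weyl_of_poly c) =
  vfield (fun i => vder v (v' i) - vder v' (v i)) +
    weyl_of_poly (vder v c' - vder v' c).
Proof.
rewrite [weyl_of_poly (vder v c' - _)]pevalB -vfield_bracket -!weyl_of_polyE -!vfield_poly.
have pC : weyl_of_poly c * weyl_of_poly c' = weyl_of_poly c' * weyl_of_poly c :> W.
  by rewrite !weyl_of_polyE -!pevalM ?[c * c']mulrC //; apply: wxC.
move: (vfield v) (vfield v') (weyl_of_poly c) (weyl_of_poly c') pC => A B p q pC.
have cDl (x y z : W) : (x + y) * z - z * (x + y) = (x * z - z * x) + (y * z - z * y).
  by rewrite mulrDl mulrDr opprD addrACA.
have cDr (x y z : W) : z * (x + y) - (x + y) * z = (z * x - x * z) + (z * y - y * z).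
  by rewrite mulrDl mulrDr opprD addrACA.
by rewrite cDl !cDr pC subrr addr0 [in RHS]opprB [RHS]addrA.
Qed.

Lemma first_order_linear c v v' p p' :
  vfield (fun i => c *: v i + v' i) + weyl_of_poly (c *: p + p') =
  c *: (vfield v + weyl_of_poly p) + (vfield v' + weyl_of_poly p').
Proof.
rewrite [weyl_of_poly (_ + _)]pevalD pevalZ -!weyl_of_polyE scalerDr addrACA; congr (_ + _).
rewrite /vfield scaler_sumr -big_split; apply: eq_bigr => i _.
by rewrite [weyl_of_poly (_ + _)]pevalD pevalZ -!weyl_of_polyE mulrDl scalerAl.
Qed.
End WeylRelations.

(** * Power series in a nilpotent operator *)

Section Sums.
Variable V : nmodType.

Lemma sum_trim (F : nat -> V) d N : (d <= N)%N -> (forall i, (d <= i)%N -> F i = 0) ->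
  \sum_(i < N) F i = \sum_(i < d) F i.
Proof.
move=> dN F0; rewrite -!(big_mkord xpredT F) (big_cat_nat (leq0n d) dN) /=.
rewrite [X in _ + X]big_nat_cond [X in _ + X]big1 ?addr0 // => i /andP[/andP[di _] _].
exact: F0.
Qed.

Lemma sum_triangle (F : nat -> nat -> V) N :
  \sum_(n < N) \sum_(i < n.+1) F i (n - i)%N = \sum_(i < N) \sum_(j < N - i) F i j.
Proof.
elim: N => [|N IH]; first by rewrite !big_ord0.
rewrite big_ord_recr /= IH [RHS]big_ord_recr /= subSnn big_ord1.
rewrite [X in _ + X]big_ord_recr /= subnn addrA; congr (_ + _).
rewrite -big_split; apply: eq_bigr => i _ /=.
by rewrite subSn 1?ltnW // big_ord_recr.
Qed.

(** Terms with an index at least d vanish, so the square can be summed along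
antidiagonals, as in a product of power series. *)
Lemma sum_square (F : nat -> nat -> V) d :
  (forall i j, (d <= i)%N -> F i j = 0) -> (forall i j, (d <= j)%N -> F i j = 0) ->
  \sum_(i < d) \sum_(j < d) F i j = \sum_(n < d + d) \sum_(i < n.+1) F i (n - i)%N.
Proof.
move=> F1 F2; rewrite sum_triangle.
rewrite (@sum_trim (fun i => \sum_(j < d + d - i) F i j) d) ?leq_addr //; last first.
  by move=> i di; rewrite big1 // => j _; apply: F1.
apply: eq_bigr => i _; rewrite (@sum_trim (F i) d) //; first by have := ltn_ord i; lia.
by move=> j; apply: F2.
Qed.
End Sums.

Section ExpCoefficients.
Variable K : numFieldType.

Definition conv (c c' : nat -> K) k := \sum_(j < k.+1) c j * c' (k - j)%N.

Lemma convC c c' : conv c c' =1 conv c' c.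
Proof.
move=> k; rewrite /conv (reindex_inj rev_ord_inj) /=; apply: eq_bigr => j _.
by rewrite mulrC subSS subKn // -ltnS.
Qed.

Definition exp_coef k : K := k`!%:R^-1.
Definition expN_coef k : K := (-1) ^+ k * k`!%:R^-1.
(** The coefficients of (1 - e^(- t)) / t. *)
Definition psi_coef k : K := (-1) ^+ k * k.+1`!%:R^-1.
(** The coefficients of (e^t - 1) / t. *)
Definition q_coef k : K := k.+1`!%:R^-1.

Lemma fact_neq0 k : k`!%:R != 0 :> K.
Proof. by rewrite pnatr_eq0 -lt0n fact_gt0. Qed.

Lemma bin_fact_inv n i : (i <= n)%N ->
  'C(n, i)%:R * n`!%:R^-1 = i`!%:R^-1 * (n - i)`!%:R^-1 :> K.
Proof.
move=> le; apply: (mulIf (fact_neq0 n)); rewrite divfK ?fact_neq0 //.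
by rewrite -(bin_fact le) !natrM; field; rewrite !fact_neq0.
Qed.

Lemma conv_expN_exp k : conv expN_coef exp_coef k = (k == 0%N)%:R.
Proof.
have -> : conv expN_coef exp_coef k = (1 - 1) ^+ k * k`!%:R^-1.
  rewrite exprBn mulr_suml; apply: eq_bigr => j _.
  rewrite !expr1n /expN_coef /exp_coef mulr1 mulr1 -mulrA -bin_fact_inv -1?ltnS //.
  by rewrite mulrnAl mul1r mulrnAr mulrnAl.
by rewrite subrr expr0n; case: k => [|k]; rewrite ?mul0r // fact0 invr1 mulr1.
Qed.

(** This is e^(- t) (e^t - 1) / t = (1 - e^(- t)) / t, read off from
e^(- t) e^t = 1 one degree higher. *)
Lemma conv_expN_q : conv expN_coef q_coef =1 psi_coef.
Proof.
move=> k; have := conv_expN_exp k.+1; rewrite /conv big_ord_recr /= subnn.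
rewrite /exp_coef fact0 invr1 mulr1 => /(canRL (addrK _)).
under eq_bigr => j _ do rewrite subSn -1?ltnS //.
by move=> ->; rewrite sub0r /expN_coef exprS mulN1r mulNr opprK.
Qed.

(** The recursion defining the coefficients of t e^t / (e^t - 1). *)
Lemma conv_q_todd : conv q_coef (@todd_coef K) =1 exp_coef.
Proof. by move=> k; rewrite convC /conv /exp_coef -todd_coefP. Qed.
End ExpCoefficients.

Lemma linear_map0 (R : nzRingType) (U V : lmodType R) (F : U -> V) :
  linear F -> F 0 = 0.
Proof. by move=> lF; have := lF (-1) 0 0; rewrite !scaleN1r oppr0 addr0 addNr. Qed.

Section NilpotentSeries.
Variables (K : numFieldType) (P : comNzRingType) (kp : {rmorphism K -> P}).
Variables (L : lmodType P) (d : nat).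

Definition series (c : nat -> K) (T : L -> L) v := \sum_(k < d) kp (c k) *: iter k T v.

Lemma eq_series c c' T v : c =1 c' -> series c T v = series c' T v.
Proof. by move=> e; apply: eq_bigr => k _; rewrite e. Qed.

Variable T : L -> L.
Hypothesis T_lin : linear T.
Hypothesis T_nil : forall v, iter d T v = 0.

Lemma iter_linear k : linear (iter k T).
Proof. by elim: k => // k IH a u v; rewrite !iterS IH T_lin. Qed.
Lemma iter_0 k : iter k T 0 = 0.
Proof. exact: linear_map0 (iter_linear k). Qed.
Lemma iter_D k u v : iter k T (u + v) = iter k T u + iter k T v.
Proof. by have := iter_linear k 1 u v; rewrite !scale1r. Qed.
Lemma iter_Z k a v : iter k T (a *: v) = a *: iter k T v.
Proof. by have := iter_linear k a v 0; rewrite iter_0 !addr0. Qed.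
Lemma iter_sum k (I : finType) (F : I -> L) : iter k T (\sum_i F i) = \sum_i iter k T (F i).
Proof. exact: (big_morph _ (iter_D k) (iter_0 k)). Qed.
Lemma iter_ge k v : (d <= k)%N -> iter k T v = 0.
Proof. by move=> dk; rewrite -(subnK dk) iterD T_nil iter_0. Qed.

Lemma series_linear c : linear (series c T).
Proof.
move=> a u v; rewrite /series scaler_sumr -big_split; apply: eq_bigr => k _ /=.
by rewrite iter_linear scalerDr !scalerA mulrC.
Qed.
Lemma series0 c : series c T 0 = 0.
Proof. by rewrite /series big1 // => k _; rewrite iter_0 scaler0. Qed.
Lemma seriesD c u v : series c T (u + v) = series c T u + series c T v.
Proof. by have := series_linear c 1 u v; rewrite !scale1r. Qed.
Lemma seriesZ c a v : series c T (a *: v) = a *: series c T v.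
Proof. by have := series_linear c a v 0; rewrite series0 !addr0. Qed.

Lemma series_widen c v N : (d <= N)%N ->
  series c T v = \sum_(k < N) kp (c k) *: iter k T v.
Proof.
move=> dN; rewrite (@sum_trim _ (fun k => kp (c k) *: iter k T v) d N) // => i di.
by rewrite iter_ge // scaler0.
Qed.

(** Since T vanishes to the order at which the series are cut, composing the cut
series is the same as multiplying the power series. *)
Lemma series_conv c c' v : series c T (series c' T v) = series (conv c c') T v.
Proof.
rewrite [RHS](series_widen _ _ (leq_addr d d)) /series.
under eq_bigr => i _ do rewrite iter_sum scaler_sumr.
rewrite (@sum_square _ (fun i j => kp (c i) *: iter i T (kp (c' j) *: iter j T v))); first last.
- by move=> i j dj; rewrite (iter_ge _ dj) scaler0 iter_0 scaler0.
- by move=> i j di; rewrite iter_ge // scaler0.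
apply: eq_bigr => n _; rewrite /conv rmorph_sum scaler_suml; apply: eq_bigr => i _.
by rewrite iter_Z scalerA -rmorphM -iterD subnKC // -ltnS.
Qed.

Lemma series_delta c v : (forall k, c k = (k == 0%N)%:R) -> series c T v = v.
Proof.
move=> cd; rewrite (series_widen c v (leqnSn d)) big_ord_recl cd rmorph1 scale1r big1 ?addr0 //.
by move=> i _; rewrite cd rmorph0 scale0r.
Qed.

(** With q = (e^t - 1) / t, the product is e^(- t) q * (t e^t / (e^t - 1)), and the
last two factors multiply to e^t. *)
Lemma series_todd_psi v :
  series (@psi_coef K) T (series (@todd_coef K) T v) = v.
Proof.
rewrite -(eq_series _ _ (@conv_expN_q K)) -series_conv series_conv.
rewrite -(series_conv _ _ (series (@todd_coef K) T v)) [series (q_coef K) _ _]series_conv.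
rewrite (eq_series _ _ (@conv_q_todd K)) series_conv; apply: series_delta.
exact: conv_expN_exp.
Qed.

Lemma series_exp_expN v : series (@expN_coef K) T (series (@exp_coef K) T v) = v.
Proof. by rewrite series_conv; apply: series_delta; apply: conv_expN_exp. Qed.
End NilpotentSeries.

Lemma series_opp (K : numFieldType) (P : comNzRingType) (kp : {rmorphism K -> P})
  (L : lmodType P) d c (T T' : L -> L) v :
  linear T -> (forall v, T' v = - T v) ->
  series kp d c T' v = series kp d (fun k => (-1) ^+ k * c k) T v.
Proof.
move=> T_lin TT'; apply: eq_bigr => k _.
have -> : iter k T' v = (-1) ^+ k *: iter k T v.
  elim: (k : nat) => [|j IH]; first by rewrite scale1r.
  rewrite !iterS IH TT'.
  have := T_lin ((-1) ^+ j) (iter j T v) 0.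
  by rewrite (linear_map0 T_lin) !addr0 => ->; rewrite exprS mulN1r scaleNr.
by rewrite scalerA rmorphM rmorph_sign mulrC.
Qed.

(** * The exponential of an inner derivation *)

Section BracketExp.
Variables (K : numFieldType) (P : comNzRingType) (kp : {rmorphism K -> P}).
Variables (L : lmodType P) (d : nat) (br : L -> L -> L).
Hypothesis br_linl : forall w, linear (br^~ w).
Hypothesis br_linr : forall w, linear (br w).
Hypothesis br_jacobi : forall x y z, br x (br y z) = br (br x y) z + br y (br x z).

Lemma br0l v : br 0 v = 0. Proof. exact: (iter_0 (br_linl v) 1). Qed.
Lemma br0r v : br v 0 = 0. Proof. exact: (iter_0 (br_linr v) 1). Qed.
Lemma brDl u v w : br (u + v) w = br u w + br v w.
Proof. exact: (iter_D (br_linl w) 1). Qed.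
Lemma brDr w u v : br w (u + v) = br w u + br w v.
Proof. exact: (iter_D (br_linr w) 1). Qed.
Lemma brZl a v w : br (a *: v) w = a *: br v w.
Proof. exact: (iter_Z (br_linl w) 1). Qed.
Lemma brZr a v w : br v (a *: w) = a *: br v w.
Proof. exact: (iter_Z (br_linr v) 1). Qed.
Lemma brNl v w : br (- v) w = - br v w.
Proof. by rewrite -scaleN1r brZl scaleN1r. Qed.
Lemma brNr v w : br v (- w) = - br v w.
Proof. by rewrite -scaleN1r brZr scaleN1r. Qed.
Lemma brBl u v w : br (u - v) w = br u w - br v w.
Proof. by rewrite brDl brNl. Qed.
Lemma br_suml (I : finType) (F : I -> L) w : br (\sum_i F i) w = \sum_i br (F i) w.
Proof. exact: (big_morph (br^~ w) (fun x y => brDl x y w) (br0l w)). Qed.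
Lemma br_sumr (I : finType) (F : I -> L) w : br w (\sum_i F i) = \sum_i br w (F i).
Proof. exact: (big_morph (br w) (brDr w) (br0r w)). Qed.
Lemma brMnr a b k : br a (b *+ k) = br a b *+ k.
Proof. by rewrite -!scaler_nat brZr. Qed.

Variable w : L.
Hypothesis w_nil : forall v, iter d (br w) v = 0.

Lemma iter_br n a b : iter n (br w) (br a b) =
  \sum_(i < n.+1) br (iter i (br w) a) (iter (n - i) (br w) b) *+ 'C(n, i).
Proof.
elim: n => [|n IH]; first by rewrite big_ord1 bin0.
rewrite iterS IH br_sumr.
under eq_bigr => i _ do rewrite brMnr br_jacobi mulrnDl -!iterS -subSn -1?ltnS //.
rewrite big_split /= addrC [RHS]big_ord_recl /= bin0.
under [in RHS]eq_bigr => i _ do rewrite /bump /= !add1n !add0n subSS binS mulrnDr.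
rewrite big_split /= addrA; congr (_ + _).
rewrite [LHS]big_ord_recl /= bin0; congr (_ + _).
rewrite [RHS]big_ord_recr /= bin_small // mulr0n addr0.
by apply: eq_bigr => i _; rewrite /bump /= !add1n !add0n subSS.
Qed.

(** Leibniz' rule for the iterates of a derivation, divided by factorials: the
exponential of a derivation is an automorphism. *)
Lemma exp_br a b : series kp d (@exp_coef K) (br w) (br a b) =
  br (series kp d (@exp_coef K) (br w) a) (series kp d (@exp_coef K) (br w) b).
Proof.
have nil := iter_ge (br_linr w) w_nil.
rewrite (series_widen _ (br_linr w) w_nil _ _ (leq_addr d d)) /series br_suml.
under [RHS]eq_bigr => i _ do rewrite br_sumr.
rewrite (@sum_square _ (fun i j => br (kp (exp_coef K i) *: iter i (br w) a)
   (kp (exp_coef K j) *: iter j (br w) b))); first last.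
- by move=> i j dj; rewrite (nil _ _ dj) scaler0 br0r.
- by move=> i j di; rewrite (nil _ _ di) scaler0 br0l.
apply: eq_bigr => n _; rewrite iter_br scaler_sumr; apply: eq_bigr => i _.
rewrite brZl brZr scalerA -rmorphM /exp_coef -bin_fact_inv -1?ltnS //.
by rewrite -scaler_nat scalerA -(rmorph_nat kp) -rmorphM [_^-1 * _]mulrC.
Qed.

Variable D : L -> L.
Hypothesis D_add : forall u v, D (u + v) = D u + D v.
Hypothesis D_scale : forall c v, D (kp c *: v) = kp c *: D v.
Hypothesis D_br : forall a b, D (br a b) = br (D a) b + br a (D b).

Let D0 : D 0 = 0. Proof. by apply: (addIr (D 0)); rewrite -D_add !add0r. Qed.
Let D_sum (I : finType) (F : I -> L) : D (\sum_i F i) = \sum_i D (F i).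
Proof. exact: (big_morph D D_add D0). Qed.

(** Moving D through each of the n factors replaces that factor by the bracket
with D w; sorting by the number k of factors that fall on D w gives the
binomial coefficients. *)
Lemma der_iter n v : D (iter n (br w) v) = iter n (br w) (D v) +
  \sum_(k < n) br (iter k (br w) (D w)) (iter (n.-1 - k) (br w) v) *+ 'C(n, k.+1).
Proof.
elim: n => [|n IH]; first by rewrite big_ord0 addr0.
rewrite iterS D_br IH brDr -iterS addrCA; congr (_ + _).
rewrite br_sumr.
under eq_bigr => k _.
  rewrite brMnr br_jacobi mulrnDl -!iterS.
  have -> : ((n.-1 - k).+1 = n - k)%N by have := ltn_ord k; lia.
  over.
under [RHS]eq_bigr => k _ do rewrite binS mulrnDr.
rewrite !big_split /= addrA addrC; congr (_ + _); last first.
  rewrite [RHS]big_ord_recl /= bin0 ?subn0; congr (_ + _); apply: eq_bigr => k _.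
  by rewrite /bump /= add1n; congr (br _ (iter _ _ _) *+ _); have := ltn_ord k; lia.
by rewrite [RHS]big_ord_recr /= bin_small // mulr0n addr0.
Qed.

(** The classical formula for the derivative of the exponential map: (D e^w) e^(- w)
is the value at D w of the series (e^t - 1) / t at t = ad w. *)
Lemma der_exp v : D (series kp d (@exp_coef K) (br w) v) =
  series kp d (@exp_coef K) (br w) (D v) +
  br (series kp d (@q_coef K) (br w) (D w)) (series kp d (@exp_coef K) (br w) v).
Proof.
have nil := iter_ge (br_linr w) w_nil.
have wid := series_widen kp (br_linr w) w_nil.
have prod : br (series kp d (@q_coef K) (br w) (D w)) (series kp d (@exp_coef K) (br w) v) =
    \sum_(i < d) \sum_(j < d) br (kp (q_coef K i) *: iter i (br w) (D w))
      (kp (exp_coef K j) *: iter j (br w) v).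
  by rewrite /series br_suml; apply: eq_bigr => i _; rewrite br_sumr.
have dd : (d <= (d + d).+1)%N by rewrite -addSn leq_addl.
rewrite prod [X in D X](wid _ v _ dd) (wid _ (D v) _ dd) D_sum.
under eq_bigr => n _ do rewrite D_scale der_iter scalerDr.
rewrite big_split; congr (_ + _) => /=.
rewrite big_ord_recl big_ord0 scaler0 add0r.
apply/esym; etransitivity; first apply: (@sum_square _ (fun i j =>
    br (kp (q_coef K i) *: iter i (br w) (D w)) (kp (exp_coef K j) *: iter j (br w) v)) d).
- by move=> i j di; rewrite (nil _ _ di) scaler0 br0l.
- by move=> i j dj; rewrite (nil _ _ dj) scaler0 br0r.
apply: eq_bigr => n _; rewrite lift0 /= scaler_sumr; apply/esym/eq_bigr => i _.
rewrite brZl brZr scalerA -rmorphM /exp_coef /q_coef.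
rewrite -subSS -bin_fact_inv //.
by rewrite -scaler_nat scalerA -(rmorph_nat kp) -rmorphM [_^-1 * _]mulrC subSS.
Qed.
End BracketExp.

(** The mixed terms in the commutator of two derivations at a product. *)
Lemma cross_cancel (V : zmodType) (x1 x2 x3 x4 z1 z4 : V) :
  x1 + x2 + (x3 + x4) - (z1 + x3 + (x2 + z4)) = x1 - z1 + (x4 - z4).
Proof.
rewrite [x3 + x4]addrC [x1 + x2 + _]addrACA [x2 + z4]addrC [z1 + x3 + _]addrACA.
by rewrite [x3 + x2]addrC opprD [LHS]addrACA subrr addr0 opprD [LHS]addrACA.
Qed.

(** * Vector fields transporting a Lie algebra *)

(** In the application L is g with polynomial coefficients, [iota] embeds g as
the constants, [u] is the generic element of nbar, and [pm], [q] are the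
projections onto nbar and b. *)
Section Realize.
Variables (K : numFieldType) (P : comNzRingType) (kp : {rmorphism K -> P}).
Variables (L : lmodType P) (d : nat) (br : L -> L -> L).
Hypothesis br_linl : forall w, linear (br^~ w).
Hypothesis br_linr : forall w, linear (br w).
Hypothesis br_anti : forall x y, br x y = - br y x.
Hypothesis br_jacobi : forall x y z, br x (br y z) = br (br x y) z + br y (br x z).
Variables (C : Type) (iota : C -> L) (lieC : C -> C -> C).
Hypothesis iota_lie : forall a b, iota (lieC a b) = br (iota a) (iota b).
Hypothesis iota_span : forall v, exists m (p : 'I_m -> P) (c : 'I_m -> C),
  v = \sum_i p i *: iota (c i).
Hypothesis br_faithful : forall v, (forall c, br v (iota c) = 0) -> v = 0.
Variable u : L.
Hypothesis u_nil : forall v, iter d (br u) v = 0.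

Definition is_der (D : L -> L) := [/\ forall u v, D (u + v) = D u + D v,
  forall c v, D (kp c *: v) = kp c *: D v,
  forall a b, D (br a b) = br (D a) b + br a (D b) & forall c, D (iota c) = 0].

Definition flow (v : L) := series kp d (@expN_coef K) (br u) v.
Definition todd (v : L) := series kp d (@todd_coef K) (br u) v.
Definition psi (v : L) := series kp d (@psi_coef K) (br u) v.

Let T_lin : linear (br u). Proof. exact: br_linr. Qed.

Lemma psi_todd v : psi (todd v) = v.
Proof. exact: series_todd_psi. Qed.
Lemma todd_psi v : todd (psi v) = v.
Proof.
rewrite -[RHS]psi_todd /todd /psi !series_conv //.
by apply: eq_series; apply: convC.
Qed.

Lemma flow_psi v : flow v = v - psi (br u v).
Proof.
rewrite /flow (series_widen _ T_lin u_nil _ _ (leqnSn d)) big_ord_recl; congr (_ + _).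
  by rewrite /expN_coef fact0 invr1 expr0 mulr1 rmorph1 scale1r.
rewrite /psi /series -sumrN; apply: eq_bigr => k _.
by rewrite lift0 -iterSr /expN_coef /psi_coef exprS mulN1r mulNr rmorphN scaleNr.
Qed.

Let u_nilN v : iter d (br (- u)) v = 0.
Proof.
have -> : iter d (br (- u)) v = (-1) ^+ d *: iter d (br u) v.
  elim: d => [|j IH]; first by rewrite scale1r.
  by rewrite !iterS IH (brZr br_linr) (brNl br_linl) exprS mulN1r scaleNr scalerN.
by rewrite u_nil scaler0.
Qed.

Let flowE v : series kp d (@exp_coef K) (br (- u)) v = flow v.
Proof. by rewrite (@series_opp _ _ _ _ _ _ (br u)) // => w; rewrite (brNl br_linl). Qed.

Lemma flow_br a b : flow (br a b) = br (flow a) (flow b).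
Proof. by rewrite -!flowE (exp_br kp br_linl br_linr br_jacobi u_nilN). Qed.

(** The derivative of the exponential at - ad u, where the factor (e^t - 1) / t
becomes psi. *)
Lemma flow_der D v : is_der D -> flow (D v) = 0 ->
  D (flow v) = - br (psi (D u)) (flow v).
Proof.
move=> [D_add D_scale D_br D_iota] Dv.
have D0 : D 0 = 0 by apply: (addIr (D 0)); rewrite -D_add !add0r.
have DN w : D (- w) = - D w.
  by apply/eqP; rewrite -addr_eq0 -D_add addNr D0.
rewrite -[in LHS]flowE (der_exp br_linl br_linr br_jacobi u_nilN D_add D_scale D_br) //.
rewrite !flowE Dv add0r -(brNl br_linl); congr (br _ _).
rewrite (@series_opp _ _ _ _ _ _ (br u)) //; last by move=> w; rewrite (brNl br_linl).
by rewrite DN -scaleN1r (seriesZ kp d T_lin) scaleN1r.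
Qed.

Lemma flow0 : flow 0 = 0.
Proof. exact: (series0 kp d T_lin _). Qed.

Definition transport (a : C) := flow (iota a).

Lemma transport_der D a : is_der D -> D (transport a) = - br (psi (D u)) (transport a).
Proof.
by move=> dD; rewrite /transport flow_der //; case: dD => _ _ _ ->; apply: flow0.
Qed.

(** Applying the inverse exponential to a constant gives a combination of
constants, so every constant is a combination of transported ones. *)
Lemma transport_faithful v : (forall c, br v (transport c) = 0) -> v = 0.
Proof.
move=> vy; apply: br_faithful => c.
have [m [p [cc ec]]] := iota_span (series kp d (@exp_coef K) (br u) (iota c)).
rewrite -(series_exp_expN kp T_lin u_nil (iota c)) -/(flow _) ec.
rewrite /flow (big_morph _ (seriesD kp d T_lin _) flow0) (br_sumr br_linr) big1 // => i _.
by rewrite (seriesZ kp d T_lin) (brZr br_linr) [br _ _]vy scaler0.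
Qed.

(** By [transport_der], psi (D u) centralizes the transported constants, so it is
zero, and psi is invertible. *)
Lemma der_generic_eq0 D : is_der D -> (forall c, D (transport c) = 0) -> D u = 0.
Proof.
move=> dD Dy; rewrite -[D u]todd_psi; suff -> : psi (D u) = 0 by apply: (series0 kp d T_lin _).
apply: transport_faithful => c; apply/eqP; rewrite -oppr_eq0 -(transport_der _ dD).
by rewrite Dy.
Qed.

Lemma is_der_comm D D' : is_der D -> is_der D' -> is_der (fun v => D (D' v) - D' (D v)).
Proof.
move=> [D1 D2 D3 D4] [E1 E2 E3 E4]; split.
- by move=> v w; rewrite E1 D1 D1 E1 opprD addrACA.
- by move=> c v; rewrite E2 D2 D2 E2 scalerBr.
- move=> a b; rewrite E3 D1 !D3 E1 !E3 cross_cancel.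
  by rewrite (brBl br_linl) (brDr br_linr) (brNr br_linr).
- by move=> c; rewrite D4 E4; have := D2 0 0; have := E2 0 0; rewrite rmorph0 !scale0r => -> ->; rewrite subrr.
Qed.

Lemma is_der_sub D D' : is_der D -> is_der D' -> is_der (fun v => D v - D' v).
Proof.
move=> [D1 D2 D3 D4] [E1 E2 E3 E4]; split.
- by move=> v w; rewrite D1 E1 opprD addrACA.
- by move=> c v; rewrite D2 E2 scalerBr.
- move=> v w; rewrite D3 E3 opprD addrACA.
  by rewrite [in RHS](brBl br_linl) [in RHS](brDr br_linr) [in RHS](brNr br_linr).
- by move=> c; rewrite D4 E4 subrr.
Qed.

Variables (pm q : L -> L).
Hypothesis pmD : forall v w, pm (v + w) = pm v + pm w.
Hypothesis pm_q : forall v, v = pm v + q v.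
Hypothesis pm_pm : forall v w, pm (br (pm v) (pm w)) = br (pm v) (pm w).
Hypothesis pm_qq : forall v w, pm (br (q v) (q w)) = 0.
Variable X : C -> L -> L.
Hypothesis X_der : forall a, is_der (X a).
Hypothesis X_pm : forall a v, X a (pm v) = pm (X a v).
Hypothesis X_u : forall a, X a u = - todd (pm (transport a)).

Lemma transport_lie a b : transport (lieC a b) = br (transport a) (transport b).
Proof. by rewrite /transport iota_lie flow_br. Qed.

(** The Todd series in X u cancels the factor psi of [transport_der]. *)
Lemma field_transport a b : X a (transport b) = br (pm (transport a)) (transport b).
Proof.
rewrite (transport_der _ (X_der a)) X_u.
have psiN v : psi (- v) = - psi v.
  by rewrite -scaleN1r /psi (seriesZ kp d T_lin) scaleN1r.
by rewrite psiN psi_todd (brNl br_linl) opprK.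
Qed.

Let pmB v w : pm (v - w) = pm v - pm w.
Proof. by apply: (addIr (pm w)); rewrite -pmD !subrK. Qed.

Let pmN v : pm (- v) = - pm v.
Proof.
have pm0 : pm 0 = 0 by apply: (addIr (pm 0)); rewrite -pmD !add0r.
by rewrite -sub0r pmB pm0 sub0r.
Qed.

(** Split both arguments along pm and q; the q-q term has no pm-component, and
the pm-pm term appears in both mixed brackets. *)
Lemma proj_transport_lie a b : pm (transport (lieC a b)) =
  pm (br (pm (transport a)) (transport b)) - pm (br (pm (transport b)) (transport a)) - br (pm (transport a)) (pm (transport b)).
Proof.
rewrite transport_lie {1}(pm_q (transport a)) (brDl br_linl) pmD -addrA; congr (_ + _).
rewrite {1}(pm_q (transport b)) (brDr br_linr) pmD pm_qq addr0.
rewrite {2}(pm_q (transport a)) (brDr br_linr) pmD pm_pm opprD [br (pm (transport b)) (pm _)]br_anti opprK.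
rewrite addrAC subrr add0r [br (pm (transport b)) _]br_anti.
by rewrite pmN opprK.
Qed.

(** The derivation [X a, X b] - X [a, b] kills the transported constants, by
[proj_transport_lie] and the Jacobi identity, so it kills u. *)
Lemma field_bracket a b : X a (X b u) - X b (X a u) = X (lieC a b) u.
Proof.
have dD := is_der_sub (is_der_comm (X_der a) (X_der b)) (X_der (lieC a b)).
apply/eqP; rewrite -subr_eq0; apply/eqP/(der_generic_eq0 dD) => c.
have XB e v w : X e (br v w) = br (X e v) w + br v (X e w) by case: (X_der e).
rewrite !field_transport !XB !field_transport !X_pm !field_transport proj_transport_lie !(brBl br_linl).
rewrite (br_jacobi (pm (transport a)) (pm (transport b)) (transport c)) addrA opprD addrACA subrr addr0.
by rewrite opprD addrA subrr.
Qed.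

Variable nu : L -> P.
Hypothesis nuD : forall v w, nu (v + w) = nu v + nu w.
Hypothesis nu_pm : forall v w, nu (br (pm v) (pm w)) = 0.
Hypothesis nu_qq : forall v w, nu (br (q v) (q w)) = 0.

(** Only the mixed terms of [y_a, y_b] contribute, since nu kills the brackets of
the image of pm and those of the image of q. *)
Lemma scalar_cocycle a b :
  nu (X a (transport b)) - nu (X b (transport a)) = nu (transport (lieC a b)).
Proof.
have nu0 : nu 0 = 0 by apply: (addIr (nu 0)); rewrite -nuD !add0r.
have nuN v : nu (- v) = - nu v by apply/eqP; rewrite -addr_eq0 -nuD addNr nu0.
rewrite !field_transport transport_lie [in RHS](pm_q (transport a)) (brDl br_linl) nuD; congr (_ + _).
rewrite [in RHS](pm_q (transport b)) (brDr br_linr) nuD nu_qq addr0.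
rewrite {1}(pm_q (transport a)) (brDr br_linr) nuD nu_pm add0r.
by rewrite br_anti nuN opprK.
Qed.
End Realize.

(** * Simultaneous diagonalization of a Cartan subalgebra *)

Import passmx.

Section CoordMatrix.
Variables (K : fieldType) (V : vectType K).
Local Notation d := (\dim {:V}).
Variable e : d.-tuple V.
Hypothesis eB : basis_of {:V} e.

Lemma free_coord_mx (b : d.-tuple V) :
  free b <-> \matrix_i rVof e (tnth b i) \in unitmx.
Proof.
have mulE (c : 'rV_d) : c *m (\matrix_i rVof e (tnth b i)) = rVof e (\sum_i c 0 i *: b`_i).
  rewrite mulmx_sum_row linear_sum; apply: eq_bigr => i _.
  by rewrite rowK linearZ (tnth_nth 0).
rewrite -row_free_unit -kermx_eq0; split=> [/freeP bF|/eqP ker].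
  apply/eqP/row_matrixP => i; rewrite row0; apply/rowP => j; rewrite [RHS]mxE.
  apply: (bF (fun j => row i (kermx _) 0 j)).
  apply/eqP; rewrite -(rVof_eq0 eB) -mulE -row_mul mulmx_ker row0 //.
apply/freeP => c c0 i.
have : (\row_j c j) = 0 :> 'rV_d.
  apply/eqP; rewrite -submx0 -ker; apply/sub_kermxP; rewrite mulE.
  by apply/eqP; rewrite rVof_eq0 // -[X in _ == X]c0; apply/eqP/eq_bigr => j _; rewrite mxE.
by move/rowP/(_ i); rewrite !mxE.
Qed.
End CoordMatrix.

Section WeightBasis.
Variables (K : fieldType) (g : lieAlgType K) (h : {vspace g}).
Local Notation d := (\dim {:g}).
Local Notation e := (vbasis {:g}).
Let eB : basis_of {:g} e := vbasisP _.

Definition adM (x : g) : 'M[K]_d := mxof e e (ad x).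

Lemma adM_rV x v : rVof e v *m adM x = rVof e (lie x v).
Proof. by rewrite /adM -(rVof_app _ eB) adE. Qed.

Lemma rV_mx_inj (A B : 'M[K]_d) :
  (forall v : g, rVof e v *m A = rVof e v *m B) -> A = B.
Proof.
move=> AB; apply/row_matrixP => i; rewrite !rowE -[delta_mx 0 i](vecofK eB).
exact: AB.
Qed.

Lemma adM_linear : linear adM.
Proof.
move=> a x y; apply: rV_mx_inj => v; rewrite mulmxDr -scalemxAr !adM_rV.
by rewrite lieDl lieZl linearD linearZ.
Qed.

HB.instance Definition _ :=
  GRing.isLinear.Build K g 'M[K]_d *:%R adM adM_linear.

Lemma lieC (x y : g) : lie x y = - lie y x.
Proof.
apply/eqP; rewrite -addr_eq0; apply/eqP.
by have := liexx (x + y); rewrite lieDl !linearD /= !liexx add0r addr0.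
Qed.

Lemma lie_jacobi (x y z : g) : lie x (lie y z) = lie (lie x y) z + lie y (lie x z).
Proof.
have /eqP := jacobi x y z; rewrite -addrA addr_eq0 => /eqP ->.
by rewrite [lie z x]lieC [lie z (lie x y)]lieC linearN /= opprD !opprK addrC.
Qed.

Lemma adM_lie x y : adM (lie x y) = adM y *m adM x - adM x *m adM y.
Proof.
apply: rV_mx_inj => v; rewrite mulmxBr !mulmxA !adM_rV -linearB.
by rewrite (lie_jacobi x y v) addrK.
Qed.

Lemma adM_diag x : ad_diagonalizable x -> diagonalizable (adM x).
Proof.
case=> b [bB bE].
have sb : size b == d by rewrite (@vector.size_basis _ _ _ _ (in_tuple b) bB).
pose bt := Tuple sb.
have btB : basis_of {:g} bt := bB.
pose Q := \matrix_i rVof e (tnth bt i).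
have Qu : Q \in unitmx by apply/(free_coord_mx eB)/(basis_free btB).
exists Q => //.
have /choice[c cP] (i : 'I_d) : exists c : K, lie x (tnth bt i) = c *: tnth bt i.
  by apply: bE; apply: mem_tnth.
apply/diagonalizable_forPex; exists (\row_i c i); apply/(simmxP Qu).
apply/row_matrixP => i; rewrite !row_mul rowK adM_rV cP linearZ row_diag_mx -scalemxAl.
by rewrite mxE -rowE rowK.
Qed.

(** Reading the eigenvalue off a nonzero coordinate of v shows that it depends
linearly on the element of h. *)
Lemma common_eigenvector (v : g) : v != 0 ->
  (forall x, x \in h -> exists c : K, lie x v = c *: v) ->
  exists a : dual h, v \in root_space a.
Proof.
move=> vN0 vE.
have [i iN] : exists i, rVof e v 0 i != 0.
  by apply/rV0Pn; rewrite rVof_eq0.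
pose phi (x : subvs_of h) : K^o := rVof e (lie (vsval x) v) 0 i / rVof e v 0 i.
have phi_lin : linear phi.
  move=> a x y; rewrite /phi linearD linearZ /= lieDl lieZl linearD linearZ /= [in LHS]mxE [in LHS]mxE.
  by rewrite mulrDl -mulrA.
pose phiL : {linear subvs_of h -> K^o} := HB.pack phi (GRing.isLinear.Build K _ _ _ phi phi_lin).
exists (linfun phiL); apply/root_spaceP => x; rewrite lfunE /= /phi.
have [c ->] := vE _ (subvsP x); congr (_ *: _).
by rewrite linearZ mxE mulfK.
Qed.

Lemma weight_basis : cartan_subalgebra h ->
  exists (w : d.-tuple g) (a : 'I_d -> dual h),
    basis_of {:g} w /\ forall i, tnth w i \in root_space (a i).
Proof.
case=> h_ab h_max h_diag.
have : codiagonalizable [seq adM x | x <- vbasis h].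
  apply/codiagonalizableP; split=> [_ _ /mapP[x xh ->] /mapP[y yh ->]|_ /mapP[x xh ->]].
    apply/eqP; rewrite -subr_eq0; apply/eqP.
    rewrite -adM_lie (h_ab y x) ?vbasis_mem //.
    by apply: rV_mx_inj => v; rewrite adM_rV lie0l linear0 mulmx0.
  by apply/adM_diag/h_diag/vbasis_mem.
case=> Q Qu /allP Qd.
pose w : d.-tuple g := [tuple vecof e (row i Q) | i < d].
have rw i : rVof e (tnth w i) = row i Q by rewrite tnth_mktuple vecofK.
have wF : free w.
  apply/(free_coord_mx eB); rewrite (_ : \matrix_i _ = Q) //.
  by apply/row_matrixP => i; rewrite rowK rw.
have wB : basis_of {:g} w.
  by rewrite basisEfree wF subvf size_tuple leqnn.
have wE i x : x \in h -> exists c : K, lie x (tnth w i) = c *: tnth w i.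
  move=> xh.
  have base y : y \in vbasis h -> exists c : K, lie y (tnth w i) = c *: tnth w i.
    move=> yh; have /diagonalizable_forPex[D /(simmxP Qu) e1] := Qd _ (map_f adM yh).
    exists (D 0 i); apply: (can_inj (rVofK eB)).
    by rewrite -adM_rV linearZ /= rw -row_mul e1 row_mul row_diag_mx -scalemxAl -rowE.
  have /choice[c cP] (k : 'I_(\dim h)) : exists c : K, lie (vbasis h)`_k (tnth w i) = c *: tnth w i.
    by apply: base; apply: mem_nth; rewrite size_tuple.
  rewrite (coord_vbasis xh) lie_suml; exists (\sum_k coord (vbasis h) k x * c k).
  by rewrite scaler_suml; apply: eq_bigr => k _; rewrite lieZl cP scalerA.
have /choice[a aP] i : exists a : dual h, tnth w i \in root_space a.
  apply: common_eigenvector; last exact: wE.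
  by apply: (free_not0 wF); apply: mem_tnth.
by exists w, a.
Qed.
End WeightBasis.

(** * Roots, heights and the triangular decomposition *)

Section Dual.
Variables (K : fieldType) (V : vectType K).
Local Notation dual := 'Hom(V, K^o).

Lemma lfun_mulrn (b : dual) n u : (b *+ n) u = b u *+ n.
Proof. by elim: n => [|n IH]; rewrite ?mulr0n ?zero_lfunE // !mulrS add_lfunE IH. Qed.

(** The matrix of values of independent functionals on a basis is row free, so it
has a right inverse. *)
Lemma free_functionals (s : seq dual) : free s -> exists u, {in s, forall b : dual, b u = 1 :> K}.
Proof.
move=> sF; pose E := vbasis {:V}.
pose N := \matrix_(i < size s, j < \dim {:V}) (s`_i (tnth E j) : K).
have : row_free N.
  rewrite -kermx_eq0; apply/eqP/row_matrixP => i; rewrite row0.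
  set c := row i _; apply/rowP => k; rewrite [RHS]mxE.
  move: k; have /freeP F : free (in_tuple s) by [].
  apply: (F (fun k => c 0 k)); apply/lfunP => u.
  rewrite zero_lfunE sum_lfunE (coord_vbasis (memvf u)).
  have cN : c *m N = 0 by rewrite /c -row_mul mulmx_ker row0.
  under eq_bigr => k _ do rewrite scale_lfunE linear_sum scaler_sumr.
  rewrite exchange_big big1 // => j _.
  have /rowP/(_ j) := cN; rewrite !mxE => e1.
  under eq_bigr => k _ do rewrite linearZ /= scalerA mulrC -scalerA.
  rewrite -scaler_sumr (_ : \sum__ _ = 0) ?scaler0 // -[RHS]e1.
  by apply: eq_bigr => k _; rewrite [N k j]mxE (tnth_nth 0).
move=> /row_freeP[B NB]; pose y := B *m const_mx 1 : 'cV_(\dim {:V}).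
exists (\sum_j y j 0 *: tnth E j) => b bs.
have bi : (index b s < size s)%N by rewrite index_mem.
rewrite linear_sum; have /matrixP/(_ (Ordinal bi) 0) : N *m y = const_mx 1.
  by rewrite mulmxA NB mul1mx.
rewrite [in LHS]mxE [RHS]mxE => <-; apply: eq_bigr => j _.
by rewrite linearZ [N _ _]mxE /= nth_index // [RHS]mulrC.
Qed.
End Dual.

Section RootDecomposition.
Variables (K : numClosedFieldType) (g : lieAlgType K) (h : {vspace g}).
Local Notation d := (\dim {:g}).
Local Notation dual := (dual h).
Local Notation root_space := (@root_space K g h).
Local Notation is_root := (@is_root K g h).
Hypothesis g_simple : simple_lie g.
Hypothesis h_cartan : cartan_subalgebra h.
Variables (n : nat) (alpha : 'I_n -> dual) (s : seq dual).
Hypothesis s_base : root_base s.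
Hypothesis alphaP : forall b, (exists i, b = alpha i) <-> is_root b /\ nat_combination s b.
Variables (w : d.-tuple g) (a : 'I_d -> dual).
Hypothesis wB : basis_of {:g} w.
Hypothesis wa : forall i, tnth w i \in root_space (a i).

Lemma coord_lie u v i : coord w i (lie (vsval u) v) = (a i u : K) * coord w i v.
Proof.
rewrite [in LHS](coord_basis wB (memvf v)) linear_sum linear_sum /=.
rewrite (bigD1 i) //= big1 ?addr0 => [|j ji]; rewrite linearZ /= -tnth_nth.
  rewrite (root_spaceP _ _ (wa i)) linearZ linearZ /= (tnth_nth 0) coord_free ?(basis_free wB) //.
  by rewrite eqxx mulr1 mulrC.
rewrite (root_spaceP _ _ (wa j)) linearZ linearZ /= (tnth_nth 0) coord_free ?(basis_free wB) //.
by rewrite (negbTE ji) !mulr0.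
Qed.

Lemma root_space_coord b v i : v \in root_space b -> coord w i v != 0 -> a i = b.
Proof.
move=> /root_spaceP vb ci; apply/lfunP => u.
apply: (mulIf ci); rewrite -[LHS]coord_lie vb linearZ //.
Qed.

Lemma coord_neq0 v : v != 0 -> exists i, coord w i v != 0.
Proof.
move=> vN0; apply: contrapT => /forallNP c0; case/negP: vN0.
rewrite (coord_basis wB (memvf v)) big1 // => i _.
by have /negP/negbNE/eqP -> := c0 i; rewrite scale0r.
Qed.

Lemma w_neq0 i : tnth w i != 0.
Proof. by apply: (free_not0 (basis_free wB)); apply: mem_tnth. Qed.

Lemma is_rootP b : is_root b <-> b != 0 /\ exists i, a i = b.
Proof.
split=> [/andP[b0 bs]|[b0 [i ai]]].
  split=> //; have [i ci] : exists i, coord w i (vpick (root_space b)) != 0.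
    by apply: coord_neq0; rewrite vpick0.
  by exists i; apply: root_space_coord ci; apply: memv_pick.
rewrite /is_root b0 /=; apply/negP => /eqP rs0.
have := wa i; rewrite ai rs0 memv0; exact/negP/w_neq0.
Qed.

(** A vector of weight zero commutes with h and can be added to it, and h is
maximal. *)
Lemma h_root0 v : v \in root_space 0 -> v \in h.
Proof.
move=> /root_spaceP v0; have [h_ab h_max _] := h_cartan.
have xv x : x \in h -> lie x v = 0.
  by move=> xh; have := v0 (vsproj h x); rewrite vsprojK // zero_lfunE scale0r.
have ab : abelian_subspace (h + <[v]>)%VS.
  move=> _ _ /memv_addP[x xh [_ /vlineP[k ->] ->]] /memv_addP[y yh [_ /vlineP[l ->] ->]].
  rewrite lieDl lieZl !linearD !linearZ /= (h_ab _ _ xh yh) (xv x xh) liexx.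
  by rewrite [lie v y]lieC xv // oppr0 !scaler0 !addr0.
by rewrite -(h_max _ ab (addvSl _ _)); apply: subvP (addvSr _ _) _ (memv_line v).
Qed.

Lemma root0_h v : v \in h -> v \in root_space 0.
Proof.
have [h_ab _ _] := h_cartan; move=> vh; apply/root_spaceP => u.
by rewrite zero_lfunE scale0r; apply: h_ab => //; apply: subvsP.
Qed.

Lemma root_space_lie b c x y : x \in root_space b -> y \in root_space c ->
  lie x y \in root_space (b + c).
Proof.
move=> /root_spaceP xb /root_spaceP yc; apply/root_spaceP => u.
by rewrite lie_jacobi xb yc lieZl linearZ /= -scalerDl add_lfunE.
Qed.

Lemma root_exists : exists i, a i != 0.
Proof.
apply: contrapT => /forallNP a0; have [[x [y xy]] _] := g_simple.
have inh v : v \in h.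
  rewrite (coord_basis wB (memvf v)); apply: memv_suml => i _; apply: memvZ; apply: h_root0.
  by have /negP/negbNE/eqP <- := a0 i; rewrite -tnth_nth.
by have [h_ab _ _] := h_cartan; rewrite h_ab ?eqxx ?inh in xy.
Qed.

(** The eigenvalues of this element are the heights, which are integers with a
sign fixed on each half of the root system. *)
Lemma grading_element : exists u : subvs_of h, {in s, forall b : dual, b u = 1 :> K}.
Proof. by have [sF _ _] := s_base; apply: free_functionals. Qed.

Variable u0 : subvs_of h.
Hypothesis u0P : {in s, forall b : dual, b u0 = 1 :> K}.

Lemma nat_height b : nat_combination s b ->
  exists k : nat, (b u0 : K) = k%:R /\ (k = 0%N -> b = 0).
Proof.
case=> c ->; exists (\sum_(x <- s) c x)%N; split.
  rewrite sum_lfunE natr_sum big_seq [RHS]big_seq; apply: eq_bigr => x xs.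
  by rewrite lfun_mulrn u0P.
move=> /eqP; rewrite sum_nat_seq_eq0 => /allP c0; rewrite big_seq big1 // => x xs.
by have /eqP -> := c0 x xs; rewrite mulr0n.
Qed.

Lemma height_int b : is_root b -> exists k : int, (b u0 : K) = k%:~R /\ k != 0.
Proof.
move=> rb; have [_ _ /(_ b rb) bs] := s_base; have /andP[b0 _] := rb.
case: bs => /nat_height[k [bk k0]].
  by exists k%:Z; split=> //; apply: contraNneq b0 => -[/k0 ->].
exists (- k%:Z); split; first by rewrite mulrNz -pmulrn -bk opp_lfunE opprK.
by rewrite oppr_eq0; apply: contraNneq b0 => -[/k0 /eqP]; rewrite oppr_eq0.
Qed.

Lemma height_a i : exists k : int, (a i u0 : K) = k%:~R /\ (k = 0 -> a i = 0).
Proof.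
case: (eqVneq (a i) 0) => [->|ai]; first by exists 0; rewrite zero_lfunE.
have [|k [ek k0]] := @height_int (a i); first by apply/is_rootP; split=> //; exists i.
by exists k; split=> // /eqP; rewrite (negbTE k0).
Qed.

Definition killing (x y : g) := \tr (adM x *m adM y).

Lemma killing_lie x y z : killing (lie x y) z = - killing y (lie x z).
Proof.
rewrite /killing !adM_lie mulmxBl mulmxBr !linearB /= opprB -!mulmxA; congr (_ - _).
by rewrite mxtrace_mulC -mulmxA.
Qed.

Lemma killing_linl y : linear (killing^~ y : g -> K^o).
Proof. by move=> c x x'; rewrite /killing adM_linear mulmxDl -scalemxAl linearD linearZ. Qed.

(** Invariance of the trace form under the element of h on which b + c does not
vanish. *)
Lemma killing_root b c x y : x \in root_space b -> y \in root_space c -> b + c != 0 ->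
  killing x y = 0.
Proof.
move=> /root_spaceP xb /root_spaceP yc bc.
have [u bcu] : exists u, (b + c) u != 0 :> K.
  by apply: contrapT => /forallNP e0; case/negP: bc; apply/eqP/lfunP => u;
     rewrite zero_lfunE; have /negP/negbNE/eqP := e0 u.
apply: (mulfI bcu); rewrite mulr0.
have X := xb u; have Y := yc u; set t := vsval u in X Y.
have com v k : lie t v = k *: v -> adM v *m adM t = adM t *m adM v + k *: adM v.
  by move=> e; rewrite -linearZ -e /= adM_lie addrC subrK.
have : \tr (adM x *m adM y *m adM t) = \tr (adM t *m (adM x *m adM y)).
  exact: mxtrace_mulC.
rewrite -mulmxA (com _ _ Y) mulmxDr mulmxA (com _ _ X) mulmxDl -!mulmxA.
rewrite -scalemxAl -scalemxAr !linearD !linearZ /= => /eqP.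
rewrite -addrA -[X in _ == X]addr0 (inj_eq (addrI _)) -mulrDl add_lfunE => /eqP e1.
exact: e1.
Qed.

Lemma killing_grading : killing (vsval u0) (vsval u0) = \sum_i (a i u0 : K) ^+ 2.
Proof.
pose Q := \matrix_i rVof (vbasis {:g}) (tnth w i).
have Qu : Q \in unitmx by apply/(free_coord_mx (vbasisP _))/(basis_free wB).
pose D := diag_mx (\row_i (a i u0 : K)).
have QD : Q *m adM (vsval u0) = D *m Q.
  apply/row_matrixP => i; rewrite !row_mul rowK adM_rV (root_spaceP _ _ (wa i)).
  by rewrite linearZ /= row_diag_mx -scalemxAl mxE -rowE rowK.
have -> : killing (vsval u0) (vsval u0) = \tr (D *m D).
  rewrite /killing -[X in \tr X]mul1mx -(mulVmx Qu) -mulmxA mxtrace_mulC.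
  by rewrite !mulmxA QD -(mulmxA D Q) QD -!mulmxA mulmxV // mulmx1.
apply: eq_bigr => i _; rewrite mul_diag_mx !mxE eqxx mulr1n.
by rewrite expr2.
Qed.

Lemma killing_coord x y : killing x y = \sum_i coord w i y * killing x (tnth w i).
Proof.
rewrite {1}(coord_basis wB (memvf y)) /killing linear_sum mulmx_sumr linear_sum.
apply: eq_bigr => i _; rewrite linearZ -scalemxAr linearZ /=.
by rewrite (tnth_nth 0).
Qed.

(** The radical is an ideal.  It is not all of g, because the form is a sum of
squares of integers, not all zero, at the grading element. *)
Lemma killing_nondeg v : (forall y, killing v y = 0) -> v = 0.
Proof.
move=> kv.
pose F (v : g) : 'rV[K]_d := \row_i killing v (tnth w i).
have F_lin : linear F by move=> c x y; apply/rowP => i; rewrite !mxE [LHS]killing_linl.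
pose FL : {linear g -> 'rV[K]_d} := HB.pack F (GRing.isLinear.Build K _ _ _ F F_lin).
have kerP x : x \in lker (linfun FL) <-> forall y, killing x y = 0.
  rewrite memv_ker lfunE /=; split=> [/eqP/rowP F0 y|k0]; last first.
    by apply/eqP/rowP => i; rewrite !mxE k0.
  rewrite killing_coord big1 // => i _.
  by have := F0 i; rewrite !mxE => ->; rewrite mulr0.
have [_ /(_ (lker (linfun FL)))[|k0|kf]] := g_simple.
- move=> x y /kerP ky; apply/kerP => z; rewrite killing_lie ky oppr0 //.
- by apply/eqP; rewrite -memv0 -k0; apply/kerP.
have /kerP/(_ (vsval u0)) : vsval u0 \in lker (linfun FL) by rewrite kf memvf.
rewrite killing_grading => /eqP; rewrite psumr_eq0 => [/allP z0|i _]; last first.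
  by have [k [-> _]] := height_a i; rewrite -rmorphXn ler0z sqr_ge0.
have [i ai] := root_exists; have := z0 i (mem_index_enum _).
rewrite sqrf_eq0; have [k [-> k0]] := height_a i.
by rewrite intr_eq0 => /eqP/k0/eqP; rewrite (negbTE ai).
Qed.

(** Otherwise a root vector would be orthogonal to every weight space. *)
Lemma root_opp b : is_root b -> is_root (- b).
Proof.
move=> /is_rootP[b0 [i ai]].
have [j kij] : exists j, killing (tnth w i) (tnth w j) != 0.
  apply: contrapT => /forallNP k0; have /negP := w_neq0 i; apply; apply/eqP.
  apply: killing_nondeg => y; rewrite killing_coord big1 // => j _.
  by have /negP/negbNE/eqP -> := k0 j; rewrite mulr0.
apply/is_rootP; rewrite oppr_eq0; split=> //; exists j.
apply/eqP; rewrite eq_sym -subr_eq0 -opprD oppr_eq0 -ai.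
by apply/negPn/negP => aij; have := killing_root (wa i) (wa j) aij => /eqP; apply/negP.
Qed.

Lemma alpha_root i : is_root (alpha i).
Proof. by have [] := (alphaP (alpha i)).1 (ex_intro _ i erefl). Qed.

Lemma alpha_height i : exists k : nat, (alpha i u0 : K) = k.+1%:R.
Proof.
have [ra /nat_height[[|k] [ek k0]]] := (alphaP (alpha i)).1 (ex_intro _ i erefl).
  by have /andP[] := ra; rewrite k0 ?eqxx.
by exists k.
Qed.

Lemma root_sign b : is_root b -> (exists i, b = alpha i) \/ (exists i, b = - alpha i).
Proof.
move=> rb; have [_ _ /(_ b rb)[bs|bs]] := s_base; [left|right].
  by apply/alphaP.
have [i ei] : exists i, - b = alpha i by apply/alphaP; split=> //; apply: root_opp.
by exists i; rewrite -ei opprK.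
Qed.

Lemma weight_trichotomy i :
  [\/ a i = 0, exists j, a i = alpha j | exists j, a i = - alpha j].
Proof.
case: (eqVneq (a i) 0) => [->|ai]; first by constructor 1.
have [|[j ej]|[j ej]] := @root_sign (a i).
- by apply/is_rootP; split=> //; exists i.
- by constructor 2; exists j.
- by constructor 3; exists j.
Qed.

Lemma nat_combD b c : nat_combination s b -> nat_combination s c -> nat_combination s (b + c).
Proof.
move=> [k ->] [l ->]; exists (fun x => k x + l x)%N; rewrite -big_split.
by apply: eq_bigr => x _; rewrite mulrnDr.
Qed.

(** The height of a sum of two positive roots is positive, so the sum is not
zero. *)
Lemma root_space_sum i j x : x \in root_space (alpha i + alpha j) -> x != 0 ->
  exists k, alpha i + alpha j = alpha k.
Proof.
move=> xs x0; apply/alphaP; split; last first.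
  by apply: nat_combD; apply: (proj2 ((alphaP _).1 (ex_intro _ _ erefl))).
apply/andP; split; last by apply: contraNneq x0 => e0; rewrite -memv0 -e0.
have [k ek] := alpha_height i; have [l el] := alpha_height j.
apply/negP => /eqP/lfunP/(_ u0)/eqP.
by rewrite add_lfunE zero_lfunE /= ek el -natrD pnatr_eq0.
Qed.

Lemma root_space_opp_sum i j x : x \in root_space (- alpha i - alpha j) -> x != 0 ->
  exists k, - alpha i - alpha j = - alpha k.
Proof.
move=> xs x0; have [k ck] := coord_neq0 x0; have ak := root_space_coord xs ck.
have : is_root (- (- alpha i - alpha j)).
  apply: root_opp; apply/is_rootP; split; last by exists k.
  have [p ep] := alpha_height i; have [l el] := alpha_height j.
  apply/negP; rewrite -opprD oppr_eq0 => /eqP/lfunP/(_ u0)/eqP.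
  by rewrite add_lfunE zero_lfunE /= ep el -natrD pnatr_eq0.
rewrite -opprD opprK => ij; have : exists l, alpha i + alpha j = alpha l.
  apply/alphaP; split=> //.
  by apply: nat_combD; apply: (proj2 ((alphaP _).1 (ex_intro _ _ erefl))).
by case=> l ->; exists l.
Qed.

Local Notation nm := (nilp_opp alpha).
Local Notation np := (Defs.nilp alpha).

Lemma mem_nm i x : x \in root_space (- alpha i) -> x \in nm.
Proof. by move=> xi; apply: subvP (sumv_sup i _ (subvv _)) _ xi. Qed.
Lemma mem_np i x : x \in root_space (alpha i) -> x \in np.
Proof. by move=> xi; apply: subvP (sumv_sup i _ (subvv _)) _ xi. Qed.

Lemma triangular_full : (nm + (h + np))%VS = fullv.
Proof.
apply/eqP; rewrite eqEsubv subvf; apply/subvP => v _ /=.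
rewrite (coord_basis wB (memvf v)); apply: memv_suml => i _; apply: memvZ.
rewrite -tnth_nth; case: (weight_trichotomy i) => [e0|[j ej]|[j ej]].
- apply: subvP (addvSr _ _) _ _; apply: subvP (addvSl _ _) _ _.
  by apply: h_root0; rewrite -e0.
- apply: subvP (addvSr _ _) _ _; apply: subvP (addvSr _ _) _ _.
  by apply: (@mem_np j); rewrite -ej.
- by apply: subvP (addvSl _ _) _ _; apply: (@mem_nm j); rewrite -ej.
Qed.

(** The sign of the height separates the three summands of g, which makes their
sum direct. *)
Lemma nm_coord v i : v \in nm -> coord w i v != 0 -> (a i u0 : K) < 0.
Proof.
move=> /memv_sumP[F FP ->] ci.
have [j cj] : exists j, coord w i (F j) != 0.
  apply: contrapT => /forallNP c0; case/negP: ci; rewrite linear_sum big1 // => j _.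
  by have /negP/negbNE/eqP := c0 j.
rewrite (root_space_coord (FP j isT) cj) opp_lfunE oppr_lt0.
by have [k ->] := alpha_height j; rewrite ltr0n.
Qed.

Lemma np_coord v i : v \in np -> coord w i v != 0 -> 0 < (a i u0 : K).
Proof.
move=> /memv_sumP[F FP ->] ci.
have [j cj] : exists j, coord w i (F j) != 0.
  apply: contrapT => /forallNP c0; case/negP: ci; rewrite linear_sum big1 // => j _.
  by have /negP/negbNE/eqP := c0 j.
rewrite (root_space_coord (FP j isT) cj).
by have [k ->] := alpha_height j; rewrite ltr0n.
Qed.

Lemma h_coord v i : v \in h -> coord w i v != 0 -> (a i u0 : K) = 0.
Proof. by move=> /root0_h vh /(root_space_coord vh) ->; rewrite zero_lfunE. Qed.

Lemma coord_add_neq0 x y i : coord w i (x + y) != 0 -> coord w i x != 0 \/ coord w i y != 0.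
Proof.
case: (eqVneq (coord w i x) 0) => [x0|]; last by left.
by rewrite linearD /= x0 add0r; right.
Qed.

Lemma nm_direct : (nm :&: (h + np) = 0)%VS.
Proof.
apply/eqP; rewrite -subv0; apply/subvP => v; rewrite memv_cap => /andP[vm vb].
rewrite memv0; apply/negPn/negP => /coord_neq0[i ci].
have := nm_coord vm ci; have /memv_addP[x xh [y yn e]] := vb.
have [cx|cy] := coord_add_neq0 (eq_ind _ (fun z => is_true (coord w i z != 0)) ci _ e).
  by rewrite (h_coord xh cx) ltxx.
by move=> a0; have := lt_trans a0 (np_coord yn cy); rewrite ltxx.
Qed.

Lemma h_direct : (h :&: (nm + np) = 0)%VS.
Proof.
apply/eqP; rewrite -subv0; apply/subvP => v; rewrite memv_cap => /andP[vh vb].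
rewrite memv0; apply/negPn/negP => /coord_neq0[i ci].
have := h_coord vh ci; have /memv_addP[x xh [y yn e]] := vb.
have [cx|cy] := coord_add_neq0 (eq_ind _ (fun z => is_true (coord w i z != 0)) ci _ e).
  by have := nm_coord xh cx => /[swap] ->; rewrite ltxx.
by have := np_coord yn cy => /[swap] ->; rewrite ltxx.
Qed.

Lemma lie_sumr I (r : seq I) (F : I -> g) (x : g) :
  lie x (\sum_(i <- r) F i) = \sum_(i <- r) lie x (F i).
Proof. exact: linear_sum. Qed.

Lemma nm_lie x y : x \in nm -> y \in nm -> lie x y \in nm.
Proof.
move=> /memv_sumP[F FP ->] /memv_sumP[G GP ->].
rewrite lie_suml; apply: memv_suml => i _; rewrite lie_sumr; apply: memv_suml => j _.
have Fij := root_space_lie (FP i isT) (GP j isT).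
case: (eqVneq (lie (F i) (G j)) 0) => [->|ne]; first exact: mem0v.
by have [k ek] := root_space_opp_sum Fij ne; apply: (@mem_nm k); rewrite -ek.
Qed.

Lemma np_lie x y : x \in np -> y \in np -> lie x y \in np.
Proof.
move=> /memv_sumP[F FP ->] /memv_sumP[G GP ->].
rewrite lie_suml; apply: memv_suml => i _; rewrite lie_sumr; apply: memv_suml => j _.
have Fij := root_space_lie (FP i isT) (GP j isT).
case: (eqVneq (lie (F i) (G j)) 0) => [->|ne]; first exact: mem0v.
by have [k ek] := root_space_sum Fij ne; apply: (@mem_np k); rewrite -ek.
Qed.

Lemma h_np x y : x \in h -> y \in np -> lie x y \in np.
Proof.
move=> xh /memv_sumP[G GP ->]; rewrite lie_sumr; apply: memv_suml => j _.
apply: (@mem_np j); rewrite -[alpha j]add0r; apply: root_space_lie (GP j isT).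
exact: root0_h.
Qed.

Lemma borel_lie x y : x \in (h + np)%VS -> y \in (h + np)%VS -> lie x y \in np.
Proof.
move=> /memv_addP[x1 x1h [x2 x2n ->]] /memv_addP[y1 y1h [y2 y2n ->]].
have [h_ab _ _] := h_cartan.
rewrite lieDl !linearD /= (h_ab _ _ x1h y1h) add0r; apply: memvD; first exact: h_np.
by apply: memvD; [rewrite lieC memvN; apply: h_np|apply: np_lie].
Qed.

Lemma center_trivial (v : g) : (forall y, lie v y = 0) -> v = 0.
Proof.
move=> vc; have [[x [y xy]] simp] := g_simple.
have [x' z /vlineP[k ->]|v0|vf] := simp <[v]>%VS.
- by rewrite lieC lieZl vc scaler0 oppr0 mem0v.
- by apply/eqP; rewrite -memv0 -v0 memv_line.
case/negP: xy; have /vlineP[k ->] : x \in <[v]>%VS by rewrite vf memvf.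
by rewrite lieZl vc scaler0.
Qed.

Lemma proj_nm_id (v : g) : v \in nm -> proj_nilp_opp alpha v = v.
Proof. exact: daddv_pi_id nm_direct. Qed.
Lemma proj_nm_mem (v : g) : proj_nilp_opp alpha v \in nm.
Proof. exact: memv_pi. Qed.
Lemma proj_nm_compl (v : g) : v - proj_nilp_opp alpha v \in (h + np)%VS.
Proof.
rewrite -{1}(daddv_pi_add (w := v) nm_direct) ?triangular_full ?memvf //.
by rewrite /proj_nilp_opp addrC addKr memv_pi.
Qed.
Lemma proj_nm_b (v : g) : v \in (h + np)%VS -> proj_nilp_opp alpha v = 0.
Proof.
move=> vb; apply/eqP; rewrite -memv0 -nm_direct memv_cap proj_nm_mem /=.
by rewrite -[proj_nilp_opp _ _](subKr v) memvB // proj_nm_compl.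
Qed.
Lemma proj_h_mem (v : g) : proj_h alpha v \in h.
Proof. exact: memv_pi. Qed.
Lemma proj_h_0 (v : g) : v \in (nm + np)%VS -> proj_h alpha v = 0.
Proof.
move=> vb; apply/eqP; rewrite -memv0 -h_direct memv_cap proj_h_mem /=.
have full : v \in (h + (nm + np))%VS by apply: subvP (addvSr _ _) _ vb.
have e := daddv_pi_add h_direct full.
have -> : proj_h alpha v = v - daddv_pi (nm + np)%VS h v by rewrite -[X in X - _]e addrK.
by rewrite memvB // memv_pi.
Qed.

Variable f : 'I_n -> g.
Hypothesis f_root : forall i, f i \in root_space (- alpha i).

(** The span of the k-fold brackets of the f i with elements of g. *)
Fixpoint flag k : {vspace g} :=
  if k is j.+1 then (\sum_i (ad (f i) @: flag j))%VS else fullv.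

Lemma flag_lie i k v : v \in flag k -> lie (f i) v \in flag k.+1.
Proof.
by move=> vk; apply: subvP (sumv_sup i _ (subvv _)) _ _ => //; rewrite -adE memv_img.
Qed.

Lemma flag_sub k : (flag k.+1 <= flag k)%VS.
Proof.
elim: k => [|k IH]; first exact: subvf.
apply/subvP => _ /memv_sumP[F FP ->]; apply: memv_suml => i _.
have /memv_imgP[v vk ->] := FP i isT; rewrite adE; apply: flag_lie.
exact: subvP IH _ vk.
Qed.

(** Each bracket with some f i lowers the height by at least one. *)
Lemma flag_height : exists B : nat, forall k v i, v \in flag k -> coord w i v != 0 ->
  (a i u0 : K) <= B%:R - k%:R /\ - B%:R <= (a i u0 : K).
Proof.
have /choice[z zP] i : exists z : int, (a i u0 : K) = z%:~R.
  by have [z [-> _]] := height_a i; exists z.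
pose B := (\sum_i `|z i|)%N; exists B => k v i.
have zB l : (`|z l| <= B)%N by rewrite /B (bigD1 l) //= leq_addr.
have low l : - B%:R <= (a l u0 : K).
  by rewrite zP pmulrn -mulrNz ler_int; have := zB l; lia.
move=> vk ci; split; last exact: low.
elim: k v i vk ci => [|k IH] v i.
  by move=> _ _; rewrite subr0 zP pmulrn ler_int; have := zB i; lia.
move=> /memv_sumP[F FP ->] ci.
have [j cj] : exists j, coord w i (F j) != 0.
  apply: contrapT => /forallNP c0; case/negP: ci; rewrite linear_sum big1 // => j _.
  by have /negP/negbNE/eqP := c0 j.
have /memv_imgP[x xk ex] := FP j isT; rewrite ex adE in cj.
rewrite (coord_basis wB (memvf x)) lie_sumr linear_sum /= in cj.
have [l cl] : exists l, coord w i (lie (f j) (coord w l x *: w`_l)) != 0.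
  apply: contrapT => /forallNP c0; case/negP: cj; rewrite big1 // => l _.
  by have /negP/negbNE/eqP := c0 l.
rewrite linearZ linearZ /= mulf_eq0 negb_or in cl; case/andP: cl => cx cl.
have := wa l; rewrite (tnth_nth 0) => wl.
rewrite (root_space_coord (root_space_lie (f_root j) wl) cl).
rewrite add_lfunE opp_lfunE /=; have [m ->] := alpha_height j.
have := IH _ _ xk cx; move: (a l u0 : K) => al le.
rewrite addrC; apply: le_trans (lerB le (ler1n _ m.+1)) _; rewrite -natr1.
by rewrite opprD addrA lexx.
Qed.

(** The flag vanishes eventually, since heights are bounded, and it cannot be
stationary before; so its dimension drops at each step, and dim g steps, the
length at which the series in pi_mu are cut, are enough. *)
Lemma flag_dim : flag d = 0%VS.
Proof.
have [B BP] := flag_height.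
have flag0 : flag (B + B).+1 = 0%VS.
  apply/eqP; rewrite -subv0; apply/subvP => v vk; rewrite memv0.
  apply/negPn/negP => /coord_neq0[i ci]; have [le1 le2] := BP _ _ _ vk ci.
  have := le_trans le2 le1.
  by rewrite lerBrDr addrC lerBlDr -natrD ler_nat ltnn.
have stuck k : flag k.+1 = flag k -> flag k = 0%VS.
  move=> e; have st j : flag (j + k) = flag k.
    elim: j => // j IH; rewrite addSn -[RHS]e /=.
    by apply: eq_bigr => i _; rewrite IH.
  have le j : (flag (j + (B + B).+1) <= 0)%VS.
    elim: j => [|j IH]; first by rewrite add0n flag0 subvv.
    by rewrite addSn (subv_trans (flag_sub _)).
  by apply/eqP; rewrite -subv0 -(st (B + B).+1) addnC le.
have dimP k : (\dim (flag k) <= d - k)%N.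
  elim: k => [|k IH]; first by rewrite subn0 dimvS ?subvf.
  case: (eqVneq (flag k.+1) (flag k)) => [/[dup] e /stuck e0|ne].
    by rewrite e e0 dimv0.
  have : (\dim (flag k.+1) < \dim (flag k))%N.
    rewrite ltn_neqAle dimvS ?flag_sub // andbT; apply: contra_neq ne => e.
    by apply/eqP; rewrite eqEdim flag_sub e leqnn.
  by lia.
by apply/eqP; rewrite -dimv_eq0 -leqn0 -(subnn d) dimP.
Qed.

Lemma lie_h_f x i : x \in h -> lie x (f i) = - (alpha i (vsproj h x) : K) *: f i.
Proof.
move=> xh; have /root_spaceP/(_ (vsproj h x)) := f_root i.
by rewrite vsprojK // opp_lfunE.
Qed.

Hypothesis alpha_inj : injective alpha.
Variable th : 'I_n.
Hypothesis th_max : maximal_root alpha th.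

(** A nonzero bracket would make alpha i + theta a root above theta. *)
Lemma f_th_central i : lie (f i) (f th) = 0.
Proof.
apply/eqP/negPn/negP => ne.
have [k ek] := root_space_opp_sum (root_space_lie (f_root i) (f_root th)) ne.
have e0 : alpha k = alpha i + alpha th by apply: oppr_inj; rewrite -ek opprD.
have e : alpha k - alpha th = alpha i by rewrite e0 addrK.
have kth : alpha k = alpha th.
  apply: th_max; first exact: alpha_root.
  rewrite e; exists (fun b => (b == alpha i)%:R : nat).
  rewrite big_image (bigD1 i) //= eqxx mulr1n big1 ?addr0 // => j ji.
  by rewrite (inj_eq alpha_inj) (negbTE ji).
by have /andP[] := alpha_root i; rewrite -e kth subrr eqxx.
Qed.

End RootDecomposition.

(** * The Lie algebra with polynomial coefficients *)

Lemma lin_sum (R : nzRingType) (U W : lmodType R) (F : U -> W) (I : finType)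
    (c : I -> R) (x : I -> U) : linear F ->
  F (\sum_i c i *: x i) = \sum_i c i *: F (x i).
Proof.
move=> lF; have F0 := linear_map0 lF.
have FD u v : F (u + v) = F u + F v by have := lF 1 u v; rewrite !scale1r.
rewrite (big_morph F FD F0); apply: eq_bigr => i _.
by have := lF (c i) (x i) 0; rewrite F0 !addr0.
Qed.

Section VectorFieldDerivation.
Variables (K : fieldType) (n : nat) (p : 'I_n -> {mpoly K[n]}).

Lemma vderD : {morph vder p : x y / x + y}.
Proof.
by move=> x y; rewrite /vder -big_split; apply: eq_bigr => i _; rewrite mderivD mulrDr.
Qed.
Lemma vder0 : vder p 0 = 0.
Proof. by rewrite /vder big1 // => i _; rewrite mderiv0 mulr0. Qed.
Lemma vder_sum (I : finType) (F : I -> {mpoly K[n]}) :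
  vder p (\sum_i F i) = \sum_i vder p (F i).
Proof. exact: (big_morph _ vderD vder0). Qed.
Lemma vderC c : vder p c%:MP = 0.
Proof. by rewrite /vder big1 // => i _; rewrite mderivC mulr0. Qed.
Lemma vderM x y : vder p (x * y) = vder p x * y + x * vder p y.
Proof.
rewrite /vder mulr_suml mulr_sumr -big_split; apply: eq_bigr => i _.
by rewrite mderivM /=; ring.
Qed.
Lemma vderX i : vder p 'X_i = p i.
Proof.
rewrite /vder (bigD1 i) //= big1 ?addr0 => [|j ji]; rewrite mderivX mnm1E.
  rewrite eqxx scale1r (_ : (U_(i) - U_(i) = 0)%MM) ?mpolyX0 ?mulr1 //.
  by apply/mnmP => k; rewrite mnmBE subnn mnm0E.
by rewrite eq_sym (negbTE ji) scale0r mulr0.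
Qed.
End VectorFieldDerivation.

Section Extension.
Variables (K : numClosedFieldType) (g : lieAlgType K) (n : nat).
Local Notation P := {mpoly K[n]}.
Local Notation d := (\dim {:g}).
Local Notation e := (vbasis {:g}).
Local Notation L := 'rV[P]_d.
Let eB : basis_of {:g} e := vbasisP _.
Local Notation ext := (@ext_vec K g n).
Local Notation extE := (@ext_end K g n).
Local Notation mC := (@mpolyC n K).

Lemma ext_linear c x y : ext (c *: x + y) = c%:MP *: ext x + ext y.
Proof.
by apply/rowP => i; rewrite /ext_vec linearD linearZ !mxE mpolyCD mpolyCM.
Qed.
Lemma ext0 : ext 0 = 0.
Proof. by apply/rowP => i; rewrite /ext_vec linear0 !mxE mpolyC0. Qed.
Lemma extD x y : ext (x + y) = ext x + ext y.
Proof. by have := ext_linear 1 x y; rewrite mpolyC1 !scale1r. Qed.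
Lemma extZ c x : ext (c *: x) = c%:MP *: ext x.
Proof. by have := ext_linear c x 0; rewrite ext0 !addr0. Qed.
Lemma ext_sum (I : finType) (F : I -> g) : ext (\sum_i F i) = \sum_i ext (F i).
Proof. exact: (big_morph _ extD ext0). Qed.

Lemma ext_mul x (T : 'End(g)) : ext x *m extE T = ext (T x).
Proof. by rewrite /ext_vec /ext_end -map_mxM -(rVof_app _ eB). Qed.

Lemma ext_basis i : ext (tnth e i) = delta_mx 0 i.
Proof.
apply/rowP => j; rewrite !mxE (tnth_nth 0) coord_free ?(basis_free eB) // eqxx [j == i]eq_sym /=.
by case: (i == j); rewrite ?mpolyC1 ?mpolyC0.
Qed.

Lemma ext_span (v : L) : v = \sum_i v 0 i *: ext (tnth e i).
Proof. rewrite [LHS]row_sum_delta; by apply: eq_bigr => i _; rewrite ext_basis. Qed.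

Lemma lin_ext (B B' : L -> L) : linear B -> linear B' ->
  (forall x, B (ext x) = B' (ext x)) -> B =1 B'.
Proof.
move=> lB lB' BB' v.
rewrite (ext_span v) !lin_sum //; apply: eq_bigr => i _; rewrite BB' //.
Qed.

(** The bilinear extension of the bracket, written through the matrices that
[pi_mu] is made of. *)
Definition ext_lie (v w : L) : L := \sum_i v 0 i *: (w *m extE (ad (tnth e i))).

Lemma ext_lie_linl w : linear (ext_lie^~ w).
Proof.
move=> c x y; rewrite /ext_lie scaler_sumr -big_split; apply: eq_bigr => i _ /=.
by rewrite !mxE scalerDl scalerA.
Qed.
Lemma ext_lie_linr v : linear (ext_lie v).
Proof.
move=> c x y; rewrite /ext_lie scaler_sumr -big_split; apply: eq_bigr => i _ /=.
by rewrite mulmxDl -scalemxAl scalerDr !scalerA mulrC.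
Qed.

Lemma ext_lie_suml (I : finType) (F : I -> L) w : ext_lie (\sum_i F i) w = \sum_i ext_lie (F i) w.
Proof. exact: (br_suml ext_lie_linl). Qed.
Lemma ext_lieZl c v w : ext_lie (c *: v) w = c *: ext_lie v w.
Proof. exact: (brZl ext_lie_linl). Qed.

Lemma ext_lie_extl x v : ext_lie (ext x) v = v *m extE (ad x).
Proof.
apply: (@lin_ext (ext_lie (ext x)) (mulmxr (extE (ad x)))) => [||y] /=.
- exact: ext_lie_linr.
- exact: linearP.
rewrite ext_mul adE [x in RHS](coord_basis eB (memvf x)) lie_suml ext_sum.
apply: eq_bigr => i _; rewrite ext_mul adE lieZl extZ (tnth_nth 0); congr (_ *: _).
by rewrite !mxE.
Qed.

Lemma ext_lie_ext x y : ext_lie (ext x) (ext y) = ext (lie x y).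
Proof. by rewrite ext_lie_extl ext_mul adE. Qed.

Lemma ext_lie_anti v w : ext_lie v w = - ext_lie w v.
Proof.
apply: (@lin_ext (ext_lie^~ w) (fun v => - ext_lie w v)) v => [||x].
- exact: ext_lie_linl.
- by move=> c x y; rewrite ext_lie_linr opprD scalerN.
apply: (@lin_ext (ext_lie (ext x)) (fun w => - ext_lie w (ext x))) w => [||y].
- exact: ext_lie_linr.
- by move=> c y z; rewrite ext_lie_linl opprD scalerN.
by rewrite !ext_lie_ext lieC -scaleN1r extZ mpolyCN mpolyC1 scaleN1r.
Qed.

Lemma ext_lie_jacobi x y z : ext_lie x (ext_lie y z) = ext_lie (ext_lie x y) z + ext_lie y (ext_lie x z).
Proof.
apply: (@lin_ext (fun x => ext_lie x (ext_lie y z)) (fun x => ext_lie (ext_lie x y) z + ext_lie y (ext_lie x z))) x => [||x].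
- exact: ext_lie_linl.
- by move=> c u v /=; rewrite !ext_lie_linl ext_lie_linr addrACA scalerDr.
apply: (@lin_ext (fun y => ext_lie (ext x) (ext_lie y z)) (fun y => ext_lie (ext_lie (ext x) y) z + ext_lie y (ext_lie (ext x) z))) y => [||y].
- by move=> c u v /=; rewrite ext_lie_linl ext_lie_linr.
- by move=> c u v /=; rewrite ext_lie_linr !ext_lie_linl scalerDr addrACA.
apply: (@lin_ext (fun z => ext_lie (ext x) (ext_lie (ext y) z))
  (fun z => ext_lie (ext_lie (ext x) (ext y)) z + ext_lie (ext y) (ext_lie (ext x) z))) z => [||z].
- by move=> c u v /=; rewrite !ext_lie_linr.
- by move=> c u v /=; rewrite !ext_lie_linr scalerDr addrACA.
by rewrite !ext_lie_ext lie_jacobi extD.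
Qed.

Definition coefv (m : 'X_{1..n}) (v : L) : g := vecof e (map_mx (mcoeff m) v).

Lemma coefvD m v w : coefv m (v + w) = coefv m v + coefv m w.
Proof.
rewrite /coefv -linearD; congr vecof; apply/rowP => i.
by rewrite !mxE mcoeffD.
Qed.
Lemma coefv0 m : coefv m 0 = 0.
Proof. by apply: (addIr (coefv m 0)); rewrite -coefvD !add0r. Qed.
Lemma coefv_sum m (I : finType) (F : I -> L) : coefv m (\sum_i F i) = \sum_i coefv m (F i).
Proof. exact: (big_morph _ (coefvD m) (coefv0 m)). Qed.

Lemma coefv_end m v (T : 'End(g)) : coefv m (v *m extE T) = T (coefv m v).
Proof.
rewrite /coefv (hom_vecof _ eB); congr vecof; apply/rowP => j.
rewrite !mxE raddf_sum; apply: eq_bigr => i _.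
have -> : extE T i j = (mxof e e T i j)%:MP by rewrite [LHS]mxE.
by rewrite /= mulrC mcoeffCM mulrC; congr (_ * _); rewrite mxE.
Qed.

Lemma coefv_inj v : (forall m, coefv m v = 0) -> v = 0.
Proof.
move=> v0; apply/rowP => i; rewrite mxE; apply/mpolyP => m; rewrite mcoeff0.
have /eqP := v0 m; rewrite vecof_eq0 // => /eqP/rowP/(_ i).
by rewrite !mxE.
Qed.

(** The bracket with a constant acts on each coefficient separately, so every
coefficient of v is central in g. *)
Lemma ext_lie_faithful : (forall x : g, (forall y, lie x y = 0) -> x = 0) ->
  forall v, (forall c, ext_lie v (ext c) = 0) -> v = 0.
Proof.
move=> gc v vc; apply: coefv_inj => m; apply: gc => y.
have := vc y; rewrite ext_lie_anti ext_lie_extl => /eqP; rewrite oppr_eq0 => /eqP/(congr1 (coefv m)).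
by rewrite coefv_end coefv0 adE => e1; rewrite lieC e1 oppr0.
Qed.
End Extension.

(** * The homomorphism pi_mu *)

Section PiMu.
Variables (K : numClosedFieldType) (g : lieAlgType K) (h : {vspace g}).
Variables (n : nat) (alpha : 'I_n -> dual h) (f : 'I_n -> g) (mu : dual h).
Local Notation P := {mpoly K[n]}.
Local Notation d := (\dim {:g}).
Local Notation e := (vbasis {:g}).
Local Notation L := 'rV[P]_d.
Let eB : basis_of {:g} e := vbasisP _.
Local Notation ext := (@ext_vec K g n).
Local Notation extE := (@ext_end K g n).
Local Notation mC := (@mpolyC n K).
Local Notation br := (@ext_lie K g n).
Local Notation pn := (proj_nilp_opp alpha).
Let ft := [tuple f j | j < n].
Let wt (b : g) : K := (mu + rho alpha) (vsproj h (proj_h alpha b)).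

Hypothesis pn_pn : forall x y, pn (lie (pn x) (pn y)) = lie (pn x) (pn y).
Hypothesis pn_qq : forall x y, pn (lie (x - pn x) (y - pn y)) = 0.
Hypothesis f_free : free ft.
Hypothesis f_coord : forall x, \sum_i coord ft i (pn x) *: f i = pn x.
Hypothesis pn_f : forall i, pn (f i) = f i.
Hypothesis wt_pn : forall x y, wt (lie (pn x) (pn y)) = 0.
Hypothesis wt_qq : forall x y, wt (lie (x - pn x) (y - pn y)) = 0.
Hypothesis g_center : forall x : g, (forall y, lie x y = 0) -> x = 0.
Variable V : nat -> {vspace g}.
Hypothesis V0 : V 0 = fullv.
Hypothesis V_lie : forall i k v, v \in V k -> lie (f i) v \in V k.+1.
Hypothesis Vd : V d = 0%VS.

Definition generic_elt : L := \sum_i 'X_i *: ext (f i).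

Lemma ad_uE (v : L) : v *m ad_u f = br generic_elt v.
Proof.
rewrite /ad_u /generic_elt mulmx_sumr ext_lie_suml; apply: eq_bigr => i _.
by rewrite -scalemxAr ext_lieZl ext_lie_extl.
Qed.

(** So a subspace of g containing all coefficients of v contains all coefficients
of X_i v.  The coefficient is zero when the variable does not divide the
monomial. *)
Lemma coefvX m i (v : L) : exists m', coefv m ('X_i *: v) = coefv m' v \/ coefv m ('X_i *: v) = 0.
Proof.
exists (m - U_(i))%MM; case: (boolP (U_(i) <= m)%MM) => [le|nle]; [left|right].
  rewrite /coefv; congr vecof; apply/rowP => j; rewrite !mxE mulrC.
  by rewrite -{1}(submK le) addmC mcoeffMX.
apply/eqP; rewrite vecof_eq0 //; apply/eqP/rowP => j; rewrite !mxE.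
rewrite mcoeffM big1 // => k /eqP em.
rewrite mcoeffX; case: eqP => [e1|]; last by rewrite mul0r.
by case/negP: nle; rewrite em -e1; apply/mnm_lepP => l; rewrite mnmDE leq_addr.
Qed.

(** Each bracket with the generic element moves all coefficients one step down
the flag. *)
Lemma generic_elt_nil (v : L) : iter d (br generic_elt) v = 0.
Proof.
have inV k m : coefv m (iter k (br generic_elt) v) \in V k.
  elim: k m => [|k IH] m; first by rewrite V0 memvf.
  rewrite iterS /generic_elt ext_lie_suml coefv_sum; apply: memv_suml => i _.
  rewrite ext_lieZl ext_lie_extl.
  have [m' [->|->]] := coefvX m i (iter k (br generic_elt) v *m extE (ad (f i))); last exact: mem0v.
  by rewrite coefv_end adE; apply: V_lie.
by apply: coefv_inj => m; apply/eqP; rewrite -memv0 -Vd.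
Qed.

Lemma nilp_series_iter c (v : L) : v *m nilp_series c (ad_u f) = series mC d c (br generic_elt) v.
Proof.
rewrite /nilp_series /series mulmx_sumr; apply: eq_bigr => k _.
rewrite -scalemxAr; congr (_ *: _); elim: (k : nat) => [|j IH].
  by rewrite expr0 mulmx1.
by rewrite exprSr -mulmxE mulmxA IH ad_uE.
Qed.

(** The sign in - ad u is moved into the coefficients of the series, because the
results on [flow] are stated with e^(- t) at ad u. *)
Lemma exp_neg_ad_uE a : exp_neg_ad_u f a = flow mC d br generic_elt (ext a).
Proof.
have it k : ext a *m (- ad_u f) ^+ k = (-1) ^+ k *: iter k (br generic_elt) (ext a).
  elim: k => [|k IH]; first by rewrite !expr0 mulmx1 scale1r.
  rewrite exprSr -mulmxE mulmxA IH mulmxN -scalemxAl ad_uE.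
  by rewrite exprS mulN1r scaleNr.
rewrite /exp_neg_ad_u /flow /series /nilp_series mulmx_sumr; apply: eq_bigr => k _.
rewrite -scalemxAr it scalerA; congr (_ *: _).
by rewrite /expN_coef rmorphM rmorph_sign mulrC.
Qed.

Definition ext_proj (v : L) : L := v *m extE pn.
Definition ext_coproj (v : L) : L := v - ext_proj v.

Lemma ext_proj_ext x : ext_proj (ext x) = ext (pn x). Proof. exact: ext_mul. Qed.
Lemma extB x y : ext (x - y) = ext x - ext y.
Proof.
by rewrite extD -[- y]scaleN1r extZ mpolyCN mpolyC1 scaleN1r.
Qed.
Lemma ext_coproj_ext x : ext_coproj (ext x) = ext (x - pn x).
Proof. by rewrite /ext_coproj ext_proj_ext extB. Qed.
Lemma ext_proj_linear : linear ext_proj.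
Proof. by move=> c x y; rewrite /ext_proj mulmxDl -scalemxAl. Qed.
Lemma ext_coproj_linear : linear ext_coproj.
Proof. by move=> c x y; rewrite /ext_coproj ext_proj_linear scalerBr opprD addrACA. Qed.

Lemma bilin_ext (M : lmodType P) (B : L -> L -> M) :
  (forall w, linear (B^~ w)) -> (forall v, linear (B v)) ->
  (forall x y, B (ext x) (ext y) = 0) -> forall v w, B v w = 0.
Proof.
move=> Bl Br B0 v w; rewrite (ext_span v) (ext_span w).
rewrite (lin_sum (F := B^~ _)) // big1 // => i _.
by rewrite (lin_sum (F := B _)) // big1 ?scaler0 // => j _; rewrite B0 scaler0.
Qed.

Lemma ext_proj_pm v w : ext_proj (br (ext_proj v) (ext_proj w)) = br (ext_proj v) (ext_proj w).
Proof.
apply/eqP; rewrite -subr_eq0; apply/eqP.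
apply: (@bilin_ext _ (fun v w => ext_proj (br (ext_proj v) (ext_proj w)) - br (ext_proj v) (ext_proj w))) => [z c x y|z c x y|x y] /=.
- by rewrite ext_proj_linear ext_lie_linl ext_proj_linear scalerBr opprD addrACA.
- by rewrite ext_proj_linear ext_lie_linr ext_proj_linear scalerBr opprD addrACA.
- by rewrite !ext_proj_ext ext_lie_ext ext_proj_ext pn_pn subrr.
Qed.

Lemma ext_proj_qq v w : ext_proj (br (ext_coproj v) (ext_coproj w)) = 0.
Proof.
apply: (@bilin_ext _ (fun v w => ext_proj (br (ext_coproj v) (ext_coproj w)))) => [z c x y|z c x y|x y] /=.
- by rewrite ext_coproj_linear ext_lie_linl ext_proj_linear.
- by rewrite ext_coproj_linear ext_lie_linr ext_proj_linear.
- by rewrite !ext_coproj_ext ext_lie_ext ext_proj_ext pn_qq ext0.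
Qed.

Section Form.
Variable phi : g -> K.
Hypothesis phi_lin : linear (phi : g -> K^o).

Lemma ext_form_linear : linear (ext_form phi : L -> P^o).
Proof.
move=> c x y; rewrite /ext_form scaler_sumr -big_split; apply: eq_bigr => i _ /=.
by rewrite !mxE mulrDl -mulrA.
Qed.

Lemma ext_form_ext x : ext_form phi (ext x) = (phi x)%:MP.
Proof.
rewrite /ext_form {2}(coord_basis eB (memvf x)).
rewrite (lin_sum (F := phi : g -> K^o)) // rmorph_sum; apply: eq_bigr => i _ /=.
by rewrite [RHS]mpolyCM !mxE (tnth_nth 0).
Qed.

Lemma ext_form_vder p (v : L) : vder p (ext_form phi v) = ext_form phi (map_mx (vder p) v).
Proof.
rewrite /ext_form vder_sum; apply: eq_bigr => i _.
by rewrite vderM vderC mulr0 addr0 !mxE.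
Qed.
End Form.

(** The vector field enters [pi_mu] with a minus sign, included here. *)
Definition field_coef a i : P := - vector_field_coef alpha f a i.
Definition field_der a (v : L) : L := map_mx (vder (field_coef a)) v.

Lemma field_der_D a v w : field_der a (v + w) = field_der a v + field_der a w.
Proof. by apply/rowP => i; rewrite !mxE vderD. Qed.
Lemma field_der_scale a p v : field_der a (p *: v) = vder (field_coef a) p *: v + p *: field_der a v.
Proof. by apply/rowP => i; rewrite !mxE vderM. Qed.
Lemma field_der_end a (v : L) T : field_der a (v *m extE T) = field_der a v *m extE T.
Proof.
apply/rowP => j; rewrite !mxE vder_sum; apply: eq_bigr => i _.
by rewrite vderM !mxE vderC mulr0 addr0.
Qed.
Lemma field_der_ext a x : field_der a (ext x) = 0.
Proof. by apply/rowP => j; rewrite !mxE vderC. Qed.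
Lemma field_der_0 a : field_der a 0 = 0.
Proof. by apply/rowP => j; rewrite !mxE vder0. Qed.
Lemma field_der_sum a (I : finType) (F : I -> L) : field_der a (\sum_i F i) = \sum_i field_der a (F i).
Proof. exact: (big_morph _ (field_der_D a) (field_der_0 a)). Qed.

Lemma field_der_der a : is_der mC br ext (field_der a).
Proof.
split; first exact: field_der_D.
- by move=> c v; rewrite field_der_scale vderC scale0r add0r.
- move=> v w; rewrite /ext_lie field_der_sum -big_split; apply: eq_bigr => i _ /=.
  by rewrite field_der_scale field_der_end [field_der a v 0 i]mxE.
- exact: field_der_ext.
Qed.

Lemma field_der_uvec a : field_der a generic_elt = \sum_i field_coef a i *: ext (f i).
Proof.
by rewrite /generic_elt field_der_sum; apply: eq_bigr => i _; rewrite field_der_scale field_der_ext scaler0 addr0 vderX.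
Qed.

Lemma coord_lin i : linear (coord ft i : g -> K^o).
Proof. by move=> c x y; rewrite linearP. Qed.

Lemma ext_form_coord_f i (F : 'I_n -> P) :
  ext_form (coord ft i) (\sum_j F j *: ext (f j)) = F i.
Proof.
rewrite (lin_sum (F := ext_form (coord ft i) : L -> P^o)); last exact: ext_form_linear.
have fE j : f j = ft`_j by rewrite -tnth_nth tnth_mktuple.
rewrite (bigD1 i) //= big1 ?addr0 => [|j ji]; rewrite ext_form_ext ?fE; try exact: coord_lin.
  by rewrite coord_free // eqxx mpolyC1 [LHS]mulr1.
by rewrite coord_free // (negbTE ji) mpolyC0 [LHS]mulr0.
Qed.

Lemma ext_proj_coord (v : L) : \sum_i ext_form (coord ft i) (ext_proj v) *: ext (f i) = ext_proj v.
Proof.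
apply: (@lin_ext _ _ _ (fun v => \sum_i ext_form (coord ft i) (ext_proj v) *: ext (f i)) ext_proj) => [c x y||x] /=.
- rewrite scaler_sumr -big_split; apply: eq_bigr => i _ /=.
  by rewrite ext_proj_linear ext_form_linear scalerDl scalerA.
- exact: ext_proj_linear.
- rewrite ext_proj_ext -[in RHS](f_coord x) ext_sum; apply: eq_bigr => i _.
  by rewrite ext_form_ext ?extZ //; apply: coord_lin.
Qed.

Lemma ext_proj_idem v : ext_proj (ext_proj v) = ext_proj v.
Proof.
rewrite -[ext_proj v]ext_proj_coord {1}/ext_proj mulmx_suml; apply: eq_bigr => i _.
by rewrite -scalemxAl ext_mul pn_f.
Qed.

(** nbar is a subalgebra containing the generic element. *)
Lemma ext_proj_series c (v : L) :
  ext_proj (series mC d c (br generic_elt) (ext_proj v)) = series mC d c (br generic_elt) (ext_proj v).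
Proof.
have pmu : ext_proj generic_elt = generic_elt.
  rewrite /ext_proj /generic_elt mulmx_suml; apply: eq_bigr => i _.
  by rewrite -scalemxAl -/(ext_proj _) ext_proj_ext pn_f.
have it k : ext_proj (iter k (br generic_elt) (ext_proj v)) = iter k (br generic_elt) (ext_proj v).
  elim: k => [|k IH]; first exact: ext_proj_idem.
  by have := ext_proj_pm generic_elt (iter k (br generic_elt) (ext_proj v)); rewrite pmu IH.
rewrite /series {1}/ext_proj mulmx_suml; apply: eq_bigr => k _.
by rewrite -scalemxAl; congr (_ *: _); apply: it.
Qed.

Lemma ext_proj_todd (v : L) : ext_proj (todd mC d br generic_elt (ext_proj v)) = todd mC d br generic_elt (ext_proj v).
Proof. exact: ext_proj_series. Qed.

Local Notation y := (transport mC d br ext generic_elt).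

Lemma field_coefE a i : field_coef a i = - ext_form (coord ft i) (todd mC d br generic_elt (ext_proj (y a))).
Proof. by rewrite /field_coef /vector_field_coef nilp_series_iter exp_neg_ad_uE. Qed.

Lemma field_der_u a : field_der a generic_elt = - todd mC d br generic_elt (ext_proj (y a)).
Proof.
rewrite field_der_uvec -[in RHS]ext_proj_todd -ext_proj_coord -sumrN; apply: eq_bigr => i _.
by rewrite ext_proj_todd field_coefE scaleNr.
Qed.

(** The coefficients of a vector field are the coordinates of its value at the
generic element, so this is [field_bracket] in coordinates. *)
Lemma vfield_coef_lie a b i :
  vder (field_coef a) (field_coef b i) - vder (field_coef b) (field_coef a i) = field_coef (lie a b) i.
Proof.
have XX : field_der a (field_der b generic_elt) - field_der b (field_der a generic_elt) = field_der (lie a b) generic_elt.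
  apply: (@field_bracket _ _ mC L d br (@ext_lie_linl _ _ _) (@ext_lie_linr _ _ _) (@ext_lie_anti _ _ _)
    (@ext_lie_jacobi _ _ _) g ext (@lie K g) _ _ _ generic_elt generic_elt_nil ext_proj ext_coproj) => //.
  - by move=> x z; rewrite ext_lie_ext.
  - by move=> v; do 3 eexists; apply: ext_span.
  - exact: ext_lie_faithful.
  - by move=> v w; have := ext_proj_linear 1 v w; rewrite !scale1r.
  - by move=> v; rewrite /ext_coproj addrC subrK.
  - exact: ext_proj_pm.
  - exact: ext_proj_qq.
  - exact: field_der_der.
  - by move=> c v; apply: field_der_end.
  - exact: field_der_u.
have := congr1 (ext_form (coord ft i)) XX.
have XLX c c' : field_der c (field_der c' generic_elt) = \sum_j vder (field_coef c) (field_coef c' j) *: ext (f j).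
  by rewrite field_der_uvec field_der_sum; apply: eq_bigr => j _; rewrite field_der_scale field_der_ext scaler0 addr0.
rewrite !XLX -sumrB field_der_uvec.
under eq_bigr => j _ do rewrite -scalerBl.
by rewrite !ext_form_coord_f.
Qed.

Definition scalar_part a : P := ext_form wt (exp_neg_ad_u f a).

Lemma scalar_partE a : scalar_part a = ext_form wt (y a).
Proof. by rewrite /scalar_part exp_neg_ad_uE. Qed.

Let wt_lin : linear (wt : g -> K^o).
Proof. by move=> c x y; rewrite /wt !linearP. Qed.

Lemma scalar_part_lie a b : vder (field_coef a) (scalar_part b) - vder (field_coef b) (scalar_part a) = scalar_part (lie a b).
Proof.
have derE c c' : vder (field_coef c) (scalar_part c') = ext_form wt (field_der c (y c')).
  by rewrite scalar_partE ext_form_vder.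
apply: etrans (etrans (f_equal2 (fun p q => p - q) (derE a b) (derE b a)) _) (esym (scalar_partE (lie a b))).
apply: (@scalar_cocycle K _ mC L d br (@ext_lie_linl _ _ _) (@ext_lie_linr _ _ _) (@ext_lie_anti _ _ _)
    (@ext_lie_jacobi _ _ _) g ext (@lie K g) _ generic_elt generic_elt_nil ext_proj ext_coproj _ field_der field_der_der field_der_u (ext_form wt)).
- by move=> x z; rewrite ext_lie_ext.
- by move=> v; rewrite /ext_coproj addrC subrK.
- by move=> v w; have := ext_form_linear wt 1 v w; rewrite !scale1r.
- move=> v w.
  apply: (@bilin_ext P^o (fun v w => ext_form wt (br (ext_proj v) (ext_proj w)))) => [z c x y'|z c x y'|x z] /=.
  + by rewrite ext_proj_linear ext_lie_linl ext_form_linear.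
  + by rewrite ext_proj_linear ext_lie_linr ext_form_linear.
  + by rewrite !ext_proj_ext ext_lie_ext ext_form_ext // wt_pn mpolyC0.
- move=> v w.
  apply: (@bilin_ext P^o (fun v w => ext_form wt (br (ext_coproj v) (ext_coproj w)))) => [z c x y'|z c x y'|x z] /=.
  + by rewrite ext_coproj_linear ext_lie_linl ext_form_linear.
  + by rewrite ext_coproj_linear ext_lie_linr ext_form_linear.
  + by rewrite !ext_coproj_ext ext_lie_ext ext_form_ext // wt_qq mpolyC0.
Qed.

Lemma pi_muE a : pi_mu alpha f mu a = vfield (field_coef a) + weyl_of_poly (scalar_part a).
Proof.
rewrite /pi_mu; congr (_ + _); rewrite /vfield -sumrN; apply: eq_bigr => i _.
by rewrite /field_coef !weyl_of_polyE -mulNr -[- peval _ _]sub0r -(peval0 (@wx K n)) -pevalB sub0r.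
Qed.

Theorem pi_mu_lie a b : pi_mu alpha f mu (lie a b) =
  pi_mu alpha f mu a * pi_mu alpha f mu b - pi_mu alpha f mu b * pi_mu alpha f mu a.
Proof.
apply: etrans (pi_muE (lie a b)) _.
apply: etrans (esym _) (f_equal2 (fun x y => x * y - y * x) (esym (pi_muE a)) (esym (pi_muE b))).
apply: etrans (first_order_bracket (field_coef a) (field_coef b) (scalar_part a) (scalar_part b)) _.
congr (_ + _).
  by apply: vfield_ext => i; apply: vfield_coef_lie.
by congr weyl_of_poly; apply: scalar_part_lie.
Qed.

Lemma exp_neg_linear c x y' :
  exp_neg_ad_u f (c *: x + y') = c%:MP *: exp_neg_ad_u f x + exp_neg_ad_u f y' :> L.
Proof. by rewrite /exp_neg_ad_u ext_linear mulmxDl -scalemxAl. Qed.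

Lemma ext_form_scale phi c (v w : L) :
  ext_form phi (c%:MP *: v + w) = c *: ext_form phi v + ext_form phi w.
Proof. by rewrite ext_form_linear -mul_mpolyC. Qed.

Lemma pi_mu_linear : linear (pi_mu alpha f mu).
Proof.
move=> c x z; apply: etrans (pi_muE _) _.
have ce : scalar_part (c *: x + z) = c *: scalar_part x + scalar_part z.
  by rewrite /scalar_part exp_neg_linear ext_form_scale.
have ve i : field_coef (c *: x + z) i = c *: field_coef x i + field_coef z i.
  rewrite /field_coef /vector_field_coef exp_neg_linear !mulmxDl -!scalemxAl ext_form_scale.
  by rewrite opprD scalerN.
apply: etrans (f_equal2 +%R (vfield_ext ve) (congr1 (@weyl_of_poly K n) ce)) _.
apply: etrans (first_order_linear c (field_coef x) (field_coef z) (scalar_part x) (scalar_part z)) _.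
by apply: f_equal2 (esym (pi_muE z)); apply: congr1; apply: esym; apply: pi_muE.
Qed.

Hypothesis wt_n : forall x, wt (pn x) = 0.

Lemma ext_form_pm v : ext_form wt (ext_proj v) = 0.
Proof.
rewrite (ext_span v) /ext_proj -/(ext_proj _) (lin_sum (F := ext_proj)); last exact: ext_proj_linear.
rewrite (lin_sum (F := ext_form wt : L -> P^o)); last exact: ext_form_linear.
by rewrite big1 // => i _; rewrite ext_proj_ext ext_form_ext // wt_n mpolyC0 scaler0.
Qed.

Lemma todd_killed v : br generic_elt v = 0 -> todd mC d br generic_elt v = v.
Proof.
move=> uv; rewrite /todd (series_widen _ (@ext_lie_linr _ _ _ generic_elt) generic_elt_nil _ _ (leqnSn d)).
have it k : iter k.+1 (br generic_elt) v = 0.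
  by rewrite iterSr uv; apply: iter_0; apply: ext_lie_linr.
rewrite big_ord_recl big1 ?addr0 => [|k _]; last by rewrite lift0 it scaler0.
have := todd_coefP K 0; rewrite big_ord1 subnn fact0 (_ : 1`! = 1)%N // invr1 mulr1 => ->.
by rewrite rmorph1 scale1r.
Qed.

(** Put N = [u, x], which has values in nbar.  Then y_x = x - psi N, whose
nbar-component - psi N is sent to - N by the Todd series, and whose h-component
is x. *)
Lemma pi_mu_h x (c : 'I_n -> K) : pn x = 0 -> (forall i, lie (f i) x = c i *: f i) ->
  pi_mu alpha f mu x = vfield (fun i => c i *: 'X_i) + (wt x)%:A.
Proof.
move=> xn fx; pose N : L := \sum_i (c i *: 'X_i) *: ext (f i).
have uN : br generic_elt (ext x) = N.
  rewrite /generic_elt ext_lie_suml; apply: eq_bigr => i _.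
  by rewrite ext_lieZl ext_lie_ext fx extZ scalerA mulrC mul_mpolyC.
have pmN : ext_proj N = N.
  rewrite /N {1}/ext_proj mulmx_suml; apply: eq_bigr => i _.
  by rewrite -scalemxAl ext_mul pn_f.
have yE : y x = ext x - psi mC d br generic_elt N
  by rewrite -uN; apply: (@flow_psi _ _ mC L d br (@ext_lie_linr _ _ _) generic_elt generic_elt_nil).
have psiN : ext_proj (psi mC d br generic_elt N) = psi mC d br generic_elt N.
  by rewrite -pmN; apply: ext_proj_series.
have pmy : ext_proj (y x) = - psi mC d br generic_elt N.
  rewrite yE [ext x - _]addrC; have := ext_proj_linear (-1) (psi mC d br generic_elt N) (ext x).
  by rewrite !scaleN1r => ->; rewrite psiN ext_proj_ext xn ext0 addr0.
apply: etrans (pi_muE x) _; congr (_ + _).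
  apply: vfield_ext => i; rewrite field_coefE pmy.
  have -> : todd mC d br generic_elt (- psi mC d br generic_elt N) = - N.
    rewrite -[- psi _ _ _ _ _]scaleN1r /todd (seriesZ mC d (@ext_lie_linr _ _ _ generic_elt)) -/(todd _ _ _ _ _).
    by rewrite (@todd_psi _ _ mC L d br (@ext_lie_linr _ _ _) generic_elt generic_elt_nil) scaleN1r.
  have -> : - N = \sum_j (- (c j *: 'X_j)) *: ext (f j).
    by rewrite -sumrN; apply: eq_bigr => j _; rewrite scaleNr.
  by rewrite ext_form_coord_f opprK.
rewrite -(pevalC (@wx K n)) -weyl_of_polyE; congr weyl_of_poly.
rewrite scalar_partE yE -psiN [ext x - _]addrC.
have := ext_form_linear wt (-1) (ext_proj (psi mC d br generic_elt N)) (ext x).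
by rewrite !scaleN1r => ->; rewrite ext_form_pm oppr0 add0r ext_form_ext.
Qed.

(** The generic element centralizes f th, so both series fix it. *)
Lemma pi_mu_f th : (forall i, lie (f i) (f th) = 0) ->
  pi_mu alpha f mu (f th) = - wd K th.
Proof.
move=> fth.
have uf : br generic_elt (ext (f th)) = 0.
  rewrite /generic_elt ext_lie_suml big1 // => i _.
  by rewrite ext_lieZl ext_lie_ext fth ext0 scaler0.
have yE : y (f th) = ext (f th).
  apply: etrans (@flow_psi _ _ mC L d br (@ext_lie_linr _ _ _) generic_elt generic_elt_nil _) _; rewrite uf.
  by rewrite /psi (series0 mC d (@ext_lie_linr _ _ _ generic_elt)) subr0.
have pmf : ext_proj (ext (f th)) = ext (f th) by rewrite ext_proj_ext pn_f.
apply: etrans (pi_muE _) _.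
have fE j : f j = ft`_j by rewrite -tnth_nth tnth_mktuple.
have -> : scalar_part (f th) = 0 by rewrite scalar_partE yE -pmf ext_form_pm.
rewrite weyl_of_polyE peval0 addr0 /vfield (bigD1 th) //= big1 => [|i ith].
  rewrite field_coefE yE pmf todd_killed // ext_form_ext; last exact: coord_lin.
  rewrite addr0 (fE th) coord_free // eqxx mpolyC1 weyl_of_polyE -[-1]sub0r pevalB.
  by rewrite peval0 sub0r peval1 mulN1r.
rewrite field_coefE yE pmf todd_killed // ext_form_ext; last exact: coord_lin.
rewrite (fE th) coord_free // eq_sym (negbTE ith) mpolyC0 oppr0 weyl_of_polyE.
by rewrite peval0 mul0r.
Qed.
End PiMu.

(** * Commuting operators and characters *)

Section CommutingOperators.
Variables (K : numClosedFieldType) (G : algType K) (M : lmodType K).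
Variable op : G -> M -> M.
Hypothesis op_lin : forall a, linear (op a).
Hypothesis op1 : forall v, op 1 v = v.
Hypothesis opD : forall a b v, op (a + b) v = op a v + op b v.
Hypothesis opM : forall a b v, op (a * b) v = op a (op b v).
Hypothesis opZ : forall c a v, op (c *: a) v = c *: op a v.
Hypothesis opC : forall a b v, op a (op b v) = op b (op a v).

HB.instance Definition _ a := GRing.isLinear.Build K M M *:%R (op a) (op_lin a).

Lemma op_r0 a : op a 0 = 0. Proof. exact: linear0. Qed.
Lemma op_rD a : {morph op a : u v / u + v}. Proof. exact: linearD. Qed.
Lemma op_rsum a (I : finType) (F : I -> M) :
  op a (\sum_i F i) = \sum_i op a (F i).
Proof. exact: (big_morph _ (op_rD a) (op_r0 a)). Qed.
Lemma op0 v : op 0 v = 0.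
Proof. by rewrite -(scale0r 1) opZ scale0r. Qed.

Definition op_poly (a : G) (p : {poly K}) : M -> M := op (horner_alg a p).

Lemma op_poly_r0 a p : op_poly a p 0 = 0. Proof. exact: op_r0. Qed.
Lemma op_polyM a p q v : op_poly a (p * q) v = op_poly a p (op_poly a q v).
Proof. by rewrite /op_poly rmorphM opM. Qed.
Lemma op_polyD a p q v : op_poly a (p + q) v = op_poly a p v + op_poly a q v.
Proof. by rewrite /op_poly rmorphD opD. Qed.
Lemma op_poly1 a v : op_poly a 1 v = v.
Proof. by rewrite /op_poly rmorph1 op1. Qed.
Lemma op_poly_rD a p : {morph op_poly a p : u v / u + v}.
Proof. exact: op_rD. Qed.
Lemma op_polyX a v : op_poly a 'X v = op a v.
Proof. by rewrite /op_poly horner_algX. Qed.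
Lemma op_polyC a c v : op_poly a c%:P v = c *: v.
Proof. by rewrite /op_poly horner_algC opZ op1. Qed.
Lemma op_poly_op a p b v : op_poly a p (op b v) = op b (op_poly a p v).
Proof. exact: opC. Qed.
Lemma op_poly_shift a c k : op_poly a (('X - c%:P) ^+ k) = op ((a - c%:A) ^+ k).
Proof. by rewrite /op_poly rmorphXn rmorphB /= horner_algX horner_algC. Qed.

Lemma op_poly_coprime a p q v :
  coprimep p q -> op_poly a p v = 0 -> op_poly a q v = 0 -> v = 0.
Proof.
move=> /Bezout_eq1_coprimepP[[u w]] /= e pv qv.
by rewrite -(op_poly1 a v) -e op_polyD !op_polyM pv qv !op_poly_r0 addr0.
Qed.

Lemma coprime_shift (c c' : K) k k' : c != c' ->
  coprimep (('X - c%:P) ^+ k) (('X - c'%:P) ^+ k').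
Proof.
move=> cc'; apply/coprimep_expl/coprimep_expr.
by rewrite coprimep_XsubC root_XsubC eq_sym.
Qed.

Lemma shift_neq a c c' k k' v : c != c' ->
  op ((a - c%:A) ^+ k) v = 0 -> op ((a - c'%:A) ^+ k') v = 0 -> v = 0.
Proof. by move=> /(coprime_shift k k'); rewrite -!op_poly_shift; apply: op_poly_coprime. Qed.

Lemma shift_leq a c k k' v : (k <= k')%N ->
  op ((a - c%:A) ^+ k) v = 0 -> op ((a - c%:A) ^+ k') v = 0.
Proof. by move=> /subnK <- e; rewrite exprD opM e op_r0. Qed.

Definition gen_eigen (chi : G -> K) (v : M) :=
  exists k, forall a, op ((a - (chi a)%:A) ^+ k) v = 0.

Lemma gen_eigen_op chi v b : gen_eigen chi v -> gen_eigen chi (op b v).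
Proof. by case=> k kP; exists k => a; rewrite opC kP op_r0. Qed.

(** The power of a - chi a that kills the last component is injective on the
components of the other characters, for an a at which they differ. *)
Lemma gen_eigen_independent m (chi : 'I_m -> G -> K) (w : 'I_m -> M) :
  (forall i j, chi i =1 chi j -> i = j) -> (forall i, gen_eigen (chi i) (w i)) ->
  \sum_i w i = 0 -> forall i, w i = 0.
Proof.
elim: m chi w => [|m IH] chi w inj wP; first by move=> _ [].
rewrite big_ord_recr /= => sw0.
have [k kP] := wP ord_max.
have w0 i : w (widen_ord (leqnSn m) i) = 0.
  have : ~ (chi (widen_ord (leqnSn m) i) =1 chi ord_max).
    by move=> /inj /(congr1 val) /= e; have := ltn_ord i; rewrite e ltnn.
  move=> /existsNP[a ne]; have [k' k'P] := wP (widen_ord (leqnSn m) i).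
  apply: (@shift_neq a (chi (widen_ord (leqnSn m) i) a) (chi ord_max a) k' k) => //.
    exact/eqP.
  apply: (IH (fun i => chi (widen_ord (leqnSn m) i))
     (fun i => op ((a - (chi ord_max a)%:A) ^+ k) (w (widen_ord (leqnSn m) i)))).
  - by move=> j j' /inj /(congr1 val) /= e; apply/val_inj.
  - by move=> j; apply/gen_eigen_op/wP.
  - have := congr1 (op ((a - (chi ord_max a)%:A) ^+ k)) sw0.
    by rewrite op_rD kP addr0 op_r0 op_rsum.
move=> i; have [j ->|->] := unliftP ord_max i.
  rewrite (_ : lift ord_max j = widen_ord (leqnSn m) j) ?w0 //.
  by apply/val_inj; rewrite /= /bump leqNgt ltn_ord.
by move: sw0; rewrite big1 ?add0r.
Qed.

Definition gen_eigen_sum (v : M) :=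
  exists m (chi : 'I_m -> {lrmorphism G -> K^o}) (w : 'I_m -> M),
    (forall i, gen_eigen (chi i) (w i)) /\ v = \sum_i w i.

Lemma gen_eigen_sum0 : gen_eigen_sum 0.
Proof.
have no (i : 'I_0) : False by case: i.
exists 0%N, (fun i => False_rect _ (no i)), (fun=> 0).
by split; [case|rewrite big_ord0].
Qed.

Lemma gen_eigen_sumD u v : gen_eigen_sum u -> gen_eigen_sum v -> gen_eigen_sum (u + v).
Proof.
case=> m [chi [w [wP ->]]] [m' [chi' [w' [wP' ->]]]].
exists (m + m')%N, (fun i => match split i with inl j => chi j | inr j => chi' j end).
exists (fun i => match split i with inl j => w j | inr j => w' j end); split.
  by move=> i; case: (split i).
rewrite big_split_ord /=; congr (_ + _); apply: eq_bigr => i _.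
  by case: splitP => j /= e; [congr w; apply/val_inj|have := ltn_ord i; rewrite e; lia].
by case: splitP => j /= e; [have := ltn_ord j; rewrite -e; lia|congr w'; apply/val_inj => /=; lia].
Qed.

Lemma gen_eigen_sum1 (chi : {lrmorphism G -> K^o}) v : gen_eigen chi v -> gen_eigen_sum v.
Proof. by move=> cv; exists 1%N, (fun=> chi), (fun=> v); rewrite big_ord1. Qed.

Lemma nil_add x y n i i' v : (i + i' <= n)%N ->
  op (x ^+ i) v = 0 -> op (y ^+ i') v = 0 -> op ((x + y) ^+ n) v = 0.
Proof.
elim: n i i' v => [|n IH] i i' v.
  by rewrite leqn0 addn_eq0 => /andP[/eqP-> _]; rewrite !expr0.
case: i => [_|i]; first by rewrite expr0 op1 => -> _; rewrite op_r0.
case: i' => [_ _|i']; first by rewrite expr0 op1 => ->; rewrite op_r0.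
move=> le xv yv; rewrite exprSr opM opD op_rD.
have -> : op ((x + y) ^+ n) (op x v) = 0.
  by apply: (IH i i'.+1); [lia|rewrite -opM -exprSr|rewrite opC yv op_r0].
have -> : op ((x + y) ^+ n) (op y v) = 0.
  by apply: (IH i.+1 i'); [lia|rewrite opC xv op_r0|rewrite -opM -exprSr].
by rewrite addr0.
Qed.

Lemma op_exprM a b k v : op ((a * b) ^+ k) v = op (a ^+ k) (op (b ^+ k) v).
Proof.
elim: k v => [|k IH] v; first by rewrite !expr0 op1.
by rewrite exprS opM IH !opM exprS opM exprS opM; congr op; rewrite opC.
Qed.

(** If every operator has a single eigenvalue on a set of vectors, these
eigenvalues form a character, because sums and multiples of commuting nilpotent
operators are nilpotent. *)
Lemma one_eigenvalue (N : M -> Prop) (k : nat) (v0 : M) :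
  N v0 -> v0 <> 0 ->
  (forall a, exists c : K, forall v, N v -> op ((a - c%:A) ^+ k) v = 0) ->
  exists chi : {lrmorphism G -> K^o}, forall v, N v -> gen_eigen chi v.
Proof.
move=> Nv0 v0N0 /choice[chi chiP].
pose nil a := exists j, op (a ^+ j) v0 = 0.
have nilchi a : nil (a - (chi a)%:A) by exists k; apply: chiP.
have nilD a b : nil a -> nil b -> nil (a + b).
  by case=> i ai [j bj]; exists (i + j)%N; apply: (nil_add (leqnn _) ai bj).
have nilMl a b : nil b -> nil (a * b).
  by case=> j bj; exists j; rewrite op_exprM bj op_r0.
have nilMr a b : nil a -> nil (a * b).
  by case=> j bj; exists j; rewrite op_exprM opC bj op_r0.
have uniq a c : nil (a - c%:A) -> chi a = c.
  case=> j e; apply/eqP/negPn/negP => /shift_neq-/(_ _ _ _ _ (chiP a _ Nv0) e).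
  exact: v0N0.
have chi_lin : linear (chi : G -> K^o).
  move=> c a b; apply: uniq.
  rewrite (_ : _ - _ = c%:A * (a - (chi a)%:A) + (b - (chi b)%:A)); last first.
    by rewrite mulr_algl scalerBr scalerA scalerDl opprD addrACA.
  by apply/nilD => //; apply/nilMl.
have chi_mul : monoid_morphism (chi : G -> K^o).
  split=> [|a b]; apply: uniq; first by exists 1%N; rewrite scale1r subrr expr1 op0.
  rewrite (_ : _ - _ = (a - (chi a)%:A) * b + (chi a)%:A * (b - (chi b)%:A)).
    by apply/nilD; [apply/nilMr|apply/nilMl].
  by rewrite mulrBl mulrBr !mulr_algl addrA subrK scalerA.
pose lchi : {lrmorphism G -> K^o} := HB.pack (chi : G -> K^o)
  (GRing.isMonoidMorphism.Build G K^o (chi : G -> K^o) chi_mul)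
  (GRing.isLinear.Build K G K^o *:%R (chi : G -> K^o) chi_lin).
by exists lchi => v Nv; exists k => a; apply: chiP.
Qed.

(** Unless every operator has a single eigenvalue, the characteristic polynomial
of one of them is a product of two coprime factors, whose kernels have smaller
dimension and stable images under Phi, and induction applies. *)
Lemma gen_eigen_sum_findim r (Phi : {linear 'rV[K]_r -> M}) :
  (forall a x, exists y, op a (Phi x) = Phi y) -> forall x, gen_eigen_sum (Phi x).
Proof.
have [n] := ubnP r; elim: n => // n IH in r Phi *; rewrite ltnS => rn Phi_stable.
case: (pselect (forall x, Phi x = 0)) => [Phi0 x|/existsNP[x0 x0N]].
  by rewrite Phi0; apply: gen_eigen_sum0.
case: r => [|r] in Phi rn Phi_stable x0 x0N *.
  by case: x0N; rewrite thinmx0 linear0.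
case: (pselect (forall a, exists c : K, forall v, (exists x, v = Phi x) ->
    op ((a - c%:A) ^+ r.+1) v = 0)) => [one|].
  have [chi chiP] := one_eigenvalue (ex_intro _ x0 erefl) x0N one.
  by move=> x; apply/gen_eigen_sum1/chiP; exists x.
move=> /existsNP[a /forallNP aN].
have /choice[yy yyP] (i : 'I_r.+1) : exists y, op a (Phi (delta_mx 0 i)) = Phi y.
  exact: Phi_stable.
pose A : 'M[K]_r.+1 := \matrix_i yy i.
have AP x : op a (Phi x) = Phi (x *m A).
  rewrite [in LHS](row_sum_delta x) linear_sum op_rsum mulmx_sum_row linear_sum.
  by apply: eq_bigr => i _; rewrite /= !linearZ /= yyP rowK.
have popA p x : op_poly a p (Phi x) = Phi (x *m horner_mx A p).
  elim/poly_ind: p x => [|p c IHp] x; first by rewrite /op_poly !rmorph0 op0 mulmx0 linear0.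
  rewrite op_polyD op_polyM op_polyX op_polyC AP IHp -linearZ -linearD.
  rewrite rmorphD rmorphM /= horner_mx_X horner_mx_C mulmxDr mul_mx_scalar.
  congr (Phi (_ + _)); rewrite -mulmxA; congr (x *m _).
  exact: comm_mx_horner.
have kerP p x : (x <= kermxpoly A p)%MS -> op_poly a p (Phi x) = 0.
  by rewrite popA => /sub_kermxP ->; rewrite linear0.
have split_sum P Q : coprimep P Q -> (\rank (kermxpoly A P) < r.+1)%N ->
    (forall w : 'rV_r.+1, (w <= kermxpoly A P + kermxpoly A Q)%MS) ->
  forall x, (x <= kermxpoly A P)%MS -> gen_eigen_sum (Phi x).
  move=> PQ rk PQ1 x xP.
  have [y ->] : exists y, x = y *m row_base (kermxpoly A P).
    by apply/submxP; rewrite eq_row_base.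
  apply: (IH _ (Phi \o mulmxr (row_base (kermxpoly A P)))); first exact: leq_trans rk rn.
  move=> b z /=; set x1 := z *m _.
  have x1P : (x1 <= kermxpoly A P)%MS by rewrite (submx_trans (submxMl _ _)) ?eq_row_base.
  have [w ew] := Phi_stable b x1.
  have /sub_addsmxP[[u1 u2] /= ew12] := PQ1 w.
  have w1P := submxMl u1 (kermxpoly A P); have w2Q := submxMl u2 (kermxpoly A Q).
  (* Phi need not be injective, so w itself need not lie in the kernel of P; but
     Phi kills its component in the kernel of Q. *)
  have w20 : Phi (u2 *m kermxpoly A Q) = 0.
    apply: (op_poly_coprime PQ) (kerP _ _ w2Q).
    have : op_poly a P (Phi w) = 0 by rewrite -ew op_poly_op kerP ?op_r0.
    by rewrite ew12 linearD op_poly_rD (kerP _ _ w1P) add0r.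
  have [t et] : exists t, u1 *m kermxpoly A P = t *m row_base (kermxpoly A P).
    by apply/submxP; rewrite eq_row_base.
  by exists t; rewrite ew ew12 linearD w20 addr0 et.
have [//|c Ac] := @eigenvalue_closed _ _ A.
have p0 : char_poly A != 0 by rewrite monic_neq0 ?char_poly_monic.
have [m [q [qc ep]]] := multiplicity_XsubC (char_poly A) c.
rewrite p0 /= in qc.
have cop : coprimep (('X - c%:P) ^+ m) q.
  by apply/coprimep_expl; rewrite coprimep_sym coprimep_XsubC.
have full (w : 'rV_r.+1) : (w <= kermxpoly A (('X - c%:P) ^+ m) + kermxpoly A q)%MS.
  rewrite -kermxpolyM // mulrC -ep kermxpoly_min ?submx1 //.
  exact: mxminpoly_dvd_char.
have sz : (m <= r.+1)%N.
  have := size_char_poly A; rewrite ep size_Mmonic ?monic_exp ?monicXsubC //.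
    rewrite size_exp_XsubC; have : (0 < size q)%N.
      by rewrite lt0n size_poly_eq0; apply: contraNneq qc => ->; rewrite root0.
    lia.
  by apply: contraNneq qc => ->; rewrite root0.
have rk1 : (\rank (kermxpoly A (('X - c%:P) ^+ m)) < r.+1)%N.
  rewrite ltn_neqAle rank_leq_row andbT; apply/negP => /eqP rk.
  apply: (aN c) => v [x ->]; apply: (shift_leq sz); rewrite -op_poly_shift.
  by apply: kerP; rewrite submx_full // /row_full rk.
have rk2 : (\rank (kermxpoly A q) < r.+1)%N.
  rewrite ltn_neqAle rank_leq_row andbT; apply/negP => /eqP rk.
  have /rowV0Pn[v] := Ac; rewrite eigenspace_poly => vc.
  case/negP; rewrite -submx0 -(@mxdirect_kermxpoly _ _ A ('X - c%:P) q).
    by rewrite sub_capmx vc submx_full // /row_full rk.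
  by rewrite coprimep_sym coprimep_XsubC.
move=> x; have /sub_addsmxP[[u1 u2] /= ->] := full x.
rewrite linearD; apply: gen_eigen_sumD.
  exact: split_sum cop rk1 full _ (submxMl _ _).
apply: (split_sum q (('X - c%:P) ^+ m)) => //; last exact: submxMl.
  by rewrite coprimep_sym.
by move=> w; rewrite addsmxC.
Qed.

End CommutingOperators.

(** * A criterion for Gelfand-Tsetlin modules with finite multiplicities *)

(** Induction on the spanning family: a vector of S that involves the last b is
used to eliminate it from the others. *)
Lemma findim_sub (K : fieldType) (M : lmodType K) (S : M -> Prop) r (b : 'I_r -> M) :
  S 0 -> (forall c u v, S u -> S v -> S (c *: u + v)) ->
  (forall v, S v -> exists c : 'I_r -> K, v = \sum_i c i *: b i) ->
  exists r' (b' : 'I_r' -> M), (forall i, S (b' i)) /\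
    forall v, S v -> exists c : 'I_r' -> K, v = \sum_i c i *: b' i.
Proof.
elim: r b S => [|r IH] b S S0 SD Sb.
  exists 0%N, b; split=> [[]|v /Sb] //.
pose T v := S v /\ exists c : 'I_r -> K, v = \sum_i c i *: b (widen_ord (leqnSn r) i).
have [|||r' [b' [b'T b'P]]] := IH (b \o widen_ord (leqnSn r)) T.
- by split=> //; exists (fun=> 0); rewrite big1 // => i _; rewrite scale0r.
- move=> c u v [Su [cu eu]] [Sv [cv ev]]; split; first exact: SD.
  exists (fun i => c * cu i + cv i); rewrite eu ev scaler_sumr -big_split.
  by apply: eq_bigr => i _; rewrite scalerDl scalerA.
- by move=> v [].
case: (pselect (exists v0 (c0 : 'I_r.+1 -> K), [/\ S v0, v0 = \sum_i c0 i *: b i & c0 ord_max != 0])).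
  move=> [v0 [c0 [Sv0 ev0 c0N]]].
  exists r'.+1, (fun i => if unlift ord_max i is Some j then b' j else v0); split.
    by move=> i; case: unliftP => // j _; case: (b'T j).
  move=> v Sv; have [c ec] := Sb v Sv; set l := c ord_max / c0 ord_max.
  have [|d ed] := b'P (v - l *: v0).
    split; first by rewrite addrC -scaleNr; apply: SD.
    exists (fun i => c (widen_ord (leqnSn r) i) - l * c0 (widen_ord (leqnSn r) i)).
    rewrite ec ev0 scaler_sumr -sumrB big_ord_recr /=.
    rewrite scalerA -scalerBl /l divfK // subrr scale0r addr0.
    by apply: eq_bigr => i _; rewrite scalerA scalerBl.
  exists (fun i => if unlift ord_max i is Some j then d j else l).
  rewrite big_ord_recr /= unlift_none; apply: (canRL (subrK _)); rewrite ed.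
  apply: eq_bigr => i _.
  have -> : widen_ord (leqnSn r') i = lift ord_max i.
    by apply/val_inj; rewrite /= /bump leqNgt ltn_ord.
  by rewrite liftK.
move=> no; exists r', b'; split=> [i|v Sv]; first by case: (b'T i).
apply: b'P; split=> //; have [c ec] := Sb v Sv.
exists (c \o widen_ord (leqnSn r)); rewrite ec big_ord_recr /=.
have -> : c ord_max = 0 by apply/eqP/negPn/negP => cN; apply: no; exists v, c.
by rewrite scale0r addr0.
Qed.

Section GensubInd.
Variables (K : fieldType) (A : algType K) (S : A -> Prop).

Lemma gensub_ind (P : A -> Prop) :
  P 1 -> (forall c a b, P a -> P b -> P (c *: a + b)) ->
  (forall a b, P a -> P b -> P (a * b)) -> (forall a, S a -> P a) ->
  forall a, a \in gensub S -> P a.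
Proof.
move=> P1 PD PM PS a /asboolP/(_ [pred x | `[< P x >]]) aB.
apply/asboolP; apply: aB => [|s Ss]; last by apply/asboolP/PS.
split=> [|c x y /asboolP Px /asboolP Py|x y /asboolP Px /asboolP Py]; apply/asboolP => //.
- exact: PD.
- exact: PM.
Qed.

Lemma gensub_gen a : S a -> a \in gensub S.
Proof. by move=> Sa; apply/asboolP => B _; apply. Qed.

Lemma gensub_comm : (forall s t, S s -> S t -> s * t = t * s) ->
  {in gensub S &, forall a b, a * b = b * a}.
Proof.
move=> SC.
have comm1 s a : S s -> a \in gensub S -> s * a = a * s.
  move=> Ss; move: a; apply: gensub_ind => [|c a b ea eb|a b ea eb|t St].
  - by rewrite mulr1 mul1r.
  - by rewrite mulrDr mulrDl -scalerAr -scalerAl ea eb.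
  - by rewrite mulrA ea -mulrA eb mulrA.
  - exact: SC.
move=> a b aS bS; move: a aS; apply: gensub_ind => [|c x y ex ey|x y ex ey|s Ss].
- by rewrite mulr1 mul1r.
- by rewrite mulrDr mulrDl -scalerAr -scalerAl ex ey.
- by rewrite mulrA -ex -!mulrA ey.
- exact: comm1.
Qed.
End GensubInd.

Section EnvInj.
Variables (K : fieldType) (g : lieAlgType K).

Lemma env_inj_linear : linear (@env_inj K g).
Proof.
move=> a x y.
rewrite /env_inj /pgenerator.
rewrite [LHS](@pclass_eq K (env_presentation g) _ _ (pc_rel (er_linear a x y))).
by rewrite -[RHS]/(padd (pscale a (pclass _)) (pclass _)) pscaleE paddE.
Qed.
HB.instance Definition _ :=
  GRing.isLinear.Build K g (env g) *:%R (@env_inj K g) env_inj_linear.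

Lemma env_inj_lie x y :
  env_inj (lie x y) = env_inj x * env_inj y - env_inj y * env_inj x :> env g.
Proof.
rewrite [LHS](@pclass_eq K (env_presentation g) _ _ (pc_rel (er_lie x y))).
by rewrite -[RHS]/(padd (pmul (pclass _) (pclass _)) (popp (pmul (pclass _) (pclass _))))
   !pmulE poppE paddE.
Qed.

Lemma env_inj_comm x y : lie x y = 0 -> env_inj x * env_inj y = env_inj y * env_inj x :> env g.
Proof. by move=> e; apply/eqP; rewrite -subr_eq0 -env_inj_lie e linear0. Qed.
End EnvInj.

Section GelfandTsetlinCriterion.
Variables (K : numClosedFieldType) (g : lieAlgType K) (h : {vspace g}).
Variables (e hh f : g) (t : g -> K).
Hypothesis h_ab : abelian_subspace h.
Hypothesis hh_in : hh \in h.
Hypothesis he : lie hh e = 2 *: e.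
Hypothesis hf : lie hh f = (- 2) *: f.
Hypothesis ef : lie e f = hh.
Hypothesis te : {in h, forall x, lie x e = t x *: e}.
Hypothesis tf : {in h, forall x, lie x f = - t x *: f}.

Local Notation s := <<[:: e; hh; f]>>%VS.
Local Notation U := (env g).
Local Notation inj := (@env_inj K g).

Lemma s_mem : [/\ e \in s, hh \in s & f \in s].
Proof. by split; apply: memv_span; rewrite !inE eqxx ?orbT. Qed.

Lemma env_sub_inj x : x \in s -> inj x \in env_sub s.
Proof. by move=> xs; apply: gensub_gen; exists x. Qed.

Lemma s_span x : x \in s -> exists a b c, x = a *: e + b *: hh + c *: f.
Proof.
move=> /coord_span ->; rewrite !big_ord_recl big_ord0 /= addr0.
by rewrite addrA; do 3 eexists.
Qed.

(** An element of the Cartan subalgebra is the sum of a multiple of the coroot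
and of an element centralizing the triple. *)
Lemma center_comm_h x z : x \in h -> center_of (env_sub s) z ->
  z * inj x = inj x * z.
Proof.
move=> xh [zs zC]; pose x' := x - (t x / 2) *: hh.
have x'h : x' \in h by rewrite memvB ?memvZ.
have ex : x = x' + (t x / 2) *: hh by rewrite subrK.
have [es hs fs] := s_mem.
have comm' y : y \in s -> lie x' y = 0.
  move=> /s_span[a [b [c ->]]]; rewrite !linearD !linearZ /=.
  rewrite /x' !lieDl -!scaleNr !lieZl he hf te // tf // !(h_ab _ hh_in) // ?liexx.
  rewrite !scaler0 addr0 !scaler0 addr0 !scalerA -!scalerDl.
  have -> : t x + - (t x / 2) * 2 = 0 by field.
  have -> : - t x + - (t x / 2) * -2 = 0 by field.
  by rewrite !scale0r !scaler0 addr0.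
have cx' : z * inj x' = inj x' * z.
  move: z zs {zC}; apply: gensub_ind => [|c a b ea eb|a b ea eb|_ [y ys ->]].
  - by rewrite mulr1 mul1r.
  - by rewrite mulrDr mulrDl -scalerAr -scalerAl ea eb.
  - by rewrite mulrA -ea -!mulrA eb.
  - by apply/esym/env_inj_comm/comm'.
rewrite ex linearD linearZ /= mulrDr mulrDl cx' -scalerAr -scalerAl zC //.
exact: env_sub_inj.
Qed.

(** Normalized so that it acts by w^2 - 2 w on a vector of weight w killed by
f. *)
Definition casimir : U :=
  inj hh * inj hh + 2 *: (inj e * inj f + inj f * inj e).

Lemma casimir_center : center_of (env_sub s) casimir.
Proof.
have [es hs fs] := s_mem.
have injZ c x : inj (c *: x) = c *: inj x by exact: linearZ.
have D1 : inj hh * inj e - inj e * inj hh = 2 *: inj e.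
  by rewrite -injZ -he env_inj_lie.
have D2 : inj hh * inj f - inj f * inj hh = (-2) *: inj f.
  by rewrite -injZ -hf env_inj_lie.
have D3 : inj e * inj f - inj f * inj e = inj hh by rewrite -ef env_inj_lie.
have DM (x y z : U) : x * y * z - z * (x * y) = x * (y * z - z * y) + (x * z - z * x) * y.
  by rewrite mulrBr mulrBl !mulrA addrA subrK.
have DC (z : U) : casimir * z - z * casimir =
    (inj hh * inj hh * z - z * (inj hh * inj hh)) +
    2 *: ((inj e * inj f * z - z * (inj e * inj f)) + (inj f * inj e * z - z * (inj f * inj e))).
  rewrite /casimir mulrDl mulrDr -scalerAl -scalerAr [(_ + inj f * _) * z]mulrDl.
  by rewrite [z * (_ + inj f * _)]mulrDr opprD addrACA -scalerBr opprD [X in _ *: X]addrACA.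
split.
  have [c1 cD cM] := gensub_closed (fun u : U => exists2 x, x \in s & u = inj x).
  rewrite /casimir addrC; apply: (cD 2); last by apply: cM; apply: env_sub_inj.
  by rewrite -[X in X + _]scale1r; apply: (cD 1); apply: cM; apply: env_sub_inj.
have D3' : inj f * inj e - inj e * inj f = - inj hh by rewrite -D3 opprB.
have D1' : inj e * inj hh - inj hh * inj e = (- 2) *: inj e.
  by rewrite scaleNr -D1 opprB.
have D2' : inj f * inj hh - inj hh * inj f = 2 *: inj f.
  by rewrite -[2]opprK scaleNr -D2 opprB.
have CE : casimir * inj e = inj e * casimir.
  apply/eqP; rewrite -subr_eq0 DC !DM D1 D3' subrr mulr0 mul0r addr0 add0r.
  rewrite mulrN mulNr -opprD -scalerAr -scalerAl -scalerDr scalerN.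
  by rewrite [inj e * _ + _]addrC subrr.
have CF : casimir * inj f = inj f * casimir.
  apply/eqP; rewrite -subr_eq0 DC !DM D2 D3 subrr mulr0 mul0r addr0 add0r.
  rewrite -scalerAr -scalerAl -scalerDr.
  by rewrite -scalerDl addNr scale0r.
have CH : casimir * inj hh = inj hh * casimir.
  apply/eqP; rewrite -subr_eq0 DC !DM subrr mulr0 mul0r addr0 add0r.
  rewrite D1' D2' -!scalerAr -!scalerAl -!scalerDl !addNr subrr !scale0r.
  by rewrite addr0 scaler0.
move: casimir {DC} CE CF CH => C CE CF CH.
move=> b; move: b; apply: gensub_ind => [|c a b ea eb|a b ea eb|_ [y ys ->]].
- by rewrite mulr1 mul1r.
- by rewrite mulrDr mulrDl -scalerAr -scalerAl ea eb.
- by rewrite mulrA ea -mulrA eb mulrA.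
- have [a [b [c ->]]] := s_span ys; rewrite !linearD !linearZ /= !mulrDr !mulrDl.
  by rewrite -!scalerAr -!scalerAl CE CF CH.
Qed.

Variables (M : lmodType K) (act : g -> M -> M).
Hypothesis actP : lie_module act.

Let act_lin x : linear (act x). Proof. by case: actP. Qed.

Definition weight_vector (mu : g -> K) (v : M) := {in h, forall x, act x v = mu x *: v}.

Hypothesis weight_span : forall v, exists m (mu : 'I_m -> g -> K) (w : 'I_m -> M),
  (forall i, weight_vector (mu i) (w i)) /\ v = \sum_i w i.
Hypothesis h_semisimple : forall x c k v, x \in h ->
  iter k (fun u => act x u - c *: u) v = 0 -> act x v = c *: v.
Hypothesis f_nilpotent : forall v, exists m, iter m (act f) v = 0.
Hypothesis weight_findim : forall mu m, exists r (b : 'I_r -> M), forall v,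
  weight_vector mu v -> iter m (act f) v = 0 ->
  exists c : 'I_r -> K, v = \sum_i c i *: b i.

Let env_lin u : linear (env_act act u : M -> M).
Proof. exact: (teval_linear act_lin). Qed.

Let env_act0 u : env_act act u 0 = 0 :> M.
Proof. exact: linear_map0 (env_lin u). Qed.

Let env_actZr u c v : env_act act u (c *: v) = c *: env_act act u v.
Proof. by have := env_lin u c v 0; rewrite !addr0 env_act0 addr0. Qed.

Let env_actB u u' v : env_act act (u - u') v = env_act act u v - env_act act u' v.
Proof. by rewrite -!scaleN1r env_actD // env_actZ. Qed.

Let env_act_alg c v : env_act act (c%:A) v = c *: v.
Proof. by rewrite env_actZ // env_act1. Qed.

Local Notation Gamma := (gamma h s).
Let op (a : Gamma) (v : M) : M := env_act act (gensub_val a) v.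

Lemma gamma_comm (a b : Gamma) : gensub_val a * gensub_val b = gensub_val b * gensub_val a.
Proof.
apply: (gensub_comm _ (valP a) (valP b)) => z z' [[x xh ->]|zC] [[y yh ->]|zC'].
- exact/env_inj_comm/h_ab.
- by rewrite center_comm_h.
- by rewrite center_comm_h.
- by case: zC => _ -> //; case: zC'.
Qed.

Let op_lin a : linear (op a). Proof. exact: env_lin. Qed.
Let gval1 : gensub_val (1 : Gamma) = 1.
Proof. exact: (rmorph1 (\val : Gamma -> U)). Qed.
Let gvalD (a b : Gamma) : gensub_val (a + b) = gensub_val a + gensub_val b.
Proof. exact: (rmorphD (\val : Gamma -> U)). Qed.
Let gvalM (a b : Gamma) : gensub_val (a * b) = gensub_val a * gensub_val b.
Proof. exact: (rmorphM (\val : Gamma -> U)). Qed.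
Let gvalZ c (a : Gamma) : gensub_val (c *: a) = c *: gensub_val a.
Proof. exact: (GRing.valZ c a). Qed.
Let gvalS (a : Gamma) c k :
  gensub_val ((a - c%:A) ^+ k) = (gensub_val a - c%:A) ^+ k.
Proof.
elim: k => [|k IH]; first by rewrite !expr0 gval1.
by rewrite !exprS gvalM IH gvalD -scaleNr gvalZ gval1 scaleNr.
Qed.

Let op1 v : op 1 v = v.
Proof. by rewrite /op gval1 env_act1. Qed.
Let opD a b v : op (a + b) v = op a v + op b v.
Proof. by rewrite /op gvalD env_actD. Qed.
Let opM a b v : op (a * b) v = op a (op b v).
Proof. by rewrite /op gvalM env_actM. Qed.
Let opZ c a v : op (c *: a) v = c *: op a v.
Proof. by rewrite /op gvalZ env_actZ. Qed.
Let opC a b v : op a (op b v) = op b (op a v).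
Proof. by rewrite /op -!env_actM // gamma_comm. Qed.

Let op_comp (chi : Gamma -> K) v : gen_eigen op chi v <->
  exists k, forall a, env_act act ((gensub_val a - (chi a)%:A) ^+ k) v = 0.
Proof.
by split=> -[k kP]; exists k => a; have := kP a; rewrite /op gvalS.
Qed.

Let iter_f m v : env_act act (inj f ^+ m) v = iter m (act f) v.
Proof.
elim: m => [|m IH]; first by rewrite expr0 env_act1.
by rewrite exprS env_actM // IH env_act_inj.
Qed.

(** An element of h acts on a weight vector by a scalar, and the centre of U(s)
commutes with f and, by [center_comm_h], with h. *)
Lemma gamma_stable mu m a v : weight_vector mu v -> iter m (act f) v = 0 ->
  weight_vector mu (op a v) /\ iter m (act f) (op a v) = 0.
Proof.
pose N w := weight_vector mu w /\ iter m (act f) w = 0.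
move=> wv fv; have ga : gensub_val a \in gensub (gamma_gens h s) by exact: (valP a).
suff gN : forall u, u \in gensub (gamma_gens h s) -> forall w, N w -> N (env_act act u w).
  exact: gN ga v (conj wv fv).
have ND c u w : N u -> N w -> N (c *: u + w).
  move=> [w1 f1] [w2 f2]; split.
    by move=> x xh; rewrite act_lin w1 // w2 // scalerDr !scalerA mulrC.
  by rewrite -iter_f env_lin !iter_f f1 f2 scaler0 addr0.
apply: gensub_ind => {v wv fv} [v|c u u' Nu Nu' v Nv|u u' Nu Nu' v Nv|u].
- by rewrite env_act1.
- by rewrite env_actD // env_actZ //; apply: ND; [apply: Nu|apply: Nu'].
- by rewrite env_actM //; apply/Nu/Nu'.
- have [es hs fs] := s_mem.
  case=> [[x xh ->]|zC] v [wv fv].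
    rewrite env_act_inj // wv //; split.
      by move=> y yh; rewrite -env_act_inj // env_actZr env_act_inj // wv // !scalerA mulrC.
    by rewrite -iter_f env_actZr iter_f fv scaler0.
  split.
    move=> x xh; rewrite -env_act_inj // -env_actM // -center_comm_h //.
    by rewrite env_actM // env_act_inj // wv // env_actZr.
  have zf : u * inj f ^+ m = inj f ^+ m * u.
    by apply: commrX; have [_ uC] := zC; apply/uC/env_sub_inj.
  by rewrite -iter_f -env_actM // -zf env_actM // iter_f fv env_act0.
Qed.

Let cut mu m v := weight_vector mu v /\ iter m (act f) v = 0.

Lemma cut0 mu m : cut mu m 0.
Proof.
split; last by rewrite -iter_f env_act0.
by move=> x xh; rewrite -env_act_inj // env_act0 scaler0.
Qed.

Lemma cutD mu m c u v : cut mu m u -> cut mu m v -> cut mu m (c *: u + v).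
Proof.
move=> [w1 f1] [w2 f2]; split.
  by move=> x xh; rewrite act_lin w1 // w2 // scalerDr !scalerA mulrC.
by rewrite -iter_f env_lin !iter_f f1 f2 scaler0 addr0.
Qed.

Lemma weight_cut_sub mu m :
  exists r (b : 'I_r -> M),
  (forall i, weight_vector mu (b i) /\ iter m (act f) (b i) = 0) /\
  forall v, weight_vector mu v /\ iter m (act f) v = 0 ->
    exists c : 'I_r -> K, v = \sum_i c i *: b i.
Proof.
have [r [b bP]] := weight_findim mu m.
apply: (@findim_sub _ _ (cut mu m) r b) => [|c u v|v [wv fv]].
- exact: cut0.
- exact: cutD.
- exact: bP.
Qed.

Lemma criterion_spanned (v : M) : gen_eigen_sum op v.
Proof.
have [m [mu [w [wP ->]]]] := weight_span v.
have sum_ind : forall k (F : 'I_k -> M), (forall i, gen_eigen_sum op (F i)) -> gen_eigen_sum op (\sum_i F i).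
  move=> k F FP; elim/big_ind: _ => //; last by move=> x y; apply: gen_eigen_sumD.
  exact: gen_eigen_sum0.
apply: sum_ind => i.
have [l lP] := f_nilpotent (w i).
have [r [b [bN bP]]] := weight_cut_sub (mu i) l.
pose phi (x : 'rV[K]_r) := \sum_j x 0 j *: b j.
have phi_lin : linear phi.
  move=> c x y; rewrite /phi scaler_sumr -big_split; apply: eq_bigr => j _.
  by rewrite !mxE scalerDl scalerA.
pose Phi : {linear 'rV[K]_r -> M} := HB.pack phi (GRing.isLinear.Build K _ _ _ phi phi_lin).
have PhiP u : weight_vector (mu i) u /\ iter l (act f) u = 0 -> exists x, u = Phi x.
  move=> /bP[c ->]; exists (\row_j c j).
  by apply: eq_bigr => j _; rewrite mxE.
have [x ->] := PhiP (w i) (conj (wP i) lP).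
have cy y : cut (mu i) l (Phi y).
  rewrite /Phi /= /phi; elim/big_ind: _ => [|u u' cu cu'|j _].
  - exact: cut0.
  - by rewrite -[u]scale1r; apply: cutD.
  - by rewrite -[_ *: _]addr0; apply: cutD => //; apply: cut0.
apply: (gen_eigen_sum_findim op_lin op1 opD opM opZ opC) => a y.
by apply: (PhiP (op a (Phi y))); case: (cy y) => c1 c2; apply: gamma_stable.
Qed.

(** If f^j v is the last nonzero one, the Casimir element acts on it by
w^2 - 2 w with w = mu(h) - 2 j.  It commutes with f, so this number is c, and a
quadratic equation leaves at most two values of j. *)
Lemma casimir_bound mu (c : K) : exists m, forall v k,
  weight_vector mu v -> env_act act ((casimir - c%:A) ^+ k) v = 0 ->
  iter m (act f) v = 0.
Proof.
pose w j : K := mu hh - j%:R * 2; pose q j := w j * w j - 2 * w j.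
have w_inj j j' : w j = w j' -> j = j'.
  move/addrI/oppr_inj/(mulIf _) => jj; apply/eqP; rewrite -(eqr_nat K); apply/eqP/jj.
  by rewrite pnatr_eq0.
have q_eq j j' : q j = q j' -> j = j' \/ w j + w j' = 2.
  move=> qq; have : (w j - w j') * (w j + w j' - 2) = 0.
    have -> : (w j - w j') * (w j + w j' - 2) = q j - q j' by rewrite /q; ring.
    by rewrite qq subrr.
  by move=> /eqP; rewrite mulf_eq0 !subr_eq0 => /orP[/eqP/w_inj|/eqP]; [left|right].
have [m mP] : exists m, forall j, q j = c -> (j < m)%N.
  case: (pselect (exists j0, q j0 = c)) => [[j0 q0]|no]; last first.
    by exists 0%N => j qj; case: no; exists j.
  case: (pselect (exists j1, q j1 = c /\ j1 <> j0)) => [[j1 [q1 j10]]|no]; last first.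
    exists j0.+1 => j qj; rewrite ltnS leq_eqVlt; case: eqP => //= jj0.
    by case: no; exists j.
  exists (maxn j0 j1).+1 => j qj; rewrite ltnS leq_max.
  have [->|e1] := q_eq j j0 (etrans qj (esym q0)); first by rewrite leqnn.
  have [//|e2] := q_eq j1 j0 (etrans q1 (esym q0)).
  by rewrite (w_inj j j1) ?leqnn ?orbT //; apply: (addIr (w j0)); rewrite e1 e2.
exists m => v k wv Cv.
have fw j : act hh (iter j (act f) v) = w j *: iter j (act f) v.
  elim: j => [|j IH]; first by rewrite /w mul0r subr0 wv.
  have [_ actl actb] := actP; rewrite iterS.
  have -> : act hh (act f (iter j (act f) v)) = act (lie hh f) (iter j (act f) v) + act f (act hh (iter j (act f) v)).
    by rewrite actb subrK.
  rewrite hf IH -!env_act_inj // !linearZ /= env_actZ // env_actZr -scalerDl.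
  by congr (_ *: _); rewrite /w -natr1; ring.
have nz : exists l, `[< iter l (act f) v = 0 >].
  by have [l lP] := f_nilpotent v; exists l; apply/asboolP.
case: (ex_minnP nz) => l /asboolP fl lmin.
have fle i j : (i <= j)%N -> iter i (act f) v = 0 -> iter j (act f) v = 0.
  by move=> ij fi; rewrite -(subnK ij) iterD fi -iter_f env_act0.
have [lm|] := leqP l m; first exact: fle fl.
case: l => // j in fl lmin *; rewrite ltnS => mj.
set v' := iter j (act f) v; have v'N : v' != 0.
  by apply/negP => /eqP v'0; have := lmin j (asboolT v'0); rewrite ltnn.
have fv' : act f v' = 0 by rewrite -[LHS]/(iter j.+1 (act f) v).
have Cv' : env_act act casimir v' = q j *: v'.
  rewrite /casimir env_actD // env_actZ // env_actD // !env_actM // !env_act_inj //.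
  have [_ _ actb] := actP.
  have -> : act f (act e v') = - act hh v'.
    by rewrite -ef actb fv' -[act e 0]env_act_inj // env_act0 sub0r opprK.
  rewrite fv' fw -!env_act_inj // env_act0 add0r env_actZr env_act_inj // fw.
  by rewrite scalerN scalerA scalerA -scalerBl.
have Cf : casimir * inj f ^+ j = inj f ^+ j * casimir.
  have [es hs fs] := s_mem; have [_ Cc] := casimir_center.
  by apply: commrX; apply/Cc/env_sub_inj.
have Cck : env_act act ((casimir - c%:A) ^+ k) v' = 0.
  have : env_act act (inj f ^+ j) (env_act act ((casimir - c%:A) ^+ k) v) = 0 by rewrite Cv env_act0.
  rewrite -env_actM //.
  have -> : inj f ^+ j * (casimir - c%:A) ^+ k = (casimir - c%:A) ^+ k * inj f ^+ j.
    apply: commrX; rewrite /GRing.comm mulrBr mulrBl Cf.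
    by rewrite mulr_algl mulr_algr.
  by rewrite env_actM // iter_f.
have Cqk i : env_act act ((casimir - c%:A) ^+ i) v' = (q j - c) ^+ i *: v'.
  elim: i => [|i IH]; first by rewrite !expr0 env_act1 // scale1r.
  rewrite exprS env_actM // IH env_actZr env_actB env_act_alg Cv' -scalerBl.
  by rewrite scalerA exprSr.
move: Cck; rewrite Cqk => /eqP; rewrite scaler_eq0 (negbTE v'N) orbF expf_eq0.
by move=> /andP[_]; rewrite subr_eq0 => /eqP/mP; rewrite ltnNge mj.
Qed.

(** The weight spaces cut by the kernel of a power of f are finite-dimensional
and stable, so they split into components; conversely each component lies in
one of them by [casimir_bound]. *)
Theorem gelfand_tsetlin_criterion : H_fin h s act.
Proof.
split; first split.
- exact: actP.
- move=> v; have [m [chi [w [wP ->]]]] := criterion_spanned v.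
  by exists m, chi, w; split=> // i; apply: (op_comp (chi i) (w i)).1; exact: wP.
- move=> m chi w inj wP; apply: (gen_eigen_independent op_lin op1 opD opM opC (chi := fun i => chi i)) => //.
  by move=> i; apply: (op_comp (chi i) (w i)).2; exact: wP.
move=> chi.
have zC : casimir \in gensub (gamma_gens h s).
  by apply: gensub_gen; right; apply: casimir_center.
have gx x : x \in h -> inj x \in gensub (gamma_gens h s).
  by move=> xh; apply: gensub_gen; left; exists x.
pose mu x := match pselect (x \in h) with
  | left xh => chi (GenSubAlg (gx x xh)) : K | right _ => 0 end.
have comp_wv v : gt_component act chi v -> weight_vector mu v.
  case=> k kP x xh; apply: (h_semisimple (k := k)) => //.
  rewrite /mu; case: pselect => // xh'; rewrite -[RHS](kP (GenSubAlg (gx x xh'))) /=.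
  elim: k {kP} => [|k IH]; first by rewrite expr0 env_act1.
  by rewrite exprS env_actM // iterS IH env_actB env_act_inj // env_act_alg.
have [m mP] := casimir_bound mu (chi (GenSubAlg zC) : K).
have [r [b bP]] := weight_findim mu m.
apply: (@findim_sub _ _ (gt_component act chi) r b).
- by exists 0%N => a; rewrite env_act0.
- move=> c u v [k kP] [k' k'P]; apply: (op_comp chi _).1; exists (k + k')%N => a.
  rewrite /op gvalS env_lin {1}addnC !exprD !env_actM // kP k'P !env_act0.
  by rewrite scaler0 addr0.
- move=> v cv; apply: bP; first exact: comp_wv.
  by have [k kP] := cv; apply: (mP v k) (comp_wv _ cv) (kP (GenSubAlg zC)).
Qed.
End GelfandTsetlinCriterion.

(** * The polynomial model of W *)

Section LeftQuotientAction.
Variables (K : fieldType) (A : algType K) (m : nat) (G : 'I_m -> A).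
Local Notation Q := (lquot G).

Lemma lclass_surj (w : Q) : exists a, w = lclass G a.
Proof. by exists (repr w); rewrite lclass_repr. Qed.

Lemma lactD a b (w : Q) : lact (a + b) w = lact a w + lact b w.
Proof. by have [c ->] := lclass_surj w; rewrite !lactE mulrDl lclassD. Qed.
Lemma lactM a b (w : Q) : lact (a * b) w = lact a (lact b w).
Proof. by have [c ->] := lclass_surj w; rewrite !lactE mulrA. Qed.
Lemma lclassZ c a : lclass G (c *: a) = c *: lclass G a.
Proof. exact: (esym (lscaleE _ _ _)). Qed.
Lemma lactZ c a (w : Q) : lact (c *: a) w = c *: lact a w.
Proof. by have [b ->] := lclass_surj w; rewrite !lactE -scalerAl lclassZ. Qed.
Lemma lact_linear a : linear (lact a : Q -> Q).
Proof.
move=> c u v; have [x ->] := lclass_surj u; have [y ->] := lclass_surj v.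
by rewrite -lclassZ -lclassD !lactE mulrDr -scalerAr lclassD lclassZ.
Qed.
Lemma lact0 (w : Q) : lact 0 w = 0.
Proof. by rewrite -[0 in LHS](scale0r (1 : A)) lactZ scale0r. Qed.
Lemma lactN a (w : Q) : lact (- a) w = - lact a w.
Proof. by rewrite -scaleN1r lactZ scaleN1r. Qed.
Lemma lact1 (w : Q) : lact 1 w = w.
Proof. by have [c ->] := lclass_surj w; rewrite lactE mul1r. Qed.
Lemma lact_comm a b (w : Q) :
  lact (a * b - b * a) w = lact a (lact b w) - lact b (lact a w).
Proof. by rewrite lactD lactN !lactM. Qed.
Lemma lact_comb c a b (w : Q) : lact (c *: a + b) w = c *: lact a w + lact b w.
Proof. by rewrite lactD lactZ. Qed.
Lemma lact_sum (I : finType) (F : I -> A) (w : Q) :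
  lact (\sum_i F i) w = \sum_i lact (F i) w.
Proof. exact: (big_morph (fun a => lact a w) (fun a b => lactD a b w) (lact0 w)). Qed.
Lemma ideal_gen i : G i \in left_ideal G.
Proof.
apply/asboolP; exists (fun j => (j == i)%:R); rewrite (bigD1 i) //= eqxx mul1r.
by rewrite big1 ?addr0 // => j /negbTE ->; rewrite mul0r.
Qed.
End LeftQuotientAction.

Section Model.
Variables (K : fieldType) (n : nat) (th : 'I_n).
Local Notation A := (weyl K n).
Local Notation wx := (@wx K n).
Local Notation wd := (@wd K n).
Local Notation G := (@gt_ideal_gens K n th).
Local Notation W := (W_gt K th).
Local Notation Q := {mpoly K[n]}.

(** After a Fourier transform in every variable but the distinguished one, the
generators of the left ideal become the partial derivatives, up to sign. *)
Definition mulop (i : 'I_n) : A := if i == th then wx i else wd i.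
Definition derop (i : 'I_n) : A := if i == th then wd i else - wx i.

Lemma mulopC i j : mulop i * mulop j = mulop j * mulop i.
Proof.
rewrite /mulop; case: (eqVneq i th) => [->|ne]; case: (eqVneq j th) => [->|ne'] //.
- by apply/esym/eqP; rewrite -subr_eq0 wdx (negbTE ne') eqxx.
- by apply/eqP; rewrite -subr_eq0 wdx (negbTE ne) eqxx.
- exact: wdC.
Qed.

Lemma derop_mulop i j : derop i * mulop j - mulop j * derop i = (i == j)%:R.
Proof.
rewrite /mulop /derop; case: (eqVneq i th) => [->|ne]; case: (eqVneq j th) => [->|ne'] //.
- by rewrite wdx eqxx.
- by rewrite wdC subrr.
- by rewrite mulNr mulrN wxC subrr (negbTE ne).
- by rewrite mulNr mulrN opprK addrC wdx eq_sym.
Qed.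

Definition model (p : Q) : W := lclass G (peval mulop p).

Lemma model_linear : linear model.
Proof. by move=> c p q; rewrite /model pevalD pevalZ lclassD lclassZ. Qed.
Lemma modelZ c p : model (c *: p) = c *: model p.
Proof. by rewrite /model pevalZ lclassZ. Qed.
Lemma modelD p q : model (p + q) = model p + model q.
Proof. by rewrite /model pevalD lclassD. Qed.
Lemma model0 : model 0 = 0.
Proof. by apply: (addIr (model 0)); rewrite -modelD !add0r. Qed.
Lemma modelN p : model (- p) = - model p.
Proof. by apply: (addIr (model p)); rewrite -modelD !addNr model0. Qed.

Lemma model_mul i p : lact (mulop i) (model p) = model ('X_i * p).
Proof. by rewrite /model lactE pevalM ?pevalX //; apply: mulopC. Qed.

Lemma derop_ideal a i : a * derop i \in left_ideal G.
Proof.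
apply: left_idealM; have := ideal_gen G i; rewrite /derop /gt_ideal_gens.
by case: (i == th) => //; rewrite rpredN.
Qed.

Lemma model_deriv i p : lact (derop i) (model p) = model p^`M(i).
Proof.
rewrite /model lactE; apply/lclassP.
by rewrite -(peval_deriv mulopC derop_mulop) opprB addrCA subrr addr0 derop_ideal.
Qed.

Lemma model_surj w : exists p, w = model p.
Proof.
have [a ->] := lclass_surj w.
suff st : forall a p, exists q, lact a (model p) = model q.
  have [q e] := st a 1; exists q; rewrite -e /model lactE peval1 mulr1 //.
move=> {w}; elim/weyl_ind => [c|i|i|b b' IH IH'|b b' IH IH'] p.
- by exists (c *: p); rewrite lactZ lact1 modelZ.
- case: (eqVneq i th) => [e|ne]; [exists ('X_i * p)|exists (- p^`M(i))].
    by rewrite -model_mul /mulop e eqxx.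
  by rewrite modelN -model_deriv /derop (negbTE ne) lactN opprK.
- case: (eqVneq i th) => [e|ne]; [exists (p^`M(i))|exists ('X_i * p)].
    by rewrite -model_deriv /derop e eqxx.
  by rewrite -model_mul /mulop (negbTE ne).
- have [q e] := IH p; have [q' e'] := IH' p; exists (q + q').
  by rewrite lactD e e' modelD.
- have [q e] := IH' p; have [q' e'] := IH q; exists q'.
  by rewrite lactM e e'.
Qed.

Let act (x : 'I_n + 'I_n) (p : Q) : Q :=
  match x with
  | inl i => if i == th then 'X_i * p else - p^`M(i)
  | inr i => if i == th then p^`M(i) else 'X_i * p
  end.

Let act_lin x : linear (act x).
Proof.
by case: x => i c u v /=; case: ifP => _; rewrite ?mulrDr ?scalerAr // !linearP ?opprD ?scalerN.
Qed.

Let mBm (i : 'I_n) : (U_(i) - U_(i))%MM = 0%MM :> 'X_{1..n}.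
Proof. by apply/mnmP => k; rewrite mnmBE subnn mnm0E. Qed.

Let derX i j (p : Q) : ('X_j * p)^`M(i) = (i == j)%:R *: p + 'X_j * p^`M(i).
Proof.
rewrite mderivM mderivX mnm1E eq_sym; case: eqP => [->|_]; last by rewrite !scale0r mul0r.
by rewrite !scale1r mBm mpolyX0 mul1r.
Qed.

Let act_rel s t : weyl_rel s t -> teval act s =1 teval act t.
Proof.
case=> i j v /=; rewrite scaleN1r ?scale0r.
- case: (eqVneq i th) => [->|ne]; case: (eqVneq j th) => [->|ne'].
  + by rewrite subrr.
  + by rewrite derX (negbTE ne') scale0r add0r mulrN opprK addNr.
  + by rewrite derX (negbTE ne) scale0r add0r mulrN opprK addNr.
  + by rewrite !mderivN !opprK mderiv_comm subrr.
- case: (eqVneq i th) => [->|ne]; case: (eqVneq j th) => [->|ne'].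
  + by rewrite subrr.
  + by rewrite derX eq_sym (negbTE ne') scale0r add0r subrr.
  + by rewrite derX eq_sym (negbTE ne) scale0r add0r subrr.
  + by rewrite mulrCA subrr.
- case: (eqVneq i th) => [->|ne]; case: (eqVneq j th) => [->|ne'].
  + by rewrite derX addrK eqxx.
  + by rewrite mderivN mderiv_comm opprK addNr ?[th == j]eq_sym ?(negbTE ne') scale0r.
  + by rewrite mulrCA subrr ?(negbTE ne) scale0r.
  + by rewrite derX mulrN opprK addrC addrK eq_sym.
Qed.

Local Notation pact := (@paction K (weyl_presentation K n) Q act).

(** The Weyl algebra acts on polynomials, with [mulop] acting by multiplication
by the variables, and the left ideal kills 1; so acting on 1 recovers p from
its class. *)
Lemma model_inj p : model p = 0 -> p = 0.
Proof.
have p1 := @paction1 K (weyl_presentation K n) Q act act_lin act_rel.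
have pD := @pactionD K (weyl_presentation K n) Q act act_lin act_rel.
have pM := @pactionM K (weyl_presentation K n) Q act act_lin act_rel.
have pZ := @pactionZ K (weyl_presentation K n) Q act act_lin act_rel.
have pg := @paction_gen K (weyl_presentation K n) Q act act_lin act_rel.
have pe q : pact (peval mulop p) q = p * q.
  elim/mpoly_alg_ind: p q => [|i|p p' IH IH'|c p p' IH IH'] q.
  - by rewrite peval1 p1 mul1r.
  - rewrite pevalX /mulop; case: (eqVneq i th) => [e|ne].
      by rewrite [LHS]pg /= e eqxx.
    by rewrite [LHS]pg /= (negbTE ne).
  - by rewrite pevalM; [rewrite [LHS]pM IH' IH mulrA|exact: mulopC].
  - by rewrite pevalD pevalZ [LHS]pD [X in X + _]pZ IH IH' mulrDl scalerAl.
move=> mp; have : peval mulop p - 0 \in left_ideal G.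
  by apply/lclassP; rewrite -/(model p) mp -[RHS]/(lclass G 0) -(scale0r (0 : A)) lclassZ scale0r.
rewrite subr0 => /asboolP[c ec].
rewrite -[p]mulr1 -pe ec.
have p0 q : pact 0 q = 0 by rewrite -(scale0r (0 : A)) [LHS]pZ scale0r.
rewrite (big_morph (fun a => pact a 1) (fun a b => pD a b 1) (p0 1)) big1 // => i _.
rewrite [LHS]pM; have -> : pact (G i) 1 = 0.
  rewrite /gt_ideal_gens; case: (eqVneq i th) => [e|ne]; rewrite [LHS]pg /=.
    by rewrite e eqxx -mpolyC1 mderivC.
  by rewrite (negbTE ne) -mpolyC1 mderivC oppr0.
exact: (linear_map0 (teval_linear act_lin (repr (c i)))).
Qed.
End Model.

Section MonomialModule.
Variables (K : numClosedFieldType) (g : lieAlgType K) (h : {vspace g}).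
Variables (n : nat) (th : 'I_n) (M : lmodType K) (act : g -> M -> M) (f : g).
Local Notation Q := {mpoly K[n]}.
Hypothesis act_lin : forall x, linear (act x).
Variable Phi : Q -> M.
Hypothesis Phi_lin : linear Phi.
Hypothesis Phi_surj : forall w, exists p, w = Phi p.
Hypothesis Phi_inj : forall p, Phi p = 0 -> p = 0.
Hypothesis act_f : forall p, act f (Phi p) = Phi (- p^`M(th)).
Variable c : 'I_n -> g -> K.
Variable c0 : g -> K.
(** The product x_i d/dx_i has eigenvalue m_i for the distinguished variable and,
after the Fourier transform, - (m_i + 1) for the others. *)
Definition mono_weight (m : 'X_{1..n}) (x : g) : K :=
  \sum_i c i x * (if i == th then (m i)%:R else - (m i).+1%:R) + c0 x.
Hypothesis act_h : {in h, forall x m, act x (Phi 'X_[m]) = mono_weight m x *: Phi 'X_[m]}.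
Variables (x0 : g) (k : 'I_n -> nat).
Hypothesis x0h : x0 \in h.
Hypothesis c_x0 : forall i, c i x0 = (k i).+1%:R.

Let Phi0 : Phi 0 = 0.
Proof. exact: linear_map0 Phi_lin. Qed.
Let PhiD p q : Phi (p + q) = Phi p + Phi q.
Proof. by have := Phi_lin 1 p q; rewrite !scale1r. Qed.
Let PhiZ a p : Phi (a *: p) = a *: Phi p.
Proof. by have := Phi_lin a p 0; rewrite Phi0 !addr0. Qed.

Lemma mweight_span v : exists r (mu : 'I_r -> g -> K) (w : 'I_r -> M),
  (forall i, weight_vector h act (mu i) (w i)) /\ v = \sum_i w i.
Proof.
have [p ->] := Phi_surj v.
exists (size (msupp p)), (fun i => mono_weight (nth 0%MM (msupp p) i)),
  (fun i => p@_(nth 0%MM (msupp p) i) *: Phi 'X_[nth 0%MM (msupp p) i]); split.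
  move=> i x xh; set m := nth _ _ _.
  have aZ a u : act x (a *: u) = a *: act x u.
    by have := act_lin x a u 0; rewrite (linear_map0 (act_lin x)) !addr0.
  by rewrite aZ act_h // !scalerA mulrC.
rewrite {1}[p]mpolyE (big_morph Phi PhiD Phi0) (big_nth 0%MM) big_mkord.
by apply: eq_bigr => i _; rewrite PhiZ.
Qed.

Definition diag (t : 'X_{1..n} -> K) (p : Q) : Q := \sum_(m <- msupp p) (t m * p@_m) *: 'X_[m].

Lemma diag_coeff t p m : (diag t p)@_m = t m * p@_m.
Proof.
rewrite /diag raddf_sum /=; under eq_bigr => i _ do rewrite mcoeffZ mcoeffX.
case: (boolP (m \in msupp p)) => [ms|ms].
  rewrite (bigD1_seq m) ?msupp_uniq //= eqxx mulr1 big1 ?addr0 // => i im.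
  by rewrite (negbTE im) mulr0.
rewrite (memN_msupp_eq0 ms) mulr0 big_seq big1 // => i ip.
by case: eqP => [e|]; rewrite ?mulr0 //; rewrite e (negbTE ms) in ip.
Qed.

Lemma act_diag x p : x \in h -> act x (Phi p) = Phi (diag (mono_weight^~ x) p).
Proof.
move=> xh; rewrite {1}[p]mpolyE (big_morph Phi PhiD Phi0).
have aD : {morph act x : u v / u + v} by move=> u v; have := act_lin x 1 u v; rewrite !scale1r.
have a0 := linear_map0 (act_lin x).
rewrite (big_morph (act x) aD a0) /diag (big_morph Phi PhiD Phi0).
apply: eq_bigr => m _; rewrite !PhiZ.
have := act_lin x p@_m (Phi 'X_[m]) 0; rewrite a0 !addr0 => ->.
by rewrite act_h // scalerA mulrC.
Qed.

(** The monomials diagonalize the action of x, so a power of an operator x - a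
has the same kernel as the operator. *)
Lemma mweight_semisimple x a j v : x \in h ->
  iter j (fun u => act x u - a *: u) v = 0 -> act x v = a *: v.
Proof.
move=> xh; have [p ->] := Phi_surj v.
have shift q : act x (Phi q) - a *: Phi q = Phi (diag (fun m => mono_weight m x - a) q).
  rewrite act_diag // -PhiZ -scaleN1r -PhiZ -PhiD; congr Phi; apply/mpolyP => m.
  by rewrite mcoeffD !mcoeffZ !diag_coeff; ring.
have it : exists2 q, iter j (fun u => act x u - a *: u) (Phi p) = Phi q &
    forall m, q@_m = (mono_weight m x - a) ^+ j * p@_m.
  elim: j => [|j [q e qm]]; first by exists p => // m; rewrite mul1r.
  exists (diag (fun m => mono_weight m x - a) q); first by rewrite iterS e shift.
  by move=> m; rewrite diag_coeff qm mulrA exprS.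
have [q -> qm] := it => /Phi_inj q0.
apply/eqP; rewrite -subr_eq0 shift; apply/eqP; rewrite -[RHS]Phi0; congr Phi.
apply/mpolyP => m; rewrite diag_coeff mcoeff0.
have /eqP := qm m; rewrite q0 mcoeff0 eq_sym mulf_eq0 expf_eq0.
by case/orP => [/andP[_ /eqP ->]|/eqP ->]; rewrite ?mul0r ?mulr0.
Qed.

(** The nonzero factors are, up to sign, the quotients of factorials of an
iterated derivative. *)
Lemma iter_act_f j p : exists2 q, iter j (act f) (Phi p) = Phi q &
  forall m, exists2 a : K, a != 0 & q@_m = a * p@_(m + U_(th) *+ j).
Proof.
elim: j => [|j [q e qm]].
  by exists p => // m; exists 1; rewrite ?oner_eq0 // mul1r mulm0n addm0.
exists (- q^`M(th)); first by rewrite iterS e act_f.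
move=> m; have [a a0 ea] := qm (m + U_(th))%MM.
exists (- (a *+ (m th).+1)); first by rewrite oppr_eq0 mulrn_eq0.
rewrite mcoeffN mcoeff_deriv ea mulNr mulrnAl; congr (- (_ * p@__ *+ _)).
by rewrite mulmS addmA.
Qed.

Lemma model_f_nilpotent v : exists j, iter j (act f) v = 0.
Proof.
have [p ->] := Phi_surj v; exists (msize p).
have [q -> qm] := iter_act_f (msize p) p.
rewrite -[RHS]Phi0; congr Phi; apply/mpolyP => m; rewrite mcoeff0.
have [a _ ->] := qm m; rewrite memN_msupp_eq0 ?mulr0 //.
apply/negP => /msize_mdeg_lt; rewrite mdegD mdegMn mdeg1 mul1n.
by rewrite ltnNge leq_addl.
Qed.

(** The weight at x0 is, up to a constant, k_th + 1 times the distinguished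
exponent minus a combination with positive coefficients of the others; as the
first is less than j, all the others are bounded. *)
Lemma model_weight_findim mu j : exists r (b : 'I_r -> M), forall v,
  weight_vector h act mu v -> iter j (act f) v = 0 ->
  exists cc : 'I_r -> K, v = \sum_i cc i *: b i.
Proof.
have [B BP] : exists B, forall m, mono_weight m x0 = mu x0 -> (m th < j)%N -> (mdeg m < B)%N.
  case: (pselect (exists m, mono_weight m x0 = mu x0)) => [[m0 e0]|no]; last first.
    by exists 0%N => m em; case: no; exists m.
  pose S m := (\sum_(i < n | i != th) (k i).+1 * (m i).+1)%N.
  have SE m : mono_weight m x0 = (k th).+1%:R * (m th)%:R - (S m)%:R + c0 x0.
    rewrite /mono_weight (bigD1 th) //= eqxx c_x0 natr_sum -sumrN; congr (_ + _ + _).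
    by apply: eq_bigr => i /negbTE ->; rewrite c_x0 mulrN -natrM.
  exists (j + S m0 + (k th).+1 * j).+1 => m em mj; rewrite ltnS.
  have e : (S m + (k th).+1 * m0 th = S m0 + (k th).+1 * m th)%N.
    apply/eqP; rewrite -(eqr_nat K) !natrD !natrM; apply/eqP.
    have := etrans em (esym e0); rewrite !SE => /addIr e1.
    apply/eqP; rewrite -subr_eq0; apply/eqP.
    by move/eqP: e1; rewrite -subr_eq0 => /eqP e1; rewrite -[RHS]oppr0 -e1; ring.
  have le : (mdeg m <= m th + S m)%N.
    rewrite mdegE (bigD1 th) //= leq_add2l /S leq_sum // => i _.
    by rewrite mulSn (leq_trans (leqnSn _)) // leq_addr.
  nia.
exists #|{: 'X_{1..n < B}}|, (fun i => Phi 'X_[enum_val i : 'X_{1..n < B}]) => v.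
have [p ->] := Phi_surj v => wp fp.
have pB : (msize p <= B)%N.
  rewrite msizeE; apply/bigmax_leqP_seq => m mp _; apply: BP.
    have := wp x0 x0h; rewrite act_diag // -PhiZ => /eqP.
    rewrite -subr_eq0 -scaleN1r -PhiZ -PhiD => /eqP/Phi_inj/mpolyP/(_ m).
    rewrite mcoeffD !mcoeffZ diag_coeff mcoeff0 mulN1r -mulrBl => /eqP.
    by rewrite mulf_eq0 mcoeff_eq0 mp orbF subr_eq0 => /eqP.
  rewrite ltnNge; apply/negP => jm.
  have [q eq qm] := iter_act_f j p; have q0 : q = 0 by apply: Phi_inj; rewrite -eq.
  have [a a0] := qm (m - U_(th) *+ j)%MM.
  rewrite submK; last first.
    by apply/mnm_lepP => l; rewrite mulmnE mnm1E; case: eqP => [<-|_]; rewrite ?mul1n ?mul0n.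
  rewrite q0 mcoeff0 => /eqP; rewrite eq_sym mulf_eq0 (negbTE a0) /=.
  by rewrite mcoeff_msupp in mp; rewrite (negbTE mp).
exists (fun i => p@_(enum_val i : 'X_{1..n < B})).
rewrite {1}(mpolywE pB) (big_morph Phi PhiD Phi0).
rewrite -(big_enum_val (fun m : 'X_{1..n < B} => p@_m *: Phi 'X_[m])) /=.
by apply: eq_big => // m _; rewrite PhiZ.
Qed.
End MonomialModule.

Section EulerWeights.
Variables (K : fieldType) (n : nat) (th : 'I_n).

(** In the Fourier transformed variables, x_i d/dx_i becomes minus the derivation
after the multiplication, hence the shift by one. *)
Lemma model_euler i m : lact (wx K i * wd K i) (model th 'X_[m]) =
  (if i == th then (m i)%:R else - (m i).+1%:R) *: model th 'X_[m] :> W_gt K th.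
Proof.
rewrite lactM; case: (eqVneq i th) => [e|ne].
  have <- : derop K th i = wd K i by rewrite /derop e eqxx.
  have <- : mulop K th i = wx K i by rewrite /mulop e eqxx.
  rewrite model_deriv model_mul -modelZ; congr model; rewrite mderivX -scalerAr.
  case: (posnP (m i)) => [-> |mi]; first by rewrite !scale0r.
  rewrite -mpolyXD addmC submK //; apply/mnm_lepP => l; rewrite mnm1E.
  by case: eqP => [<-|].
have <- : mulop K th i = wd K i by rewrite /mulop (negbTE ne).
have -> : wx K i = - derop K th i by rewrite /derop (negbTE ne) opprK.
rewrite model_mul lactN model_deriv -modelN -modelZ; congr model.
rewrite -mpolyXD mderivX mnmDE mnm1E eqxx scaleNr; congr (- (_ *: 'X_[_])).
by rewrite addmC addmK.
Qed.

Lemma model_affine (c : 'I_n -> K) (c0 : K) m :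
  lact (vfield (fun i => c i *: 'X_i) + c0%:A) (model th 'X_[m]) =
  (\sum_i c i * (if i == th then (m i)%:R else - (m i).+1%:R) + c0) *:
    model th 'X_[m] :> W_gt K th.
Proof.
rewrite lactD lactZ lact1 scalerDl; congr (_ + _).
rewrite /vfield lact_sum scaler_suml; apply: eq_bigr => i _.
by rewrite weyl_of_polyE pevalZ pevalX -scalerAl lactZ model_euler scalerA.
Qed.
End EulerWeights.

(** * The module W *)

(** The complex numbers enter only through their algebraic closedness and the
ordering of the integers among them. *)
Theorem W_gt_H_fin (K : numClosedFieldType) (g : lieAlgType K) (h : {vspace g})
    (n : nat) (alpha : 'I_n -> dual h) (f : 'I_n -> g) (th : 'I_n)
    (e hh : g) (lambda : dual h) :
  simple_lie g -> cartan_subalgebra h -> positive_root_system alpha ->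
  maximal_root alpha th -> root_basis alpha f ->
  sl2_triple alpha th e hh (f th) ->
  H_fin h <<[:: e; hh; f th]>>%VS (@W_gt_act K g h n alpha f th lambda).
Proof.
move=> simp cart [alpha_inj [s [sbase alphaP]]] th_max [f_root f_basis].
case=> [[eR hhH fR] [he hf ef]].
have [w [a [wB wa]]] := weight_basis cart.
have [u0 u0P] := grading_element sbase.
have [h_ab _ _] := cart.
pose mu := lambda + rho alpha.
pose pn : g -> g := proj_nilp_opp alpha.
have pn_mem x : pn x \in nilp_opp alpha by apply: proj_nm_mem.
have pn_id x : x \in nilp_opp alpha -> pn x = x.
  exact: (proj_nm_id cart alphaP wB wa u0P).
have pn_compl x : x - pn x \in (h + Defs.nilp alpha)%VS.
  exact: (proj_nm_compl simp cart sbase alphaP wB wa u0P).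
have pn_b x : x \in (h + Defs.nilp alpha)%VS -> pn x = 0.
  exact: (proj_nm_b simp cart sbase alphaP wB wa u0P).
have nm_l x y : x \in nilp_opp alpha -> y \in nilp_opp alpha -> lie x y \in nilp_opp alpha.
  exact: (nm_lie simp cart sbase alphaP wB wa u0P).
have b_l x y : x \in (h + Defs.nilp alpha)%VS -> y \in (h + Defs.nilp alpha)%VS ->
    lie x y \in Defs.nilp alpha.
  exact: (borel_lie cart alphaP u0P).
have h0 x : x \in (nilp_opp alpha + Defs.nilp alpha)%VS -> proj_h alpha x = 0.
  exact: (proj_h_0 cart alphaP wB wa u0P).
have wt0 (nu : dual h) x : x \in (nilp_opp alpha + Defs.nilp alpha)%VS ->
    nu (vsproj h (proj_h alpha x)) = 0.
  by move=> xn; rewrite h0 // !linear0.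
have pn_pn x y : pn (lie (pn x) (pn y)) = lie (pn x) (pn y) by apply/pn_id/nm_l.
have pn_qq x y : pn (lie (x - pn x) (y - pn y)) = 0.
  by apply: pn_b; apply: subvP (addvSr _ _) _ _; apply: b_l.
have fF : free [tuple f j | j < n] := basis_free f_basis.
have f_coord x : \sum_i coord [tuple f j | j < n] i (pn x) *: f i = pn x.
  rewrite [RHS](coord_basis f_basis (pn_mem x)); apply: eq_bigr => i _.
  by rewrite -tnth_nth tnth_mktuple.
have pn_f i : pn (f i) = f i by apply: pn_id; apply: (mem_nm (f_root i)).
have wt_n (nu : dual h) x : nu (vsproj h (proj_h alpha (pn x))) = 0.
  by apply: wt0; apply: subvP (addvSl _ _) _ _.
have wt_pn (nu : dual h) x y : nu (vsproj h (proj_h alpha (lie (pn x) (pn y)))) = 0.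
  by rewrite -pn_pn.
have wt_qq (nu : dual h) x y : nu (vsproj h (proj_h alpha (lie (x - pn x) (y - pn y)))) = 0.
  by apply: wt0; apply: subvP (addvSr _ _) _ _; apply: b_l.
have fl i k v : v \in flag f k -> lie (f i) v \in flag f k.+1 := @flag_lie _ _ _ f i k v.
have fd : flag f (\dim {:g}) = 0%VS by apply: (flag_dim sbase alphaP wB wa u0P f_root).
have act_bracket := pi_mu_lie pn_pn pn_qq fF f_coord pn_f (wt_pn (mu + rho alpha))
  (wt_qq (mu + rho alpha)) (center_trivial simp) (erefl : flag f 0 = fullv) fl fd.
have actP : lie_module (@W_gt_act K g h n alpha f th lambda).
  split=> [x|v|x y v].
  - exact: lact_linear.
  - move=> c x y.
    by apply: etrans (congr1 (fun z => lact z v) (pi_mu_linear alpha f mu c x y)) _; apply: lact_comb.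
  - by apply: etrans (congr1 (fun z => lact z v) (act_bracket x y)) _; apply: lact_comm.
have act_f p : @W_gt_act K g h n alpha f th lambda (f th) (model th p) = model th (- p^`M(th)).
  have pf := pi_mu_f fF pn_f (erefl : flag f 0 = fullv) fl fd (wt_n (mu + rho alpha))
    (f_th_central simp cart sbase alphaP wB wa u0P f_root alpha_inj th_max).
  apply: etrans (congr1 (fun z => lact z (model th p)) pf) _.
  by rewrite lactN modelN -model_deriv /derop eqxx.
pose c i x : K := alpha i (vsproj h x).
pose c0 x : K := (mu + rho alpha) (vsproj h (proj_h alpha x)).
have act_h : {in h, forall x m, @W_gt_act K g h n alpha f th lambda x (model th 'X_[m]) =
    mono_weight th c c0 m x *: model th 'X_[m]}.
  move=> x xh m; have fx i : lie (f i) x = c i x *: f i.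
    by rewrite lieC (lie_h_f f_root) // scaleNr opprK.
  have xn : pn x = 0 by apply: pn_b; apply: subvP (addvSl _ _) _ xh.
  have ph := pi_mu_h pn_pn fF f_coord pn_f (erefl : flag f 0 = fullv) fl fd
    (wt_n (mu + rho alpha)) xn fx.
  apply: etrans (congr1 (fun z => lact z (model th 'X_[m])) ph) _.
  exact: model_affine.
have /choice[k kP] i : exists k : nat, (alpha i u0 : K) = k.+1%:R.
  exact: (alpha_height alphaP u0P).
have c_x0 i : c i (vsval u0) = (k i).+1%:R by rewrite /c vsvalK kP.
apply: (gelfand_tsetlin_criterion (t := c th)) => //.
- move=> x xh; have /root_spaceP/(_ (vsproj h x)) := eR; by rewrite vsprojK.
- by move=> x xh; apply: (lie_h_f f_root).
- apply: (mweight_span _ (@model_linear K n th) (@model_surj K n th) act_h) => x.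
  by case: actP.
- apply: (mweight_semisimple _ (@model_linear K n th) (@model_surj K n th)
    (@model_inj K n th) act_h) => x.
  by case: actP.
- exact: (model_f_nilpotent (@model_linear K n th) (@model_surj K n th) act_f).
- apply: (model_weight_findim _ (@model_linear K n th) (@model_surj K n th)
    (@model_inj K n th) act_f act_h (subvsP u0) c_x0) => x.
  by case: actP.
Qed.

Theorem theorem2p11 (R : realType) (g : lieAlgType R[i]) (h : {vspace g})
    (n : nat) (alpha : 'I_n -> dual h) (f : 'I_n -> g) (theta : 'I_n)
    (e_theta h_theta : g) (lambda : dual h) :
  simple_lie g ->
  ~ isomorphic_to_sl2 g ->
  cartan_subalgebra h ->
  positive_root_system alpha ->
  maximal_root alpha theta ->
  root_basis alpha f ->
  sl2_triple alpha theta e_theta h_theta (f theta) ->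
  H_fin h <<[:: e_theta; h_theta; f theta]>>%VS
    (@W_gt_act R[i] g h n alpha f theta lambda).
Proof.
move=> simp _ cart pos th_max fb sl2.
exact: (@W_gt_H_fin R[i] g h n alpha f theta e_theta h_theta lambda).
Qed.
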